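(* (Spectral Theorem, archetypal form) Let $B$ be a commutative C*-algebra of bounded linear operators acting non-degenerately on a Hilbert space $H\neq\{0\}$. There exists a unique resolution of identity $P$ on $\Delta(B)$, acting on $H$, such that $$b=\int\hat b\,dP\quad\text{(in norm)}\qquad\text{for all }b\in B.$$ Moreover $B'=P'$, and the support of $P$ is all of $\Delta(B)$.
   Context: Hilbert spaces are complex. $B$ is a norm-closed commutative $*$-subalgebra of $B(H)$; it acts non-degenerately if $bx=0$ for all $b\in B$ implies $x=0$. $\Delta(B)$ is the set of non-zero multiplicative linear functionals on $B$ with the topology of pointwise convergence on $B$ (relative weak* topology); it is a locally compact Hausdorff space. $\hat b(\tau)=\tau(b)$ for $\tau\in\Delta(B)$. A spectral measure $P$ defined on a $\sigma$-algebra $\mathcal{E}$ on a set $\Omega\ne\varnothing$ and acting on $H$ is a map $P:\mathcal{E}\to B(H)$ such that each $P(\omega)$ is an orthogonal projection, $P(\Omega)=1$, and $\omega\mapsto\langle P(\omega)x,x\rangle$ is a measure for every $x\in H$. A resolution of identity on a locally compact Hausdorff space $\Omega\neq\varnothing$ is a spectral measure on the Borel $\sigma$-algebra of $\Omega$ such that all measures $\langle Px,x\rangle$ are inner regular ($\mu(\omega)=\sup\{\mu(K):K\subset\omega\text{ compact}\}$). Its support is $\Omega\setminus\omega$, where $\omega$ is the largest open set with $P(\omega)=0$. For a bounded measurable complex function $f$ and $b\in B(H)$, $b=\int f\,dP$ (in norm) means that $\|b-I_P(h)\|\leq|f-h|_\infty$ (supremum norm) for every measurable step function $h$, where $I_P$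 is the linear map on step functions with $I_P(1_\omega)=P(\omega)$. $B'$ and $P'$ denote the sets of operators in $B(H)$ commuting with all elements of $B$, respectively with all $P(\omega)$. *)

(* Defs.v *)
From HB Require Import structures.
From mathcomp Require Import all_boot all_order all_algebra.
From mathcomp Require Import all_classical all_reals all_analysis.
From mathcomp Require Import complex.

Set Implicit Arguments.
Unset Strict Implicit.
Unset Printing Implicit Defensive.

Import Order.TTheory GRing.Theory Num.Theory.
Import numFieldNormedType.Exports.

Local Open Scope classical_set_scope.
Local Open Scope ring_scope.
Local Open Scope complex_scope.

(* Complex Hilbert spaces: Banach spaces over R[i] whose norm is induced by an
   inner product, linear in its first and conjugate-linear in its second
   argument. *)
HB.mixin Record CompleteNormedModule_isHilbert (R : realType) H
    & CompleteNormedModule R[i] H := {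
  inner : {dot H for (@Num.conj R[i])} ;
  inner_norm : forall x : H, inner x x = `|x| ^+ 2
}.

#[short(type="hilbertType")]
HB.structure Definition Hilbert (R : realType) :=
  {H of CompleteNormedModule R[i] H & CompleteNormedModule_isHilbert R H}.

(* Over R[i], norms are nonnegative real elements of R[i] in the library;
   rnorm v is the corresponding element of R. *)
Definition rnorm (R : realType) (V : normedZmodType R[i]) (v : V) : R :=
  complex.Re `|v|.

Section Operators.
Context {R : realType} {H : hilbertType R}.
Implicit Types (a b c : H -> H) (S B : set (H -> H)).

(* Operators are plain functions H -> H: sums and scalar multiples are those of
   the library's pointwise module structure on H -> H, products are
   compositions. *)

Definition bounded_operator b : Prop :=
  linear b /\ exists M : R, forall x : H, rnorm (b x) <= M * rnorm x.

Definition opnorm b : R :=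
  sup [set rnorm (b x) | x in [set x : H | rnorm x <= 1]].

Definition is_adjoint b c : Prop := forall x y : H, inner (b x) y = inner x (c y).

Definition orthogonal_projection p : Prop :=
  [/\ bounded_operator p, p \o p = p & is_adjoint p p].

Definition norm_closed S : Prop :=
  forall b, bounded_operator b ->
    (forall e : R, 0 < e -> exists2 c, S c & opnorm (b - c) < e) -> S b.

Record commutative_cstar_algebra B : Prop := {
  cstar_bounded : forall b, B b -> bounded_operator b ;
  cstar_0 : B 0 ;
  cstar_add : forall b c, B b -> B c -> B (b + c) ;
  cstar_scale : forall (z : R[i]) b, B b -> B (z *: b) ;
  cstar_mul : forall b c, B b -> B c -> B (b \o c) ;
  cstar_adjoint : forall b, B b -> exists2 c, B c & is_adjoint b c ;
  cstar_closed : norm_closed B ;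
  cstar_comm : forall b c, B b -> B c -> b \o c = c \o b }.

Definition acts_nondegenerately B : Prop :=
  forall x : H, (forall b, B b -> b x = 0) -> x = 0.

Definition commutant S : set (H -> H) :=
  [set a | bounded_operator a /\ forall s, S s -> a \o s = s \o a].

End Operators.

Section GelfandSpectrum.
Context {R : realType} {H : hilbertType R}.
Variable B : set (H -> H).

(* B, used as a type, has no algebraic structure of its own: additivity,
   homogeneity and multiplicativity are expressed on the underlying operators. *)
Definition is_character (tau : B -> R[i]^o) : Prop :=
  [/\ exists b : B, tau b != 0,
      forall (z : R[i]) (b c d : B),
        val d = z *: val b + val c -> tau d = z * tau b + tau c &
      forall b c d : B, val d = val b \o val c -> tau d = tau b * tau c].

(* Used as a type, this set carries the topology induced by {ptws B -> R[i]^o},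
   that is, the topology of pointwise convergence on B. *)
Definition spectrum : set {ptws B -> R[i]^o} := [set tau | is_character tau].

Definition gelfand (b : B) (tau : spectrum) : R[i] := val tau b.

End GelfandSpectrum.

Arguments spectrum {R H} B _.

Section SpectralMeasures.
Context {R : realType} {H : hilbertType R}.

(* Nonnegative, countably additive and finite. The library's measures live on
   pointed types only, whereas here the non-emptiness of the underlying set is
   part of what has to be asserted. *)
Definition is_finite_measure (T : Type) (E : set_system T) (mu : set T -> R) :
    Prop :=
  [/\ mu set0 = 0,
      forall w, E w -> 0 <= mu w &
      forall F : (set T)^nat, (forall n, E (F n)) -> trivIset [set: nat] F ->
        series (mu \o F) @ \oo --> mu (\bigcup_n F n)].

(* The numbers <P(w) x, x> are real as soon as P(w) is self-adjoint. *)
Definition diag_measure (T : Type) (P : set T -> H -> H) (x : H) (w : set T) : R :=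
  complex.Re (inner (P w x) x).

(* P is a total function on the subsets of T, of which only the values on E are
   meaningful. *)
Record spectral_measure (T : Type) (E : set_system T) (P : set T -> H -> H) : Prop := {
  spectral_sigma_algebra : sigma_algebra [set: T] E ;
  spectral_nonempty : [set: T] !=set0 ;
  spectral_projection : forall w, E w -> orthogonal_projection (P w) ;
  spectral_setT : P [set: T] = id ;
  spectral_diag : forall x : H, is_finite_measure E (diag_measure P x) }.

Definition borel (T : topologicalType) : set_system T := <<s @open T >>.

Definition inner_regular (T : topologicalType) (mu : set T -> R) : Prop :=
  forall w, borel w -> mu w = sup [set mu K | K in [set K | compact K /\ K `<=` w]].

Record resolution_of_identity (T : topologicalType) (P : set T -> H -> H) : Prop := {
  resolution_hausdorff : hausdorff_space T ;
  resolution_locally_compact : locally_compact [set: T] ;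
  resolution_spectral : spectral_measure (@borel T) P ;
  resolution_regular : forall x : H, inner_regular (diag_measure P x) }.

Definition is_support (T : topologicalType) (P : set T -> H -> H) (S : set T) : Prop :=
  exists w : set T,
    [/\ open w, P w = 0,
        forall v : set T, open v -> P v = 0 -> v `<=` w &
        S = ~` w].

Definition supnorm (T : Type) (f : T -> R[i]) : R := sup (range (fun t => rnorm (f t))).

(* step_integral E P is the graph of I_P, the linear extension of
   1_w |-> P(w) (w in E) to the E-measurable step functions. *)
Definition step_integral (T : Type) (E : set_system T) (P : set T -> H -> H)
    (h : T -> R[i]) (b : H -> H) : Prop :=
  exists (n : nat) (z : 'I_n -> R[i]) (w : 'I_n -> set T),
    [/\ forall i, E (w i),
        h = \sum_(i < n) z i *: (\1_(w i) : T -> R[i]^o) &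
        b = \sum_(i < n) z i *: P (w i)].

(* b is the integral of the bounded E-measurable function f, in norm. *)
Definition is_norm_integral (T : Type) (E : set_system T) (P : set T -> H -> H)
    (f : T -> R[i]) (b : H -> H) : Prop :=
  [/\ exists M : R, forall t, rnorm (f t) <= M,
      forall U : set R[i]^o, open U -> E (f @^-1` U) &
      forall h c, step_integral E P h c -> opnorm (b - c) <= supnorm (f - h)].

End SpectralMeasures.

(* Main.v *)
Require Import Defs.
From HB Require Import structures.
From mathcomp Require Import all_boot all_order all_algebra.
From mathcomp Require Import all_classical all_reals all_analysis.
From mathcomp Require Import complex.
From mathcomp Require Import ring lra.

(** The Gelfand transform turns the self-adjoint elements of B into real
    functions on the spectrum X, and the measure is recovered from the order
    between them, one open set at a time.

    The real part of the inner product makes H a real Hilbert space.  Positive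
    elements of B have square roots in B, obtained by a norm-convergent
    iteration (cstar_sqrt); hence self-adjoint elements have positive parts in
    B.  A Neumann series bounds characters by the operator norm (ev_bound),
    which makes them *-preserving and monotone.  Conversely there are enough of
    them: finitely many elements of B have joint approximate eigenvectors, whose
    vector states converge along an ultrafilter to a character, and the range
    in which these vectors lie can be chosen so that this character does not
    vanish at a given self-adjoint p != 0 (ev_separates).  So an element of B is
    positive as soon as its Gelfand transform is (psd_ev).  The same ultrafilter
    argument shows that level sets of Gelfand transforms are compact
    (compact_ev_ge), and positive parts provide elements of B playing the role
    of Urysohn functions (below_basis).

    For U open, the elements of B with values in [0, 1] that vanish outside U
    form an increasing net, whose strong limit is a projection P(U)
    (sup_projection).  Compactness shows that a vector killed by all P(U_i) is
    killed by P(U), U being the union of the U_i (openproj_bigcup_ker).  For an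
    arbitrary set A let P(A) be the infimum of the P(U) over the open U that
    contain A: this is a countably subadditive outer measure with values in
    projections, and Caratheodory's argument applies (outer_bigcup_ker,
    borel_splits), which gives a countably additive measure on the Borel sets.
    Wherever a Gelfand transform is within r of a constant z, so is the operator
    within r of z on the range of the corresponding projection (outer_local);
    summed over orthogonal pieces this is the norm integral formula
    (step_estimate).  Inner regularity comes from the definition of P(A) by open
    sets and from the compactness of level sets (outer_regular).

    Let Q be another measure.  The integral formula approximates elements of B
    in norm by combinations of the Q(w), whence the vectors killed by Q(U) are
    killed by P(U).  Conversely, if P(U) y = 0 then for K compact inside U some v
    in B exceeds 1 on K and kills y, so Q(K) y = 0; by inner regularity
    Q(U) y = 0.  Thus Q(U) = P(U) for U open (integral_open), and inner
    regularity settles all Borel sets.  The P(w) are strong limits of elements of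
    B, and these are norm limits of combinations of the P(w), so both have the
    same commutant.  Finally, a non-empty open U carries some non-zero u in B
    vanishing outside U, and P(U) = 0 would force u = 0: the support is X. *)

Set Implicit Arguments.
Unset Strict Implicit.
Unset Printing Implicit Defensive.

Import Order.TTheory GRing.Theory Num.Theory.
Import numFieldNormedType.Exports.

Local Open Scope classical_set_scope.
Local Open Scope ring_scope.
Local Open Scope complex_scope.

(** * The underlying real Hilbert space *)

Section RealStructure.
Context {R : realType}.

(** Norms on R[i]-spaces take values in R[i]; the estimates are carried out on
    their real counterparts rnorm. *)
Lemma normE (V : normedZmodType R[i]) (v : V) : `|v| = (rnorm v)%:C.
Proof. by rewrite /rnorm RRe_real // normr_real. Qed.

Lemma rnorm_ge0 (V : normedZmodType R[i]) (v : V) : 0 <= rnorm v.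
Proof. rewrite -lecR -normE; exact: normr_ge0. Qed.

Lemma rnorm0 (V : normedZmodType R[i]) : rnorm (0 : V) = 0.
Proof. by rewrite /rnorm normr0. Qed.

Lemma rnormN (V : normedZmodType R[i]) (v : V) : rnorm (- v) = rnorm v.
Proof. by rewrite /rnorm normrN. Qed.

Lemma rnormD (V : normedZmodType R[i]) (v w : V) :
  rnorm (v + w) <= rnorm v + rnorm w.
Proof. by rewrite -lecR rmorphD /= -!normE ler_normD. Qed.

Lemma rnormB (V : normedZmodType R[i]) (v w : V) :
  rnorm (v - w) <= rnorm v + rnorm w.
Proof. by rewrite -(rnormN w) rnormD. Qed.

Lemma rdistC (V : normedZmodType R[i]) (v w : V) : rnorm (v - w) = rnorm (w - v).
Proof. by rewrite -rnormN opprB. Qed.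

Lemma rnorm_dist (V : normedZmodType R[i]) (u v w : V) :
  rnorm (v - w) <= rnorm (v - u) + rnorm (u - w).
Proof. by rewrite -[v - w](subrKA u) rnormD. Qed.

Lemma rnorm_eq0 (V : normedZmodType R[i]) (v : V) : rnorm v = 0 -> v = 0.
Proof. by move=> h; apply/eqP; rewrite -normr_eq0 normE h. Qed.

Lemma rnorm_gt0 (V : normedZmodType R[i]) (v : V) : v != 0 -> 0 < rnorm v.
Proof.
by move=> v0; rewrite lt_neqAle rnorm_ge0 andbT eq_sym; apply: contra_neq v0 => /rnorm_eq0.
Qed.

Lemma rnormZ (V : normedModType R[i]) (z : R[i]) (v : V) :
  rnorm (z *: v) = rnorm z * rnorm v.
Proof. by apply: (@complexI R); rewrite rmorphM /= -!normE normrZ. Qed.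

Lemma rnormM (z w : R[i]) : rnorm (z * w) = rnorm z * rnorm w.
Proof. by apply: (@complexI R); rewrite rmorphM /= -!normE normrM. Qed.

Lemma rnorm_real (r : R) : rnorm r%:C = `|r|.
Proof. by rewrite /rnorm normc_def /= expr0n /= addr0 sqrtr_sqr. Qed.

Lemma rnorm_sqr (z : R[i]) : rnorm z ^+ 2 = complex.Re z ^+ 2 + complex.Im z ^+ 2.
Proof.
by rewrite /rnorm normc_def /= sqr_sqrtr // addr_ge0 // sqr_ge0.
Qed.

Lemma rnorm_i : rnorm ('i%C : R[i]) = 1.
Proof.
apply/eqP; rewrite -(eqrXn2 (n := 2)) ?rnorm_ge0 // rnorm_sqr /=.
by rewrite expr0n /= add0r expr1n.
Qed.

Lemma realC_eq0 (r : R) : ((r%:C : R[i]) == 0) = (r == 0).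
Proof. by rewrite -(rmorph0 (real_complex R)) (inj_eq (@complexI R)). Qed.

Lemma rnorm_Re (z : R[i]) : `|complex.Re z| <= rnorm z.
Proof.
rewrite -(ler_pXn2r (n := 2)) ?nnegrE ?rnorm_ge0 // rnorm_sqr.
by rewrite real_normK ?num_real // lerDl sqr_ge0.
Qed.

Lemma rnorm_Im (z : R[i]) : `|complex.Im z| <= rnorm z.
Proof.
rewrite -(ler_pXn2r (n := 2)) ?nnegrE ?rnorm_ge0 // rnorm_sqr.
by rewrite real_normK ?num_real // lerDr sqr_ge0.
Qed.

Lemma le_eps (a b : R) : (forall e, 0 < e -> a <= b + e) -> a <= b.
Proof. by move=> h; apply/ler_addgt0Pr => e /h. Qed.

Lemma le0_eps (a k : R) : (forall e, 0 < e -> a <= k * e) -> a <= 0.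
Proof.
move=> h; have [k0|k0] := lerP k 0.
  by apply: le_trans (h 1 ltr01) _; rewrite mulr1.
apply/ler_addgt0Pr => e e0; rewrite add0r; apply: le_trans (h (e / k) _) _.
  by rewrite divr_gt0.
by rewrite mulrC divfK // gt_eqF.
Qed.

Lemma complete_filter (H : hilbertType R) (T : Type) (F : set_system T) (f : T -> H) :
  ProperFilter F ->
  (forall e : R, 0 < e -> exists x, \forall s \near F, rnorm (f s - x) <= e) ->
  exists l, forall e : R, 0 < e -> \forall s \near F, rnorm (f s - l) <= e.
Proof.
move=> PF h.
have : cvg (f @ F).
  apply: cauchy_cvg; apply: cauchy_exP => e e0.
  have e0' : 0 < complex.Re e.
    by move: e0; rewrite ltcE /= => /andP[].
  have eE : e = (complex.Re e)%:C by rewrite RRe_real // gtr0_real.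
  have [x hx] := h (complex.Re e / 2) (divr_gt0 e0' (ltr0n _ 2)).
  exists x; apply: filterS hx => s hs /=.
  rewrite -ball_normE /ball_ /= normE eE ltcR rdistC.
  apply: le_lt_trans hs _; lra.
move=> /cvg_ex[l hl]; exists l => e e0.
have /cvgrPdist_le/(_ e%:C) := hl; rewrite ltcR => /(_ e0).
by apply: filterS => s; rewrite normE lecR rdistC.
Qed.

End RealStructure.

Section RealInner.
Context {R : realType} {H : hilbertType R}.
Implicit Types (x y z : H) (a b c p : H -> H).

(** The inner product of H regarded as a real Hilbert space: no conjugations,
    and form inequalities become linear arithmetic. *)
Definition rdot x y : R := complex.Re (inner x y).

Lemma rdotE x : rdot x x = rnorm x ^+ 2.
Proof. by rewrite /rdot inner_norm normE -rmorphXn. Qed.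

Lemma innerC x y : inner x y = (inner y x)^*%C.
Proof.
rewrite (@hermitian_subproof _ _ _ _ inner x y) expr0 mul1r.
reflexivity.
Qed.

Lemma rdotC x y : rdot x y = rdot y x.
Proof. by rewrite /rdot innerC; case: (inner y x). Qed.

Lemma rdotDl x y z : rdot (x + y) z = rdot x z + rdot y z.
Proof. by rewrite /rdot linearDl raddfD. Qed.

Lemma rdotDr x y z : rdot z (x + y) = rdot z x + rdot z y.
Proof. by rewrite !(rdotC z) rdotDl. Qed.

Lemma rdotNl x y : rdot (- x) y = - rdot x y.
Proof. by rewrite /rdot linearNl raddfN. Qed.

Lemma rdotNr x y : rdot x (- y) = - rdot x y.
Proof. by rewrite !(rdotC x) rdotNl. Qed.

Lemma rdot0l x : rdot 0 x = 0.
Proof. by rewrite /rdot linear0l. Qed.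

Lemma rdot0r x : rdot x 0 = 0.
Proof. by rewrite rdotC rdot0l. Qed.

Lemma innerDl x y z : inner (x + y) z = inner x z + inner y z.
Proof. exact: linearDl. Qed.

Lemma innerZl (u : R[i]) x y : inner (u *: x) y = u * inner x y.
Proof. by rewrite linearZl. Qed.

Lemma rdotZl (r : R) x y : rdot (r%:C *: x) y = r * rdot x y.
Proof. by rewrite /rdot innerZl; case: (inner x y) => u v /=; rewrite mul0r subr0. Qed.

Lemma rdotZr (r : R) x y : rdot x (r%:C *: y) = r * rdot x y.
Proof. by rewrite !(rdotC x) rdotZl. Qed.

Definition rdotw := (rdotDl, rdotDr, rdotNl, rdotNr, rdotZl, rdotZr, rdot0l, rdot0r).

Lemma inner_rdot x y : inner x y = rdot x y +i* - rdot ('i%C *: x) y.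
Proof.
rewrite /rdot innerZl; case: (inner x y) => u v /=.
by rewrite mul0r mul1r sub0r opprK.
Qed.

Lemma rdot_i x y : rdot ('i%C *: x) y = - rdot x ('i%C *: y).
Proof.
rewrite /rdot (innerC x) !innerZl (innerC y x).
by case: (inner x y) => u v /=; ring.
Qed.

Lemma rdot_eq0 x : rdot x x = 0 -> x = 0.
Proof. by rewrite rdotE => /eqP; rewrite sqrf_eq0 => /eqP /rnorm_eq0. Qed.

Lemma rdot_ge0 x : 0 <= rdot x x.
Proof. by rewrite rdotE sqr_ge0. Qed.

Lemma rdotP x y : (forall z, rdot x z = rdot y z) -> x = y.
Proof.
move=> h; apply/eqP; rewrite -subr_eq0; apply/eqP/rdot_eq0.
by rewrite rdotDl rdotNl h subrr.
Qed.

Lemma rnorm_le_dot x (r : R) : 0 <= r -> rdot x x <= r ^+ 2 -> rnorm x <= r.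
Proof. by move=> r0; rewrite rdotE ler_pXn2r // nnegrE ?rnorm_ge0. Qed.

Lemma rdot_le_norms x y (k : R) :
  0 <= k -> (rdot x x <= k ^+ 2 * rdot y y) = (rnorm x <= k * rnorm y).
Proof.
move=> k0; rewrite !rdotE -exprMn ler_pXn2r // nnegrE ?rnorm_ge0 //.
by rewrite mulr_ge0 // rnorm_ge0.
Qed.

Lemma rdot_CS x y : `|rdot x y| <= rnorm x * rnorm y.
Proof.
suff key u v : rdot u v <= rnorm u * rnorm v.
  rewrite ler_norml key andbT lerNl -rdotNl -(rnormN x); exact: key.
have [u0|u0] := eqVneq u 0; first by rewrite u0 rdot0l mulr_ge0 // rnorm_ge0.
have [v0|v0] := eqVneq v 0; first by rewrite v0 rdot0r mulr_ge0 // rnorm_ge0.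
have nu := rnorm_gt0 u0; have nv := rnorm_gt0 v0.
have := rdot_ge0 ((rnorm v)%:C *: u - (rnorm u)%:C *: v).
rewrite !rdotw !rdotE (rdotC v u) => h.
have : 0 <= (2 * (rnorm u * rnorm v)) * (rnorm u * rnorm v - rdot u v) by nra.
by rewrite pmulr_rge0 ?subr_ge0 // !mulr_gt0.
Qed.

End RealInner.

(** * Operators and their forms *)

Section Operators.
Context {R : realType} {H : hilbertType R}.
Implicit Types (x y z : H) (a b c p : H -> H).

Lemma op_add a b x : (a + b) x = a x + b x. Proof. by []. Qed.
Lemma op_opp a x : (- a) x = - a x. Proof. by []. Qed.
Lemma op_scale (u : R[i]) a x : (u *: a) x = u *: a x. Proof. by []. Qed.
Lemma op_zero x : (0 : H -> H) x = 0. Proof. by []. Qed.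
Definition opE := (op_add, op_opp, op_scale, op_zero).

Lemma op_neq0 a : a != 0 -> exists x, a x != 0.
Proof.
move=> a0; apply: contrapT => h; move/eqP: a0; apply; apply/funext => x.
by apply/eqP/negP => hx; apply: h; exists x; apply/negP.
Qed.

Lemma linD a x y : linear a -> a (x + y) = a x + a y.
Proof. by move=> la; have := la 1 x y; rewrite !scale1r. Qed.

Lemma lin0 a : linear a -> a 0 = 0.
Proof.
move=> la; have := la (-1) 0 0.
by rewrite scaler0 addr0 scaleN1r addNr.
Qed.

Lemma linZ a (u : R[i]) x : linear a -> a (u *: x) = u *: a x.
Proof. by move=> la; have := la u x 0; rewrite (lin0 la) !addr0. Qed.

Lemma linN a x : linear a -> a (- x) = - a x.
Proof. by move=> la; rewrite -scaleN1r linZ // scaleN1r. Qed.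

Lemma linB a x y : linear a -> a (x - y) = a x - a y.
Proof. by move=> la; rewrite linD // linN. Qed.

Definition opbound a (M : R) : Prop := forall x, rnorm (a x) <= M * rnorm x.

Lemma bdd_lin a : bounded_operator a -> linear a.
Proof. by case. Qed.

Lemma bddP a : bounded_operator a -> exists2 M, 0 < M & opbound a M.
Proof.
case=> _ [M hM]; exists (`|M| + 1); first by rewrite ltr_wpDl.
move=> x; apply: le_trans (hM x) _; apply: ler_wpM2r; first exact: rnorm_ge0.
by apply: le_trans (ler_norm _) _; rewrite lerDl.
Qed.

Lemma opbound_mkbdd a M : linear a -> opbound a M -> bounded_operator a.
Proof. by move=> la h; split=> //; exists M. Qed.

Lemma lin_add a b : linear a -> linear b -> linear (a + b).
Proof.
by move=> la lb u x y; rewrite !opE (la u) (lb u) scalerDr addrACA.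
Qed.

Lemma lin_scale (u : R[i]) a : linear a -> linear (u *: a).
Proof.
by move=> la v x y; rewrite !opE (la v) scalerDr !scalerA mulrC.
Qed.

Lemma lin_comp a b : linear a -> linear b -> linear (a \o b).
Proof. by move=> la lb v x y; rewrite /= (lb v) (la v). Qed.

Lemma lin_opp a : linear a -> linear (- a).
Proof. by move=> la; rewrite -scaleN1r; exact: lin_scale. Qed.

Lemma lin_sub a b : linear a -> linear b -> linear (a - b).
Proof. by move=> la lb; apply: lin_add => //; exact: lin_opp. Qed.

Lemma lin_zero : linear (0 : H -> H).
Proof. by move=> v x y; rewrite !opE scaler0 addr0. Qed.

Lemma bdd_add a b : bounded_operator a -> bounded_operator b -> bounded_operator (a + b).
Proof.
move=> ba bb; have [M M0 hM] := bddP ba; have [N N0 hN] := bddP bb.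
apply: (@opbound_mkbdd _ (M + N)); first exact: lin_add (bdd_lin ba) (bdd_lin bb).
move=> x; rewrite opE mulrDl; apply: le_trans (rnormD _ _) _.
exact: lerD.
Qed.

Lemma bdd_scale (u : R[i]) a : bounded_operator a -> bounded_operator (u *: a).
Proof.
move=> ba; have [M M0 hM] := bddP ba.
apply: (@opbound_mkbdd _ (rnorm u * M)); first exact: lin_scale (bdd_lin ba).
by move=> x; rewrite opE rnormZ -mulrA ler_wpM2l // rnorm_ge0.
Qed.

Lemma bdd_sub a b : bounded_operator a -> bounded_operator b -> bounded_operator (a - b).
Proof. by move=> ba bb; apply: bdd_add => //; rewrite -scaleN1r; apply: bdd_scale. Qed.

Lemma bdd_id : bounded_operator (@id H).
Proof. by split=> //; exists 1 => x; rewrite mul1r. Qed.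

Lemma bdd_zero : bounded_operator (0 : H -> H).
Proof.
split; first exact: lin_zero.
by exists 0 => x; rewrite opE rnorm0 mul0r.
Qed.

Lemma opnorm_ub b : bounded_operator b ->
  has_ubound [set rnorm (b x) | x in [set x : H | rnorm x <= 1]].
Proof.
move=> bb; have [M M0 hM] := bddP bb; exists M => _ [x /= x1 <-].
by apply: le_trans (hM x) _; rewrite ler_piMr // ltW.
Qed.

Lemma opbound_opnorm b : bounded_operator b -> opbound b (opnorm b).
Proof.
move=> bb x; have lb := bdd_lin bb.
have [->|x0] := eqVneq x 0; first by rewrite lin0 // rnorm0 mulr0.
have nx := rnorm_gt0 x0.
rewrite -ler_pdivrMr // mulrC.
have -> : (rnorm x)^-1 * rnorm (b x) = rnorm (b ((rnorm x)^-1%:C *: x)).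
  by rewrite linZ // rnormZ rnorm_real ger0_norm // invr_ge0 ltW.
apply: ub_le_sup; first exact: opnorm_ub.
exists ((rnorm x)^-1%:C *: x) => //=.
by rewrite rnormZ rnorm_real ger0_norm ?mulVf ?gt_eqF // invr_ge0 ltW.
Qed.

Lemma opnorm_le b M : 0 <= M -> opbound b M -> opnorm b <= M.
Proof.
move=> M0 h; apply: ge_sup.
  by exists (rnorm (b 0)), 0 => //=; rewrite rnorm0.
move=> _ [x /= x1 <-]; apply: le_trans (h x) _.
by rewrite ler_piMr.
Qed.

(** For complex-linear operators this is self-adjointness: the imaginary part
    of the inner product is recovered by inserting a factor i, see
    sym_adjoint. *)
Definition sym a : Prop := forall x y, rdot (a x) y = rdot x (a y).

Lemma sym_add a b : sym a -> sym b -> sym (a + b).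
Proof. by move=> sa sb x y; rewrite !opE !rdotw sa sb. Qed.

Lemma sym_scale (r : R) a : sym a -> sym (r%:C *: a).
Proof. by move=> sa x y; rewrite !opE !rdotw sa. Qed.

Lemma sym_opp a : sym a -> sym (- a).
Proof. by move=> sa x y; rewrite !opE !rdotw sa. Qed.

Lemma sym_sub a b : sym a -> sym b -> sym (a - b).
Proof. by move=> sa sb; apply: sym_add => //; exact: sym_opp. Qed.

Lemma sym_zero : sym (0 : H -> H).
Proof. by move=> x y; rewrite !opE !rdotw. Qed.

Lemma sym_comp a b : sym a -> sym b -> a \o b = b \o a -> sym (a \o b).
Proof.
by move=> sa sb ab x y; rewrite /= sa sb -[b (a y)]/((b \o a) y) -ab.
Qed.

Lemma adjoint_rdot a b : is_adjoint a b -> forall x y, rdot (a x) y = rdot x (b y).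
Proof. by move=> h x y; rewrite /rdot h. Qed.

Lemma sym_adjoint a : linear a -> sym a -> is_adjoint a a.
Proof.
move=> la sa x y; rewrite !inner_rdot sa; congr (_ +i* - _).
by rewrite -linZ // sa.
Qed.

Lemma sym_eq0 a : linear a -> sym a -> (forall x, rdot (a x) x = 0) -> a = 0.
Proof.
move=> la sa h; apply/funext => x; apply: rdotP => y; rewrite opE rdot0l.
have := h (x + y); rewrite linD // !rdotw !h (sa y x) (rdotC y); lra.
Qed.

Lemma sym_eq a b : linear a -> linear b -> sym a -> sym b ->
  (forall x, rdot (a x) x = rdot (b x) x) -> a = b.
Proof.
move=> la lb sa sb h; apply/eqP; rewrite -subr_eq0; apply/eqP.
apply: sym_eq0; [exact: lin_sub|exact: sym_sub|].
by move=> x; rewrite !opE !rdotw h subrr.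
Qed.

(** Testing positivity on x - a x / e takes the place of the Cauchy-Schwarz
    inequality for semi-definite forms.  The hypotheses concern single vectors
    because 0 <= a <= e will sometimes be known only on an invariant subspace,
    such as the range of an operator commuting with a. *)
Lemma form_sandwich a (e : R) x : linear a -> sym a -> 0 < e ->
  0 <= rdot (a (x - e^-1%:C *: a x)) (x - e^-1%:C *: a x) ->
  rdot (a (a x)) (a x) <= e * rdot (a x) (a x) ->
  rdot (a x) (a x) <= e * rdot (a x) x.
Proof.
move=> la sa e0; rewrite linB // linZ // !rdotw (sa (a x) x) => h1 h2.
have : e * rdot (a x) (a x) <= e * (e * rdot (a x) x).
  have e1 : e^-1 * e = 1 by rewrite mulVf // gt_eqF.
  have f0 : 0 < e^-1 by rewrite invr_gt0.
  have h3 : e^-1 * (e^-1 * rdot (a (a x)) (a x)) <= e^-1 * rdot (a x) (a x).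
    apply: ler_wpM2l; first exact: ltW.
    by rewrite mulrC ler_pdivrMr // mulrC.
  have h4 : e^-1 * rdot (a x) (a x) <= rdot (a x) x by lra.
  by apply: ler_wpM2l; [exact: ltW|rewrite mulrC ler_pdivrMr // in h4; lra].
by rewrite ler_pM2l.
Qed.

Definition psd a : Prop := forall x, 0 <= rdot (a x) x.

Lemma effect_norm a : linear a -> sym a -> psd a -> psd (id - a) ->
  forall x, rdot (a x) (a x) <= rdot (a x) x.
Proof.
move=> la sa p1 p2 x.
have := @form_sandwich a 1 x la sa ltr01 (p1 _).
rewrite !mul1r; apply; have := p2 (a x); rewrite !opE !rdotw; lra.
Qed.

Lemma effect_bound a : linear a -> sym a -> psd a -> psd (id - a) -> opbound a 1.
Proof.
move=> la sa p1 p2 x; rewrite mul1r; apply: rnorm_le_dot; first exact: rnorm_ge0.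
rewrite -rdotE; apply: le_trans (effect_norm la sa p1 p2 x) _.
by have := p2 x; rewrite !opE !rdotw; lra.
Qed.

Lemma opbound_form M a x : 0 <= M -> opbound a M -> `|rdot (a x) x| <= M * rdot x x.
Proof.
move=> M0 h; apply: le_trans (rdot_CS _ _) _; rewrite rdotE expr2 mulrA.
by apply: ler_wpM2r; [exact: rnorm_ge0|exact: h].
Qed.

Lemma psd_form0 a : bounded_operator a -> sym a -> psd a ->
  forall x, rdot (a x) x = 0 -> a x = 0.
Proof.
move=> ba sa pa x hx; have [M M0 hM] := bddP ba.
apply: rdot_eq0; apply/eqP; rewrite eq_le rdot_ge0 andbT.
have := @form_sandwich a M x (bdd_lin ba) sa M0 (pa _).
rewrite hx mulr0; apply.
apply: le_trans (ler_norm _) _; apply: opbound_form => //; exact: ltW.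
Qed.

End Operators.

(** * Orthogonal projections and monotone limits *)

Section Projections.
Context {R : realType} {H : hilbertType R}.
Implicit Types (x y z : H) (a b c p q s : H -> H).

Lemma proj_lin p : orthogonal_projection p -> linear p.
Proof. by case=> /bdd_lin. Qed.

Lemma proj_bdd p : orthogonal_projection p -> bounded_operator p.
Proof. by case. Qed.

Lemma proj_idem p x : orthogonal_projection p -> p (p x) = p x.
Proof. by case=> _ h _; rewrite -[RHS](congr1 (@^~ x) h). Qed.

Lemma proj_sym p : orthogonal_projection p -> sym p.
Proof. by case=> _ _ h; exact: adjoint_rdot. Qed.

Lemma proj_dot p x : orthogonal_projection p -> rdot (p x) x = rdot (p x) (p x).
Proof. by move=> pp; rewrite -{1}(proj_idem _ pp) (proj_sym pp). Qed.

Lemma proj_psd p : orthogonal_projection p -> psd p.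
Proof. by move=> pp x; rewrite proj_dot // rdot_ge0. Qed.

Lemma projC_dot p x : orthogonal_projection p ->
  rdot (x - p x) (x - p x) = rdot x x - rdot (p x) (p x).
Proof. by move=> pp; rewrite !rdotw (rdotC x (p x)) proj_dot //; lra. Qed.

Lemma proj_bound p : orthogonal_projection p -> opbound p 1.
Proof.
move=> pp x; rewrite mul1r; apply: rnorm_le_dot; first exact: rnorm_ge0.
by have := rdot_ge0 (x - p x); rewrite projC_dot // rdotE; lra.
Qed.

Lemma proj_le p x : orthogonal_projection p -> rnorm (p x) <= rnorm x.
Proof. by move=> pp; have := proj_bound pp x; rewrite mul1r. Qed.

Lemma proj_subid p : orthogonal_projection p -> psd (id - p).
Proof.
move=> pp x; rewrite !opE !rdotw proj_dot // -projC_dot //; exact: rdot_ge0.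
Qed.

Lemma mkproj p : linear p -> sym p -> (forall x, p (p x) = p x) ->
  orthogonal_projection p.
Proof.
move=> lp sp pp; split; [|exact/funext|exact: sym_adjoint].
apply: (@opbound_mkbdd _ _ _ 1) => //; apply: effect_bound => //.
  by move=> x; rewrite -pp sp rdot_ge0.
move=> x; have -> : rdot ((id - p) x) x = rdot (x - p x) (x - p x).
  rewrite !opE !rdotw (rdotC x (p x)) -{2}(pp x) (sp (p x)); lra.
exact: rdot_ge0.
Qed.

Lemma proj_id : orthogonal_projection (@id H).
Proof. exact: mkproj. Qed.

Lemma proj_compl p : orthogonal_projection p -> orthogonal_projection (id - p).
Proof.
move=> pp; apply: mkproj.
- exact: lin_sub (proj_lin pp).
- exact: sym_sub (proj_sym pp).
- move=> x; rewrite !opE (linB _ _ (proj_lin pp)) proj_idem // subrr subr0 //.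
Qed.

Lemma proj_form0 p x : orthogonal_projection p -> rdot (p x) x <= 0 -> p x = 0.
Proof.
move=> pp h; apply: rdot_eq0; apply/eqP; rewrite eq_le rdot_ge0 andbT.
by rewrite -proj_dot.
Qed.

(** p kills x - q x, so that p = p q, and likewise q = q p; taking adjoints,
    p = q. *)
Lemma proj_eq_ker p q : orthogonal_projection p -> orthogonal_projection q ->
  (forall x, p x = 0 <-> q x = 0) -> p = q.
Proof.
move=> pp pq h; have lp := proj_lin pp; have lq := proj_lin pq.
have h1 x : p x = p (q x).
  apply/eqP; rewrite -subr_eq0 -linB //; apply/eqP/h.
  by rewrite linB // proj_idem // subrr.
have h2 x : q x = q (p x).
  apply/eqP; rewrite -subr_eq0 -linB //; apply/eqP/h.
  by rewrite linB // proj_idem // subrr.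
apply/funext => x; apply: rdotP => y.
by rewrite h1 (proj_sym pp) (proj_sym pq) -h2 -(proj_sym pq).
Qed.

Lemma proj_le_ker p q x : orthogonal_projection p -> psd (q - p) ->
  q x = 0 -> p x = 0.
Proof.
move=> pp h qx; apply: proj_form0 => //.
by have := h x; rewrite !opE qx !rdotw; lra.
Qed.

(** The form of s is at most that of q, hence vanishes at x - q x; a positive
    form vanishing at a vector kills it. *)
Lemma le_proj_fix s q x : bounded_operator s -> sym s -> psd s ->
  orthogonal_projection q -> psd (q - s) -> s (q x) = s x.
Proof.
move=> bs ss ps pq h; apply/esym/eqP; rewrite -subr_eq0 -linB; last exact: bdd_lin.
apply/eqP/psd_form0 => //; apply/eqP; rewrite eq_le ps andbT.
have := h (x - q x); rewrite !opE (linB _ _ (proj_lin pq)) proj_idem // subrr.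
by rewrite sub0r rdotNl oppr_ge0.
Qed.

Definition effect s : Prop := [/\ linear s, sym s, psd s & psd (id - s)].

Lemma effect_bdd s : effect s -> bounded_operator s.
Proof. by case=> ls ss p1 p2; apply: (@opbound_mkbdd _ _ _ 1) => //; exact: effect_bound. Qed.

Lemma proj_effect p : orthogonal_projection p -> effect p.
Proof.
by move=> pp; split; [exact: proj_lin|exact: proj_sym|exact: proj_psd|exact: proj_subid].
Qed.

(** The properties of the strong limit p of an increasing net S that the sequel
    relies on; commuting with p follows because composition with a bounded
    operator is strongly continuous. *)
Record is_sup_of (S : set (H -> H)) p : Prop := {
  is_sup_proj : orthogonal_projection p ;
  is_sup_ge : forall s, S s -> psd (p - s) ;
  is_sup_near : forall x (e : R), 0 < e ->
    exists2 s, S s & forall r, S r -> psd (r - s) -> rnorm (r x - p x) <= e ;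
  is_sup_comm : forall a, bounded_operator a -> (forall s, S s -> a \o s = s \o a) ->
    a \o p = p \o a }.

Lemma eq_eps x y (k : R) : (forall e : R, 0 < e -> rnorm (x - y) <= k * e) -> x = y.
Proof.
move=> h; apply/eqP; rewrite -subr_eq0; apply/eqP/rnorm_eq0/eqP.
by rewrite eq_le rnorm_ge0 andbT; exact: le0_eps h.
Qed.

(** Monotone convergence: along an increasing net of effects the forms converge,
    and for s <= r the form of r - s at x controls the norm of r x - s x.
    The limit p is a projection because 2 s - s^2 <= r passes to the limit as
    p <= p^2. *)
Lemma sup_projection (S : set (H -> H)) :
  S !=set0 -> (forall s, S s -> effect s) ->
  (forall s t, S s -> S t -> exists r, [/\ S r, psd (r - s) & psd (r - t)]) ->
  (forall s, S s -> exists2 r, S r &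
     forall x, 2 * rdot (s x) x - rdot (s x) (s x) <= rdot (r x) x) ->
  exists p, is_sup_of S p.
Proof.
move=> [s0 Ss0] Seff Sdir Ssq.
pose F : set_system (H -> H) := filter_from S (fun s => [set r | S r /\ psd (r - s)]).
have psd_refl s : psd (s - s) by move=> x; rewrite subrr opE rdot0l.
have psd_trans s t r : psd (t - s) -> psd (r - t) -> psd (r - s).
  by move=> h1 h2 x; have := h1 x; have := h2 x; rewrite !opE !rdotw; lra.
have PF : ProperFilter F.
  apply: filter_from_proper; last by move=> s Ss; exists s; split.
  apply: filter_from_filter; first by exists s0.
  move=> s t Ss St; have [r [Sr h1 h2]] := Sdir s t Ss St; exists r => //.
  by move=> u [Su hu]; split; split=> //; [exact: psd_trans hu|exact: psd_trans hu].
have FS : F S by exists s0 => // r [].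
have mono s r x : S s -> S r -> psd (r - s) ->
    rdot (r x - s x) (r x - s x) <= rdot (r x) x - rdot (s x) x.
  move=> Ss Sr h; have [ls ss ps p1] := Seff _ Ss; have [lr sr pr p2] := Seff _ Sr.
  have := @effect_norm _ _ (r - s) (lin_sub lr ls) (sym_sub sr ss) h.
  move=> /(_ _ x); rewrite !opE [X in _ <= X]rdotDl rdotNl; apply.
  move=> y; have := p2 y; have := ps y; rewrite !opE !rdotw; lra.
have lim x : exists l, forall e : R, 0 < e -> \forall s \near F, rnorm (s x - l) <= e.
  apply: complete_filter => e e0.
  (* beyond an s whose form at x is nearly extremal, the family is within e *)
  pose A := [set rdot (s x) x | s in S].
  have supA : has_sup A.
    split; first by exists (rdot (s0 x) x), s0.
    exists (rdot x x) => _ [s Ss <-]; have [_ _ _ /(_ x)] := Seff _ Ss.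
    by rewrite !opE !rdotw subr_ge0.
  have [_ [s Ss <-] hs] := sup_adherent (exprn_gt0 2 e0) supA.
  exists (s x), s => //= r [Sr hr]; apply: rnorm_le_dot; first exact: ltW.
  apply: le_trans (mono _ _ _ Ss Sr hr) _.
  have : rdot (r x) x <= sup A by apply: ub_le_sup; [case: supA|exists r].
  by move: hs; lra.
pose p x := projT1 (cid (lim x)).
have pP x (e : R) : 0 < e -> \forall s \near F, rnorm (s x - p x) <= e.
  exact: (projT2 (cid (lim x))).
have near3 x y z (e : R) : 0 < e -> exists s, [/\ S s, rnorm (s x - p x) <= e,
    rnorm (s y - p y) <= e & rnorm (s z - p z) <= e].
  move=> e0; have : \forall s \near F, [/\ S s, rnorm (s x - p x) <= e,
      rnorm (s y - p y) <= e & rnorm (s z - p z) <= e].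
    by near=> s; split; near: s; [exact: FS|exact: pP|exact: pP|exact: pP].
  by move=> /filter_ex.
have lp : linear p.
  move=> u x y; apply: (@eq_eps _ _ (2 + rnorm u)) => e e0.
  have [s [Ss h1 h2 h3]] := near3 (u *: x + y) x y _ e0.
  have [ls _ _ _] := Seff _ Ss.
  have -> : p (u *: x + y) - (u *: p x + p y) =
      - (s (u *: x + y) - p (u *: x + y)) + (u *: (s x - p x) + (s y - p y)).
    rewrite (ls u) opprB scalerBr [X in _ = _ + X]addrACA -opprD.
    by rewrite addrA subrK.
  have n1 := rnormD (- (s (u *: x + y) - p (u *: x + y)))
                    (u *: (s x - p x) + (s y - p y)).
  have n2 := rnormD (u *: (s x - p x)) (s y - p y).
  have n3 : rnorm (u *: (s x - p x)) <= rnorm u * e.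
    by rewrite rnormZ ler_wpM2l // rnorm_ge0.
  rewrite rnormN in n1; lra.
have dlim x y (s : H -> H) e : rnorm (s x - p x) <= e ->
    `|rdot (s x) y - rdot (p x) y| <= e * rnorm y.
  move=> h; rewrite -rdotNl -rdotDl; apply: le_trans (rdot_CS _ _) _.
  by rewrite ler_wpM2r // rnorm_ge0.
have sp : sym p.
  move=> x y; apply/eqP; rewrite -subr_eq0 -normr_eq0 eq_le normr_ge0 andbT.
  apply: (@le0_eps _ _ (rnorm x + rnorm y)) => e e0.
  have [s [Ss h1 h2 _]] := near3 x y x _ e0; have [_ ss _ _] := Seff _ Ss.
  have := dlim x y s e h1; have := dlim y x s e h2.
  rewrite (rdotC (s y)) -ss (rdotC (p y)) !ler_norml => /andP[k1 k2] /andP[k3 k4].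
  by apply/andP; split; lra.
have ge s : S s -> psd (p - s).
  move=> Ss x; rewrite !opE !rdotw -oppr_le0.
  apply: (@le0_eps _ _ (rnorm x)) => e e0.
  have : \forall r \near F, S r /\ psd (r - s) /\ rnorm (r x - p x) <= e.
    near=> r; split; [|split]; near: r; [exact: FS| |exact: pP].
    by exists s => // r [].
  move=> /filter_ex[r [Sr [hr h]]]; have := hr x; rewrite !opE !rdotw.
  have := dlim x x r e h; rewrite ler_norml => /andP[k1 k2]; lra.
have norm_le1 x (s : H -> H) : S s -> rdot (s x) (s x) <= rdot (s x) x.
  by move=> /Seff[ls ss p1 p2]; exact: effect_norm.
have sq x : rdot (p x) (p x) = rdot (p x) x.
  apply/eqP; rewrite -subr_eq0 -normr_eq0 eq_le normr_ge0 andbT.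
  apply: (@le0_eps _ _ (2 * (rnorm (p x) + 2 * rnorm x))) => e e0.
  have [s [Ss h _ _]] := near3 x x x _ e0; have [r Sr hr] := Ssq _ Ss.
  have a1 := norm_le1 x s Ss; have := ge r Sr x; rewrite !opE !rdotw => a2.
  have := dlim x x s e h; rewrite ler_norml => /andP[a3 a4]; have a5 := hr x.
  have := dlim x (p x) s e h; rewrite ler_norml => /andP[a6 a7].
  have := dlim x (s x) s e h; rewrite ler_norml => /andP[a8 a9].
  have a10 : rnorm (s x) <= rnorm x.
    by have [ls ss p1 p2] := Seff _ Ss; have := effect_bound ls ss p1 p2 x; rewrite mul1r.
  have a11 := ler_wpM2l (ltW e0) a10; rewrite (rdotC (p x) (s x)) in a8 a9.
  have n1 := mulr_ge0 (ltW e0) (rnorm_ge0 x).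
  have n2 := mulr_ge0 (ltW e0) (rnorm_ge0 (p x)).
  by rewrite ler_norml; apply/andP; split; lra.
have pp : orthogonal_projection p.
  apply: mkproj => // x; apply/eqP; rewrite -subr_eq0; apply/eqP.
  have -> : p (p x) - p x = ((p \o p) - p) x by [].
  rewrite (@sym_eq0 _ _ ((p \o p) - p)) //.
  - exact: lin_sub (lin_comp lp lp) lp.
  - exact: sym_sub (sym_comp sp sp _) sp.
  - by move=> y; rewrite !opE !rdotw /= sp sq subrr.
exists p; split=> //.
- move=> x e e0; have [s Ss hs] := pP x e e0; exists s => // r Sr hr.
  by apply: hs; split.
- move=> a ba comm; apply/funext => x /=; have [M M0 hM] := bddP ba.
  apply: (@eq_eps _ _ (M + 1)) => e e0.
  have [s [Ss h1 h2 _]] := near3 x (a x) x _ e0.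
  have k1 : rnorm (a (s x) - a (p x)) <= M * e.
    rewrite -linB; last exact: bdd_lin.
    by apply: le_trans (hM _) _; rewrite ler_wpM2l // ltW.
  have asx : a (s x) = s (a x) by rewrite -[LHS]/((a \o s) x) comm.
  have := rnorm_dist (s (a x)) (a (p x)) (p (a x)).
  rewrite (rdistC (a (p x)) (s (a x))) /=; rewrite asx in k1; lra.
Unshelve. all: by end_near. Qed.

Lemma is_sup_approx S p x (e : R) : is_sup_of S p -> 0 < e ->
  exists2 s, S s & rnorm (s x - p x) <= e.
Proof.
move=> sp e0; have [s Ss h] := is_sup_near sp x e0; exists s => //; apply: h => //.
by move=> y; rewrite subrr opE rdot0l.
Qed.

Lemma is_sup_ker S p x : is_sup_of S p -> (forall s, S s -> s x = 0) -> p x = 0.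
Proof.
move=> sp h; apply: (@eq_eps _ _ 1) => e e0.
have [s Ss hs] := is_sup_approx x sp e0.
by rewrite mul1r rdistC -(h s Ss).
Qed.

Lemma is_sup_fix S p s x : is_sup_of S p -> S s -> effect s -> s (p x) = s x.
Proof.
move=> sp Ss es; have [_ ss ps _] := es.
apply: (@le_proj_fix s p x) => //.
- exact: effect_bdd.
- exact: is_sup_proj sp.
- exact: is_sup_ge sp _ Ss.
Qed.

Lemma is_sup_kerE S p x : is_sup_of S p -> (forall s, S s -> effect s) ->
  (p x = 0 <-> forall s, S s -> s x = 0).
Proof.
move=> sp eS; split=> [px s Ss|]; last exact: is_sup_ker.
have es := eS _ Ss; rewrite -(is_sup_fix x sp Ss es) px lin0 //.
exact: bdd_lin (effect_bdd es).
Qed.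

Lemma is_sup_le S p q : is_sup_of S p -> (forall s, S s -> psd (q - s)) -> psd (q - p).
Proof.
move=> sp h x; rewrite !opE !rdotw -oppr_le0.
apply: (@le0_eps _ _ (rnorm x)) => e e0.
have [s Ss hs] := is_sup_approx x sp e0.
have := h s Ss x; rewrite !opE !rdotw.
have := rdot_CS (s x - p x) x; rewrite ler_norml !rdotw => /andP[h1 h2].
have := ler_wpM2r (rnorm_ge0 x) hs; lra.
Qed.

Lemma proj_le_fix p q x : orthogonal_projection p -> orthogonal_projection q ->
  psd (q - p) -> p (q x) = p x /\ q (p x) = p x.
Proof.
move=> pp pq h.
have h1 y : p (q y) = p y.
  exact: le_proj_fix y (proj_bdd pp) (proj_sym pp) (proj_psd pp) pq h.
split=> //; apply: rdotP => z.
by rewrite (proj_sym pq) (proj_sym pp) h1 -(proj_sym pp).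
Qed.

Lemma proj_le_rnorm p q x : orthogonal_projection p -> orthogonal_projection q ->
  psd (q - p) -> rnorm (p x) <= rnorm (q x).
Proof. by move=> pp pq h; have [<- _] := proj_le_fix x pp pq h; exact: proj_le. Qed.

Lemma proj_le_antisym p q : orthogonal_projection p -> orthogonal_projection q ->
  psd (q - p) -> psd (p - q) -> p = q.
Proof.
by move=> pp pq h1 h2; apply: proj_eq_ker => // x; split; exact: proj_le_ker.
Qed.

Lemma sup_increasing (p : nat -> H -> H) :
  (forall n, orthogonal_projection (p n)) ->
  (forall m n, (m <= n)%N -> psd (p n - p m)) ->
  exists q, is_sup_of (range p) q.
Proof.
move=> pp pm; apply: sup_projection.
- by exists (p 0%N), 0%N.
- by move=> _ [n _ <-]; exact: proj_effect.
- move=> _ _ [m _ <-] [n _ <-]; exists (p (maxn m n)); split; first by exists (maxn m n).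
    exact/pm/leq_maxl.
  exact/pm/leq_maxr.
- move=> _ [n _ <-]; exists (p n); first by exists n.
  by move=> x; rewrite (proj_dot _ (pp n)); lra.
Qed.

End Projections.

(** * Norm limits of operators *)

Section Sequences.
Context {R : realType} {H : hilbertType R}.
Implicit Types (x y z : H) (a b c p q s : H -> H).

(** The rate d is uniform on the unit ball, so the pointwise limit is bounded
    and is a limit in norm with the same rate. *)
Lemma op_complete (v : nat -> H -> H) (d : nat -> R) :
  (forall e, 0 < e -> exists N, d N <= e) ->
  (forall n, bounded_operator (v n)) ->
  (forall m n, (n <= m)%N -> opbound (v m - v n) (d n)) ->
  exists2 w, bounded_operator w & forall n, opbound (w - v n) (d n).
Proof.
move=> d0 bv cv.
have lim x : exists l, forall e : R, 0 < e -> \forall n \near \oo, rnorm (v n x - l) <= e.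
  apply: complete_filter => e e0.
  have e1 : 0 < e / (rnorm x + 1) by rewrite divr_gt0 // ltr_wpDl // rnorm_ge0.
  have [N hN] := d0 _ e1; exists (v N x), N => // n /= Nn.
  apply: le_trans (cv _ _ Nn x) _.
  apply: (@le_trans _ _ (e / (rnorm x + 1) * rnorm x)).
    by rewrite ler_wpM2r // rnorm_ge0.
  rewrite mulrAC ler_pdivrMr; last by rewrite ltr_wpDl // rnorm_ge0.
  by rewrite ler_wpM2l ?lerDl // ltW.
pose w x := projT1 (cid (lim x)).
have wP x (e : R) : 0 < e -> \forall n \near \oo, rnorm (v n x - w x) <= e.
  exact: (projT2 (cid (lim x))).
have wv n : opbound (w - v n) (d n).
  move=> x; apply: le_eps => e e0.
  have [N _ hN] := wP x e e0; have := hN (maxn n N) (leq_maxr _ _) => /=.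
  have := cv _ n (leq_maxl n N) x; rewrite !opE => h1 h2.
  have := rnorm_dist (v (maxn n N) x) (w x) (v n x).
  rewrite (rdistC (w x) (v (maxn n N) x)); lra.
have lw : linear w.
  move=> u x y; apply: (@eq_eps _ _ _ _ (2 + rnorm u)) => e e0.
  have : \forall n \near \oo, [/\ rnorm (v n (u *: x + y) - w (u *: x + y)) <= e,
      rnorm (v n x - w x) <= e & rnorm (v n y - w y) <= e].
    by near=> n; split; near: n; exact: wP.
  move=> /filter_ex[n [h1 h2 h3]]; have ls := bdd_lin (bv n).
  have -> : w (u *: x + y) - (u *: w x + w y) =
      - (v n (u *: x + y) - w (u *: x + y)) + (u *: (v n x - w x) + (v n y - w y)).
    rewrite (ls u) opprB scalerBr [X in _ = _ + X]addrACA -opprD.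
    by rewrite addrA subrK.
  have n1 := rnormD (- (v n (u *: x + y) - w (u *: x + y)))
                    (u *: (v n x - w x) + (v n y - w y)).
  have n2 := rnormD (u *: (v n x - w x)) (v n y - w y).
  have n3 : rnorm (u *: (v n x - w x)) <= rnorm u * e.
    by rewrite rnormZ ler_wpM2l // rnorm_ge0.
  rewrite rnormN in n1; lra.
exists w => //; have [M M0 hM] := bddP (bv 0).
apply: (@opbound_mkbdd _ _ _ (d 0 + M)) => // x.
have := wv 0 x; rewrite !opE => h1; have := hM x.
by have := rnormD (w x - v 0 x) (v 0 x); rewrite subrK mulrDl; lra.
Unshelve. all: by end_near. Qed.

End Sequences.

(** * Limits along ultrafilters, and compactness *)

Section Ultralimits.
Context {R : realType}.

Lemma ultra_lim_real (X : Type) (U : set_system X) (f : X -> R) (M : R) :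
  UltraFilter U -> (\forall x \near U, `|f x| <= M) ->
  exists l, forall e : R, 0 < e -> \forall x \near U, `|f x - l| <= e.
Proof.
move=> UU hM.
have PU : ProperFilter U by exact: ultra_proper.
have fM : (f @ U) `[- M, M]%classic.
  by apply: filterS hM => x /=; rewrite ler_norml in_itv.
have [l [_ cl]] := @segment_compact R (- M) M (f @ U) (fmap_proper_filter f PU) fM.
exists l => e e0.
have nl : nbhs l (ball l e) by exact: nbhsx_ballx.
have [h|h] := in_ultra_setVsetC (f @^-1` ball l e) UU.
  by apply: filterS h => x; rewrite /= /ball /= => /ltW; rewrite distrC.
have [y [/= h1 h2]] := cl (~` ball l e) (ball l e) h nl; by [].
Qed.

Lemma rnorm_ReIm (z : R[i]) : rnorm z <= `|complex.Re z| + `|complex.Im z|.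
Proof.
rewrite -(ler_pXn2r (n := 2)) ?nnegrE ?rnorm_ge0 ?addr_ge0 // rnorm_sqr.
rewrite -(real_normK (num_real (complex.Re z))) -(real_normK (num_real (complex.Im z))).
by have := normr_ge0 (complex.Re z); have := normr_ge0 (complex.Im z); nra.
Qed.

Lemma ultra_lim (X : Type) (U : set_system X) (f : X -> R[i]) (M : R) :
  UltraFilter U -> (\forall x \near U, rnorm (f x) <= M) ->
  exists l, forall e : R, 0 < e -> \forall x \near U, rnorm (f x - l) <= e.
Proof.
move=> UU hM; have PU : ProperFilter U by exact: ultra_proper.
have [|u hu] := @ultra_lim_real X U (fun x => complex.Re (f x)) M UU.
  by apply: filterS hM => x; apply: le_trans (rnorm_Re _).
have [|v hv] := @ultra_lim_real X U (fun x => complex.Im (f x)) M UU.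
  by apply: filterS hM => x; apply: le_trans (rnorm_Im _).
exists (u +i* v) => e e0; have e2 : 0 < e / 2 by rewrite divr_gt0.
near=> x; apply: le_trans (rnorm_ReIm _) _.
have h1 : `|complex.Re (f x) - u| <= e / 2 by near: x; exact: hu.
have h2 : `|complex.Im (f x) - v| <= e / 2 by near: x; exact: hv.
by move: h1 h2; case: (f x) => p q /= h1 h2; lra.
Unshelve. all: by end_near. Qed.

End Ultralimits.

(** Compactness in terms of ideals of sets: were K not in the ideal J, the
    complements in K of the members of J would generate a proper filter, and no
    cluster point of it can have a neighbourhood in J. *)
Lemma compact_ideal (T : topologicalType) (K : set T) (J : set_system T) :
  compact K -> J set0 -> (forall A A', J A -> J A' -> J (A `|` A')) ->
  (forall A A', A `<=` A' -> J A' -> J A) ->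
  (forall t, K t -> exists2 A, J A & nbhs t A) -> J K.
Proof.
move=> cK J0 JU JS loc; apply: contrapT => nJ.
pose F : set_system T := [set X | J (K `\` X)].
have PF : ProperFilter F.
  split; first by rewrite /F /= setD0.
  split.
  - by rewrite /F /= setDT.
  - by move=> P Q hP hQ; rewrite /F /= setDIr; exact: JU.
  - by move=> P Q PQ; apply: JS; exact: setDS.
have FK : F K by rewrite /F /= setDv.
have [t [Kt ct]] := cK F PF FK.
have [A JA At] := loc t Kt.
have FA : F (~` A) by apply: (JS _ A) => // s [_ /contrapT].
by have [s [? ?]] := ct _ _ FA At.
Qed.

(** * Spectral measures *)

Section SpectralMeasures.
Context {R : realType} {H : hilbertType R}.
Implicit Types (x y z : H) (a b c p q : H -> H).
Variables (T : Type) (E : set_system T) (P : set T -> H -> H).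
Hypothesis sP : spectral_measure E P.
Implicit Types (A w : set T).

Lemma sm_set0 : E set0.
Proof. by have [] := spectral_sigma_algebra sP. Qed.

Lemma sm_compl A : E A -> E (~` A).
Proof. by have [_ h _] := spectral_sigma_algebra sP => EA; rewrite -setTD; exact: h. Qed.

Lemma sm_setT : E setT.
Proof. by rewrite -setC0; exact/sm_compl/sm_set0. Qed.

Lemma sm_setU A w : E A -> E w -> E (A `|` w).
Proof.
move=> EA Ew; rewrite -bigcup2E; have [_ _ h] := spectral_sigma_algebra sP.
by apply: h => -[|[|n]] //=; exact: sm_set0.
Qed.

Lemma sm_setI A w : E A -> E w -> E (A `&` w).
Proof.
move=> EA Ew; rewrite -[A `&` w]setCK setCI; apply/sm_compl/sm_setU; exact: sm_compl.
Qed.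

Lemma sm_setD A w : E A -> E w -> E (A `\` w).
Proof. by move=> EA Ew; rewrite setDE; apply: sm_setI => //; exact: sm_compl. Qed.

Let pP A : E A -> orthogonal_projection (P A) := @spectral_projection _ _ _ _ _ sP A.

Lemma diag_rdot x A : diag_measure P x A = rdot (P A x) x.
Proof. by []. Qed.

(** A self-adjoint operator is determined by its form, so the scalar additivity
    of the diagonal measures gives additivity of operators. *)
Lemma sm_add A w : E A -> E w -> A `&` w = set0 -> P (A `|` w) = P A + P w.
Proof.
move=> EA Ew Aw0; apply: sym_eq.
- exact: proj_lin (pP (sm_setU EA Ew)).
- exact: lin_add (proj_lin (pP EA)) (proj_lin (pP Ew)).
- exact: proj_sym (pP (sm_setU EA Ew)).
- exact: sym_add (proj_sym (pP EA)) (proj_sym (pP Ew)).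
move=> x; rewrite opE rdotDl -!diag_rdot.
have [m0 mge mU] := Defs.spectral_diag sP x.
have Eb n : E (bigcup2 A w n).
  by case: n => [|[|n]] //=; exact: sm_set0.
have tr : trivIset [set: nat] (bigcup2 A w).
  apply/trivIsetP => -[|[|i]] [|[|j]] //= _ _ _; rewrite ?set0I ?setI0 //.
  by rewrite setIC.
have := mU _ Eb tr; rewrite bigcup2E => c1.
have c2 : series (diag_measure P x \o bigcup2 A w) @ \oo -->
    diag_measure P x A + diag_measure P x w.
  apply: cvg_near_cst; exists 2%N => // n /= n2.
  rewrite /series /= big_mkord -(subnKC n2) 2!big_ord_recl /= big1 ?addr0 //.
exact: (cvg_unique _ c1 c2).
Qed.

(** P A + P w = P (A `|` w) <= 1, evaluated on the range of P w. *)
Lemma sm_orth A w x : E A -> E w -> A `&` w = set0 -> P A (P w x) = 0.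
Proof.
move=> EA Ew Aw0; apply: (proj_form0 (pP EA)).
have pU := pP (sm_setU EA Ew).
have := proj_subid pU (P w x); rewrite !opE (sm_add EA Ew Aw0) !opE !rdotw.
by rewrite (proj_idem _ (pP Ew)); lra.
Qed.

Lemma sm_C A x : E A -> P (~` A) x = x - P A x.
Proof.
move=> EA; have := sm_add EA (sm_compl EA) (setICr A).
rewrite setUCr (spectral_setT sP) => /(congr1 (@^~ x)); rewrite /= opE => {2}->.
by rewrite addrC addKr.
Qed.

Lemma sm_sub A w x : E A -> E w -> A `<=` w -> P w (P A x) = P A x.
Proof.
move=> EA Ew Aw; have := @sm_orth (~` w) A x (sm_compl Ew) EA.
rewrite sm_C // => h; apply/esym/eqP; rewrite -subr_eq0; apply/eqP/h.
by rewrite setIC -subsets_disjoint.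
Qed.

Lemma sm_split A w x : E A -> E w -> P A x = P (A `&` w) x + P (A `\` w) x.
Proof.
move=> EA Ew; rewrite -[X in P X x = _](setUIDK A w).
rewrite sm_add //; [exact: sm_setI|exact: sm_setD|].
by rewrite setDE setIACA setICr setI0.
Qed.

Lemma sm_comm A w x : E A -> E w -> P A (P w x) = P w (P A x).
Proof.
move=> EA Ew; have EI := sm_setI EA Ew.
have key C D y : E C -> E D -> P C (P D y) = P (C `&` D) y.
  move=> EC ED; rewrite (sm_split y ED EC) (linD _ _ (proj_lin (pP EC))).
  rewrite (sm_sub y (sm_setI ED EC) EC (@subIsetr _ _ _)).
  rewrite (sm_orth y EC (sm_setD ED EC)) ?addr0 1?setIC //.
  by rewrite setDE -setIA setICl setI0.
by rewrite !key // setIC.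
Qed.

Lemma sm_pyth A w x : E A -> E w ->
  rdot (P A x) (P A x) = rdot (P (A `&` w) x) (P (A `&` w) x) +
                         rdot (P (A `\` w) x) (P (A `\` w) x).
Proof.
move=> EA Ew; rewrite -!proj_dot; [|exact/pP/sm_setD|exact/pP/sm_setI|exact: pP].
by rewrite (sm_split x EA Ew) rdotDl.
Qed.

(** From constants to step functions, by induction on the number of sets: the
    last set v splits A into two pieces, on one of which its coefficient joins
    the constant u and on the other disappears.  The errors on the two pieces
    are orthogonal, so that the bound r is not doubled. *)
Lemma step_estimate b (f : T -> R[i]) (r : R) : linear b -> 0 <= r ->
  (forall w x, E w -> b (P w x) = P w (b x)) ->
  (forall A (u : R[i]), E A -> (forall t, A t -> rnorm (f t - u) <= r) ->
     forall x, rnorm (b (P A x) - u *: P A x) <= r * rnorm (P A x)) ->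
  forall n (z : 'I_n -> R[i]) (w : 'I_n -> set T) (u : R[i]) A, (forall i, E (w i)) -> E A ->
  (forall t, A t -> rnorm (f t - (u + \sum_(i < n) z i * \1_(w i) t)) <= r) ->
  forall x, rnorm (b (P A x) - (u *: P A x + (\sum_(i < n) z i *: P (w i)) (P A x)))
    <= r * rnorm (P A x).
Proof.
move=> lb r0 cb loc; elim=> [|n IH] z w u A Ew EA hA x.
  rewrite big_ord0 opE addr0; apply: loc => // t At.
  by have := hA t At; rewrite big_ord0 addr0.
set v := w ord_max; have Ev : E v by exact: Ew.
pose S : H -> H := \sum_(i < n) z (widen_ord (leqnSn n) i) *: P (w (widen_ord (leqnSn n) i)).
have lS : linear S.
  apply: (@big_ind _ (fun a : H -> H => linear a)); [exact: lin_zero|exact: lin_add|].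
  by move=> i _; apply/lin_scale/proj_lin/pP.
have SP C y : E C -> S (P C y) = P C (S y).
  move=> EC; rewrite /S; apply: (@big_ind _ (fun a : H -> H => a (P C y) = P C (a y))).
  - by rewrite !opE (lin0 (proj_lin (pP EC))).
  - by move=> a a' h h'; rewrite !opE h h' (linD _ _ (proj_lin (pP EC))).
  - by move=> i _; rewrite !opE (linZ _ _ (proj_lin (pP EC))) sm_comm.
pose y1 := P (A `&` v) x; pose y2 := P (A `\` v) x.
have E1 : E (A `&` v) by exact: sm_setI.
have E2 : E (A `\` v) by exact: sm_setD.
have yE : P A x = y1 + y2 by exact: sm_split.
have v1 : P v y1 = y1 by apply: sm_sub => //; exact: subIsetr.
have v2 : P v y2 = 0 by apply: sm_orth => //; rewrite setDE setIC -setIA setICl setI0.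
have h1 : rnorm (b y1 - ((u + z ord_max) *: y1 + S y1)) <= r * rnorm y1.
  apply: (IH _ _ (u + z ord_max) (A `&` v)) => // t [At vt].
  have := hA t At; rewrite big_ord_recr /= indicE mem_set // mulr1.
  by rewrite -[u + z ord_max + _]addrA [z ord_max + _]addrC.
have h2 : rnorm (b y2 - (u *: y2 + S y2)) <= r * rnorm y2.
  apply: (IH _ _ u (A `\` v)) => // t [At vt].
  by have := hA t At; rewrite big_ord_recr /= indicE memNset // mulr0 addr0.
rewrite big_ord_recr /= -/S -/v !opE -/S yE.
have -> : b (y1 + y2) - (u *: (y1 + y2) + (S (y1 + y2) + z ord_max *: P v (y1 + y2))) =
  (b y1 - ((u + z ord_max) *: y1 + S y1)) + (b y2 - (u *: y2 + S y2)).
  rewrite (linD _ _ lb) (linD _ _ lS) (linD _ _ (proj_lin (pP Ev))) v1 v2 addr0.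
  rewrite scalerDr scalerDl.
  move: (b y1) (b y2) (S y1) (S y2) (u *: y1) (u *: y2) (z ord_max *: y1) => *.
  by apply: rdotP => t; rewrite !rdotw; ring.
have comm C y k : E C -> b (P C y) - (k *: P C y + S (P C y)) = P C (b y - (k *: y + S y)).
  move=> EC; have lC := proj_lin (pP EC).
  by rewrite (linB _ _ lC) (linD _ _ lC) (linZ _ _ lC) SP // cb.
have orth : rdot (b y1 - ((u + z ord_max) *: y1 + S y1)) (b y2 - (u *: y2 + S y2)) = 0.
  rewrite /y1 /y2 !comm // (proj_sym (pP E1)) sm_orth ?rdot0r //.
  by rewrite setDE setIACA setICr setI0.
rewrite -(rdot_le_norms _ _ r0) -yE (sm_pyth x EA Ev) -/y1 -/y2.
rewrite -(rdot_le_norms _ _ r0) in h1; rewrite -(rdot_le_norms _ _ r0) in h2.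
move: (b y1 - _) (b y2 - _) orth h1 h2 => p1 p2 orth h1 h2.
by rewrite !rdotw (rdotC p2) orth; lra.
Qed.

Lemma step_bdd n (z : 'I_n -> R[i]) (w : 'I_n -> set T) : (forall i, E (w i)) ->
  bounded_operator (\sum_(i < n) z i *: P (w i)).
Proof.
move=> Ew; apply: (@big_ind _ (fun a : H -> H => bounded_operator a)); [exact: bdd_zero|exact: bdd_add|].
by move=> i _; apply/bdd_scale/proj_bdd/pP.
Qed.

Lemma step_bounded n (z : 'I_n -> R[i]) (w : 'I_n -> set T) :
  exists M : R, forall t, rnorm ((\sum_(i < n) z i *: (\1_(w i) : T -> R[i]^o)) t) <= M.
Proof.
apply: (@big_ind _ (fun h : T -> R[i]^o => exists M : R, forall t, rnorm (h t : R[i]) <= M)).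
- by exists 0 => t; rewrite rnorm0.
- move=> h h' [M hM] [M' hM']; exists (M + M') => t.
  by apply: le_trans (rnormD _ _) (lerD (hM t) (hM' t)).
- move=> i _; exists (rnorm (z i)) => t; rewrite /= rnormM indicE.
  case: (_ \in _) => /=; first by rewrite {2}/rnorm normr1 mulr1.
  by rewrite rnorm0 mulr0 rnorm_ge0.
Qed.

End SpectralMeasures.

Lemma supnorm_ub (R : realType) (T : Type) (f : T -> R[i]) (M : R) t :
  (forall t, rnorm (f t) <= M) -> rnorm (f t) <= supnorm f.
Proof. by move=> h; apply: ub_le_sup; [exists M => _ [s _ <-]|exists t]. Qed.

Lemma supnorm_le (R : realType) (T : Type) (f : T -> R[i]) (M : R) :
  [set: T] !=set0 -> (forall t, rnorm (f t) <= M) -> supnorm f <= M.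
Proof. by move=> [t _] h; apply: ge_sup; [exists (rnorm (f t)), t|move=> _ [s _ <-]]. Qed.

Section Counting.
Context {R : realType}.

Lemma sum_funE (T : Type) n (F : 'I_n -> T -> R[i]^o) t :
  (\sum_(i < n) F i) t = \sum_(i < n) (F i t : R[i]).
Proof. by elim/big_ind2 : _ => // f g f' g' <- <-. Qed.

(** The step function with n jumps of height 1 is within 1 of the identity of
    [0, n]; rescaled, it is the standard approximation of a function with values
    in [0, 1] by its level sets. *)
Lemma count_below n (t : R) : 0 <= t <= n%:R ->
  t <= \sum_(j < n) ((j%:R < t)%R)%:R <= t + 1.
Proof.
elim: n => [|n IH] /andP[t0 tn].
  by rewrite big_ord0; apply/andP; split; lra.
rewrite big_ord_recr /=; have [tn'|tn'] := lerP t n%:R.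
  by rewrite addr0; apply: IH; rewrite t0.
have -> : \sum_(j < n) ((j%:R < t)%R)%:R = n%:R :> R.
  rewrite (eq_bigr (fun _ => 1)) ?sumr_const ?card_ord // => j _.
  by rewrite (lt_le_trans _ (ltW tn')) // ?ltr_nat.
by move: tn; rewrite -[n.+1%:R]natr1 /= => tn; apply/andP; split; lra.
Qed.

End Counting.

(** * Square roots and positive parts *)

Section SpectralTheorem.
Context {R : realType} {H : hilbertType R}.
Variable B : set (H -> H).
Hypothesis cB : commutative_cstar_algebra B.
Implicit Types (x y z : H) (a b c p q : H -> H).
Implicit Types (tau : spectrum B) (U V A : set (spectrum B)).

Let Bbdd b : B b -> bounded_operator b := cstar_bounded cB (b := b).
Let Badd b c : B b -> B c -> B (b + c) := cstar_add cB (b := b) (c := c).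
Let Bscale (u : R[i]) b : B b -> B (u *: b) := @cstar_scale _ _ _ cB u b.
Let Bmul b c : B b -> B c -> B (b \o c) := cstar_mul cB (b := b) (c := c).
Let Bsym b c : B b -> B c -> sym b -> sym c -> sym (b \o c).
Proof. by move=> Bb Bc sb sc; apply: sym_comp => //; exact: cstar_comm cB _ _ Bb Bc. Qed.

Section Algebra.

Lemma cstar_lin b : B b -> linear b.
Proof. by move=> /Bbdd/bdd_lin. Qed.

Lemma cstar_opp b : B b -> B (- b).
Proof. by move=> Bb; rewrite -scaleN1r; exact: Bscale. Qed.

Lemma cstar_sub b c : B b -> B c -> B (b - c).
Proof. by move=> Bb Bc; apply: Badd => //; exact: cstar_opp. Qed.

Lemma cstar_commx b c x : B b -> B c -> b (c x) = c (b x).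
Proof. by move=> Bb Bc; rewrite -[LHS]/((b \o c) x) (cstar_comm cB). Qed.

Lemma cstar_limit (v : nat -> H -> H) (d : nat -> R) w :
  (forall e, 0 < e -> exists N, d N <= e) ->
  (forall n, B (v n)) -> bounded_operator w -> (forall n, opbound (w - v n) (d n)) -> B w.
Proof.
move=> d0 Bv bw wv; apply: (cstar_closed cB) => // e e0.
have [N hN] := d0 _ (divr_gt0 e0 (ltr0n _ 2)); exists (v N) => //.
apply: (@le_lt_trans _ _ (e / 2)); last by lra.
apply: opnorm_le; first by rewrite divr_ge0 // ltW.
move=> x; apply: le_trans (wv N x) _; rewrite ler_wpM2r //; exact: rnorm_ge0.
Qed.

(** eta n is the value at t = 1 of the polynomials y_0 = 0,
    y_(n+1) = (t + y_n^2) / 2, which converge to 1 - sqrt (1 - t) on [0, 1].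
    Their coefficients and those of their increments are nonnegative, so the
    values at 1 bound the polynomials of any contraction t. *)
Fixpoint eta (n : nat) : R := if n is k.+1 then (1 + eta k ^+ 2) / 2 else 0.

Lemma etaS n : eta n.+1 = (1 + eta n ^+ 2) / 2.
Proof. by []. Qed.

Lemma eta_bounds n : 0 <= eta n /\ eta n <= 1.
Proof.
elim: n => [|n [h1 h2]]; first by split.
by rewrite etaS; split; nra.
Qed.

Lemma eta_rate n : (1 - eta n) * (1 + n%:R / 2) <= 1.
Proof.
elim: n => [|n IH]; first by rewrite subr0 mul0r addr0 mulr1.
rewrite etaS; have [h1 h2] := eta_bounds n; rewrite -[n.+1%:R]natr1.
set k := 1 + n%:R / 2 in IH.
have -> : 1 + (n%:R + 1) / 2 = k + 2^-1 by rewrite /k; lra.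
set d := 1 - eta n in IH.
have -> : 1 - (1 + eta n ^+ 2) / 2 = d * (1 - d / 2) by rewrite /d; field.
have d0 : 0 <= d by rewrite /d; lra.
have d1 : d <= 1 by rewrite /d; lra.
have : (1 - d / 2) * (d * k + d / 2) <= (1 - d / 2) * (1 + d / 2).
  by rewrite ler_wpM2l //; lra.
have := sqr_ge0 d; nra.
Qed.

Lemma eta_lim (e : R) : 0 < e -> exists N, 2 * (1 - eta N) <= e.
Proof.
move=> e0; have := archi_boundP (x := 4 / e); rewrite divr_ge0 ?ltW // => /(_ isT).
set N := Num.bound _ => hN; exists N; have := eta_rate N; have [h1 h2] := eta_bounds N.
have : 4 < e * N%:R by rewrite mulrC -ltr_pdivrMr.
set d := 1 - eta N; set k : R := N%:R => h3 h4.
have d0 : 0 <= d by rewrite /d; lra.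
have k0 : 0 <= k by rewrite ler0n.
have h5 : d * k <= 2 by nra.
rewrite leNgt; apply/negP => h6.
have : e * k <= 2 * d * k by rewrite ler_wpM2r // ltW.
nra.
Qed.

(** The square root comes from the iteration y := (t + y^2) / 2 with t = 1 - a,
    whose fixed point is 1 - sqrt a.  Although 1 need not be in B, the n-th term
    differs from the scalar eta n by an element of B. *)
Lemma cstar_sqrt1 a : B a -> sym a -> psd a -> psd (id - a) ->
  exists s, [/\ B s, sym s, psd s & s \o s = a].
Proof.
move=> Ba sa pa p1; have la := cstar_lin Ba.
pose t : H -> H := id - a.
pose half : R[i] := (2^-1 : R)%:C.
have lt : linear t by exact: lin_sub.
have st : sym t by exact: sym_sub.
have bt : opbound t 1.
  apply: effect_bound => //; move=> x; have := pa x; rewrite !opE !rdotw; lra.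
pose y := fix y n : H -> H := if n is k.+1 then half *: (t + (y k \o y k)) else 0.
pose v n : H -> H := (eta n)%:C *: id - y n.
have ly n : linear (y n).
  by elim: n => [|n IH] /=; [exact: lin_zero|apply/lin_scale/lin_add/lin_comp].
have sy n : sym (y n).
  by elim: n => [|n IH] /=; [exact: sym_zero|apply/sym_scale/sym_add/sym_comp].
have by_ n : opbound (y n) (eta n).
  elim: n => [|n IH] x /=; first by rewrite rnorm0 mul0r.
  have [e0 e1] := eta_bounds n.
  rewrite !opE rnormZ rnorm_real ger0_norm ?invr_ge0 //=.
  have := rnormD (t x) (y n (y n x)); have := bt x; rewrite mul1r => h1 h2.
  have h3 := IH (y n x); have h4 := ler_wpM2l e0 (IH x).
  rewrite expr2; lra.
have By n : B (v n).
  elim: n => [|n IH].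
    rewrite /v /= (_ : _ - _ = 0); first exact: cstar_0 cB.
    by apply/funext => x; rewrite !opE scale0r subr0.
  have -> : v n.+1 = half *: (a + ((2 * eta n)%:C *: v n - (v n \o v n))).
    apply/funext => x; rewrite /v /= !opE /= !opE /=.
    rewrite (linB _ _ (ly n)) (linZ _ _ (ly n)) /t !opE.
    by apply: rdotP => z; rewrite !rdotw; field.
  by apply/Bscale/Badd => //; apply: cstar_sub; [exact: Bscale|exact: Bmul].
have dy n : opbound (y n.+1 - y n) (eta n.+1 - eta n).
  elim: n => [|n IH] x.
    rewrite /= !opE /= subr0 opE addr0 rnormZ rnorm_real expr0n /= addr0 subr0 mul1r.
    rewrite ger0_norm ?invr_ge0 // ler_wpM2l ?invr_ge0 //.
    by have := bt x; rewrite mul1r.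
  have -> : (y n.+2 - y n.+1) x =
      half *: (y n.+1 ((y n.+1 - y n) x) + (y n.+1 - y n) (y n x)).
    have e k : y k.+1 x = half *: (t x + y k (y k x)) by [].
    rewrite !opE (e n.+1) [X in _ - X](e n) -scalerBr; congr (_ *: _).
    by rewrite opprD addrACA subrr add0r (linB _ _ (ly n.+1)) subrKA.
  rewrite rnormZ rnorm_real ger0_norm ?invr_ge0 //.
  have [e0 e1] := eta_bounds n; have [e2 e3] := eta_bounds n.+1.
  have h1 := rnormD (y n.+1 ((y n.+1 - y n) x)) ((y n.+1 - y n) (y n x)).
  have h2 := by_ n.+1 ((y n.+1 - y n) x).
  have h3 := ler_wpM2l e2 (IH x).
  have h4 := IH (y n x).
  have e4 : 0 <= eta n.+1 - eta n.
    by rewrite etaS; have := sqr_ge0 (eta n - 1); lra.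
  have h5 := ler_wpM2l e4 (by_ n x).
  have -> : eta n.+2 - eta n.+1 = (eta n.+1 ^+ 2 - eta n ^+ 2) / 2.
    by rewrite (etaS n.+1); have := etaS n; lra.
  rewrite !opE /= in h1 h2 h3 h4 h5 *; lra.
have dym m n : (n <= m)%N -> opbound (y m - y n) (eta m - eta n) /\ eta n <= eta m.
  move=> nm; rewrite -(subnK nm); elim: (m - n)%N => [|k [IH1 IH2]].
    split=> // x; rewrite add0n !subrr opE rnorm0 mul0r //.
  split; last first.
    apply: le_trans IH2 _; rewrite addSn /=; have := sqr_ge0 (eta (k + n) - 1); nra.
  move=> x; have := IH1 x; have := dy (k + n)%N x; rewrite addSn !opE => h1 h2.
  have := rnorm_dist (y (k + n)%N x) (y (k + n).+1 x) (y n x); lra.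
have dv m n : (n <= m)%N -> opbound (v m - v n) (2 * (1 - eta n)).
  move=> nm x; have [h1 h2] := dym m n nm; have [e0 e1] := eta_bounds m.
  have -> : (v m - v n) x = (eta m - eta n)%:C *: x - (y m - y n) x.
    by rewrite /v !opE; apply: rdotP => z; rewrite !rdotw; ring.
  have := rnormB ((eta m - eta n)%:C *: x) ((y m - y n) x); have := h1 x.
  rewrite rnormZ rnorm_real ger0_norm ?subr_ge0 //; have := rnorm_ge0 x; nra.
have [w bw wv] := op_complete eta_lim (fun n => Bbdd (By n)) dv.
have Bw : B w by exact: cstar_limit eta_lim By bw wv.
have lw := bdd_lin bw.
have wv' x (e : R) : 0 < e -> exists n, [/\ 2 * (1 - eta n) <= e,
    rnorm (w x - v n x) <= e & rnorm (w (w x) - v n (w x)) <= e].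
  move=> e0; pose r := rnorm x + rnorm (w x) + 1.
  have r0 : 0 < r by rewrite ltr_wpDl // addr_ge0 // rnorm_ge0.
  have r1 : 1 <= r by rewrite lerDr addr_ge0 // rnorm_ge0.
  have [n hn] := eta_lim (divr_gt0 e0 r0); exists n.
  have [q0 q1] := eta_bounds n.
  have h y0 : rnorm y0 <= r -> rnorm (w y0 - v n y0) <= e.
    move=> yr; apply: le_trans (wv n y0) _.
    apply: le_trans (ler_wpM2r (rnorm_ge0 _) hn) _.
    by rewrite mulrAC ler_pdivrMr // ler_wpM2l // ltW.
  split.
  - by apply: le_trans hn _; rewrite ler_pdivrMr // ler_peMr // ltW.
  - by apply: h; rewrite /r; have := rnorm_ge0 (w x); lra.
  - by apply: h; rewrite /r; have := rnorm_ge0 x; lra.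
have sv n : sym (v n) by apply: sym_sub => //; apply: sym_scale.
have sw : sym w.
  move=> x z; apply/eqP; rewrite -subr_eq0 -normr_eq0 eq_le normr_ge0 andbT.
  apply: (@le0_eps _ _ (2 * (rnorm x * rnorm z))) => e e0.
  have [n hn] := eta_lim e0.
  have h1 := rdot_CS (w x - v n x) z; have h2 := rdot_CS x (w z - v n z).
  have h3 := ler_wpM2r (rnorm_ge0 z) (le_trans (wv n x) (ler_wpM2r (rnorm_ge0 x) hn)).
  have h4 := ler_wpM2l (rnorm_ge0 x) (le_trans (wv n z) (ler_wpM2r (rnorm_ge0 z) hn)).
  rewrite rdotDl rdotNl (sv n) in h1; rewrite rdotDr rdotNr in h2; rewrite !opE in h3 h4.
  move: h1 h2; rewrite !ler_norml => /andP[h5 h6] /andP[h7 h8].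
  by apply/andP; split; lra.
have pw : psd w.
  move=> x; rewrite -oppr_le0; apply: (@le0_eps _ _ (rnorm x)) => e e0.
  have [n [_ hn _]] := wv' x e e0.
  have := rdot_CS (w x - v n x) x; rewrite ler_norml rdotDl rdotNl => /andP[h1 _].
  have : 0 <= rdot (v n x) x.
    rewrite /v !opE !rdotw.
    have [e0' _] := eta_bounds n; have := opbound_form x e0' (by_ n).
    by rewrite ler_norml => /andP[_]; lra.
  by have := ler_wpM2r (rnorm_ge0 x) hn; lra.
exists w; split=> //; apply/funext => x /=.
have Ev n : a x = 2%:C *: v n.+1 x - (2 * eta n)%:C *: v n x + v n (v n x).
  rewrite /v !opE /= (linB _ _ (ly n)) (linZ _ _ (ly n)) !opE /= /t !opE.
  by apply: rdotP => z; rewrite !rdotw; field.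
have bv n x0 : rnorm (v n x0) <= 2 * rnorm x0.
  have := rnormB ((eta n)%:C *: x0) (y n x0); have := by_ n x0.
  have [e0 e1] := eta_bounds n; rewrite rnormZ rnorm_real ger0_norm //.
  have := ler_wpM2r (rnorm_ge0 x0) e1; rewrite mul1r /v !opE; lra.
apply: (@eq_eps _ _ _ _ (3 + 4 * rnorm x)) => e e0.
have [n [h1 h2 h3]] := wv' x e e0; have [q0 q1] := eta_bounds n.
have -> : w (w x) - a x = (w (w x) - v n (w x)) + v n (w x - v n x)
    - 2%:C *: ((v n.+1 - v n) x) - (2 * (1 - eta n))%:C *: v n x.
  rewrite (Ev n) (linB _ _ (cstar_lin (By n))) !opE.
  by apply: rdotP => z; rewrite !rdotw; ring.
have k1 := dv n.+1 n (leqnSn n) x.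
have k2 := ler_wpM2r (rnorm_ge0 x) h1.
have k3 := bv n (w x - v n x).
have k4 := rnormB (w (w x) - v n (w x) + v n (w x - v n x) - 2%:C *: ((v n.+1 - v n) x))
  ((2 * (1 - eta n))%:C *: v n x).
have k5 := rnormB (w (w x) - v n (w x) + v n (w x - v n x)) (2%:C *: ((v n.+1 - v n) x)).
have k6 := rnormD (w (w x) - v n (w x)) (v n (w x - v n x)).
have k7 : rnorm (2%:C *: ((v n.+1 - v n) x)) = 2 * rnorm ((v n.+1 - v n) x).
  by rewrite rnormZ rnorm_real ger0_norm.
have k8 : rnorm ((2 * (1 - eta n))%:C *: v n x) <= e * (2 * rnorm x).
  rewrite rnormZ rnorm_real ger0_norm; last by rewrite mulr_ge0 // subr_ge0.
  by apply: ler_pM => //; [rewrite mulr_ge0 // subr_ge0|exact: rnorm_ge0].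
lra.
Qed.

Lemma cstar_sqrt a : B a -> sym a -> psd a ->
  exists s, [/\ B s, sym s, psd s & s \o s = a].
Proof.
move=> Ba sa pa; have [M M0 hM] := bddP (Bbdd Ba).
have M1 : 0 <= M^-1 by rewrite invr_ge0 ltW.
have [||||s [Bs ss ps sqs]] := @cstar_sqrt1 (M^-1%:C *: a).
- exact: Bscale.
- exact: sym_scale.
- by move=> x; rewrite opE rdotZl mulr_ge0.
- move=> x; rewrite !opE !rdotw subr_ge0 mulrC ler_pdivrMr // mulrC.
  by apply: le_trans (ler_norm _) _; apply: opbound_form => //; exact: ltW.
exists ((Num.sqrt M)%:C *: s); split.
- exact: Bscale.
- exact: sym_scale.
- by move=> x; rewrite opE rdotZl mulr_ge0 // sqrtr_ge0.
- apply/funext => x; rewrite /= !opE (linZ _ _ (cstar_lin Bs)) scalerA -rmorphM /=.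
  rewrite -expr2 sqr_sqrtr ?ltW // -[s (s x)]/((s \o s) x) sqs opE scalerA -rmorphM /=.
  by rewrite divff ?gt_eqF // scale1r.
Qed.

(** With |q| the square root of q^2, take p = (|q| + q) / 2 and
    m = (|q| - q) / 2.  At this stage only p + m = |q| is known to be positive;
    that p and m are follows from the existence of characters, see
    cstar_posneg_ev. *)
Lemma cstar_posneg q : B q -> sym q -> exists p m,
  [/\ [/\ B p, B m, sym p & sym m], q = p - m, p \o m = 0 & psd (p + m)].
Proof.
move=> Bq sq.
have [||| s [Bs ss ps sqs]] := @cstar_sqrt (q \o q).
- exact: Bmul.
- exact: sym_comp.
- by move=> x; rewrite /= sq rdot_ge0.
pose half : R[i] := (2^-1 : R)%:C.
exists (half *: (s + q)), (half *: (s - q)); split.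
- split; [exact/Bscale/Badd|exact/Bscale/cstar_sub| |].
    exact/sym_scale/sym_add.
  exact/sym_scale/sym_sub.
- by apply/funext => x; rewrite !opE; apply: rdotP => z; rewrite !rdotw; field.
- apply/funext => x; rewrite /= !opE.
  have [ls lq] := (cstar_lin Bs, cstar_lin Bq).
  rewrite (linZ _ _ ls) (linZ _ _ lq) (linB _ _ ls) (linB _ _ lq).
  rewrite -[s (s x)]/((s \o s) x) sqs /= (cstar_commx _ Bs Bq).
  by apply: rdotP => z; rewrite !rdotw; ring.
- have -> : half *: (s + q) + half *: (s - q) = s => //.
  by apply/funext => x; rewrite !opE; apply: rdotP => z; rewrite !rdotw; field.
Qed.

End Algebra.

(** * Characters *)

Section Characters.

Definition inB b (Bb : B b) : B := SigSub (mem_set Bb).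

(** Extending characters by 0 outside B frees computations from membership
    proofs carried inside the elements of the type B. *)
Definition ev tau b : R[i] :=
  if pselect (B b) is left Bb then (val tau : {ptws B -> R[i]^o}) (inB Bb) else 0.

Lemma evE tau (b : B) : ev tau (val b) = gelfand b tau.
Proof.
rewrite /ev; case: pselect => [Bb|]; last by move=> nB; case: nB; exact: set_valP.
by rewrite /gelfand; congr (_ _); apply: val_inj.
Qed.

Lemma ev_inB tau b (Bb : B b) : ev tau b = (val tau : {ptws B -> R[i]^o}) (inB Bb).
Proof. exact: (evE tau (inB Bb)). Qed.

Lemma char_tau tau : is_character (val tau).
Proof. exact: set_mem (valP tau). Qed.

Lemma ev_lin tau (u : R[i]) b c : B b -> B c ->
  ev tau (u *: b + c) = u * ev tau b + ev tau c.
Proof.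
move=> Bb Bc; have Bd : B (u *: b + c) by apply: Badd => //; exact: Bscale.
have [_ h _] := char_tau tau.
by rewrite (ev_inB _ Bb) (ev_inB _ Bc) (ev_inB _ Bd); apply: h.
Qed.

Lemma evM tau b c : B b -> B c -> ev tau (b \o c) = ev tau b * ev tau c.
Proof.
move=> Bb Bc; have [_ _ h] := char_tau tau.
by rewrite (ev_inB _ Bb) (ev_inB _ Bc) (ev_inB _ (Bmul Bb Bc)); apply: h.
Qed.

Lemma evD tau b c : B b -> B c -> ev tau (b + c) = ev tau b + ev tau c.
Proof. by move=> Bb Bc; rewrite -[b]scale1r ev_lin // mul1r scale1r. Qed.

Lemma ev0 tau : ev tau 0 = 0.
Proof.
have := @evD tau 0 0 (cstar_0 cB) (cstar_0 cB); rewrite addr0 => h.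
by apply: (@addIr _ (ev tau 0)); rewrite add0r.
Qed.

Lemma evZ tau (u : R[i]) b : B b -> ev tau (u *: b) = u * ev tau b.
Proof.
move=> Bb; have := @ev_lin tau u b 0 Bb (cstar_0 cB).
by rewrite ev0 !addr0.
Qed.

Lemma evN tau b : B b -> ev tau (- b) = - ev tau b.
Proof. by move=> Bb; rewrite -scaleN1r evZ // mulN1r. Qed.

Lemma evB tau b c : B b -> B c -> ev tau (b - c) = ev tau b - ev tau c.
Proof. by move=> Bb Bc; rewrite evD ?evN //; exact: cstar_opp. Qed.

Lemma ev_neq0 tau : exists2 e, B e & ev tau e != 0.
Proof.
by have [[e he] _ _] := char_tau tau; exists (val e); [exact: set_valP|rewrite evE].
Qed.

Lemma spectrum_mk (phi : (H -> H) -> R[i]) :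
  (exists2 e, B e & phi e != 0) ->
  (forall u b c, B b -> B c -> phi (u *: b + c) = u * phi b + phi c) ->
  (forall b c, B b -> B c -> phi (b \o c) = phi b * phi c) ->
  exists tau : spectrum B, forall b, B b -> ev tau b = phi b.
Proof.
move=> [e Be he] hl hm.
pose f : {ptws B -> R[i]^o} := fun b : B => phi (val b).
have cf : is_character f.
  split; first by exists (inB Be).
    by move=> u b c d; rewrite /f => ->; apply: hl; exact: set_valP.
  by move=> b c d; rewrite /f => ->; apply: hm; exact: set_valP.
exists (SigSub (mem_set cf)) => b Bb; by rewrite (ev_inB _ Bb).
Qed.

Lemma expr_small (r K e : R) : 0 <= r < 1 -> 0 < e -> exists N, K * r ^+ N <= e.
Proof.
move=> /andP[r0 r1] e0.
have /cvgrPdist_lt h : (fun n => r ^+ n) @ \oo --> (0 : R).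
  by apply: cvg_expr; rewrite ger0_norm.
have K0 : 0 < `|K| + 1 by rewrite ltr_wpDl.
have [N _ hN] := h _ (divr_gt0 e0 K0); exists N.
have := hN N (leqnn N); rewrite /= sub0r normrN ger0_norm ?exprn_ge0 // => h1.
have h2 : r ^+ N * (`|K| + 1) <= e by rewrite -ler_pdivlMr // ltW.
have h3 := exprn_ge0 N r0.
have : K * r ^+ N <= `|K| * r ^+ N by rewrite ler_wpM2r // ler_norm.
lra.
Qed.

(** Were l = ev tau b + z of modulus larger than M, the Neumann series for
    (1 - (b + z) / l)^-1 would converge.  Multiplied by some e with
    ev tau e != 0 its sum w stays in B, and tau applied to
    w = e + (b + z) w / l gives ev tau e = 0. *)
Lemma ev_bound tau b (z : R[i]) M : B b -> 0 <= M -> opbound (b + z *: id) M ->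
  rnorm (ev tau b + z) <= M.
Proof.
move=> Bb M0 hM; rewrite leNgt; apply/negP => Ml.
set l := ev tau b + z in Ml.
have l0 : 0 < rnorm l by exact: le_lt_trans Ml.
have lN0 : l != 0 by apply/eqP => l_0; move: l0; rewrite l_0 rnorm0 ltxx.
have [e Be he] := ev_neq0 tau; have [E E0 hE] := bddP (Bbdd Be).
pose r := M / rnorm l.
have r01 : 0 <= r < 1.
  apply/andP; split; first by apply: divr_ge0 => //; exact: ltW.
  by rewrite ltr_pdivrMr // mul1r.
have [r0 r1] := andP r01.
pose y : H -> H := l^-1 *: (b + z *: id).
have ly : linear y by apply/lin_scale/lin_add; [exact: cstar_lin|exact: lin_scale].
have yr : opbound y r.
  move=> x; rewrite /y opE rnormZ /r mulrAC ler_pdivlMr // mulrC mulrA -rnormM.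
  by rewrite divff // {1}/rnorm normr1 mul1r.
pose g := fix g n : H -> H := if n is k.+1 then e + (y \o g k) else e.
have Bg n : B (g n).
  elim: n => [//|n IH] /=; apply: Badd => //.
  have -> : y \o g n = l^-1 *: ((b \o g n) + z *: g n) by [].
  by apply/Bscale/Badd; [exact: Bmul|exact: Bscale].
pose K := E / (1 - r).
have K0 : 0 <= K by rewrite divr_ge0 ?subr_ge0 ?ltW.
have KE : E + r * K = K by rewrite /K; field; rewrite subr_eq0 eq_sym lt_eqF.
have gK n : opbound (g n) K.
  elim: n => [|n IH] x /=.
    apply: le_trans (hE x) _; rewrite ler_wpM2r ?rnorm_ge0 // -KE lerDl.
    by rewrite mulr_ge0.
  rewrite -KE mulrDl; apply: le_trans (rnormD _ _) _; apply: lerD; first exact: hE.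
  apply: le_trans (yr _) _; rewrite -[leRHS]mulrA; exact: ler_wpM2l (IH x).
pose d n := 2 * K * r ^+ n.
have d0 (eps : R) : 0 < eps -> exists N, d N <= eps by move=> ?; exact: expr_small.
have dg m n : (n <= m)%N -> opbound (g m - g n) (d n).
  elim: n m => [|n IH] m nm x.
    rewrite /d expr0 mulr1 !opE; apply: le_trans (rnormB _ _) _.
    by have := gK m x; have := gK 0%N x; lra.
  case: m nm => // m nm; have := IH m nm x.
  have -> : (g m.+1 - g n.+1) x = y ((g m - g n) x).
    by rewrite !opE /= !opE /= linB // opprD addrACA subrr add0r.
  move=> h; apply: le_trans (yr _) _; rewrite /d exprS.
  by have := ler_wpM2l r0 h; rewrite /d; lra.
have [w bw wv] := op_complete d0 (fun n => Bbdd (Bg n)) dg.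
have Bw : B w by exact: cstar_limit d0 Bg bw wv.
have wE : w = e + l^-1 *: ((b \o w) + z *: w).
  apply/funext => x; apply: (@eq_eps _ _ _ _ (2 * rnorm x)) => eps eps0.
  have [n hn] := d0 _ eps0.
  have -> : w x - (e + l^-1 *: ((b \o w) + z *: w)) x =
      (w - g n.+1) x - y ((w - g n) x).
    have -> : (e + l^-1 *: ((b \o w) + z *: w)) x = e x + y (w x) by [].
    have -> : (w - g n.+1) x = w x - (e x + y (g n x)) by [].
    have -> : y ((w - g n) x) = y (w x) - y (g n x) by rewrite !opE linB.
    move: (y (w x)) (y (g n x)) => y1 y2.
    by apply: rdotP => u; rewrite !rdotw; ring.
  apply: le_trans (rnormB _ _) _.
  have h1 := wv n.+1 x; have h2 := wv n x; have h3 := yr ((w - g n) x).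
  have h4 := ler_wpM2r (rnorm_ge0 x) hn.
  have h5 : d n.+1 * rnorm x <= eps * rnorm x.
    rewrite ler_wpM2r ?rnorm_ge0 //; apply: le_trans hn.
    rewrite /d exprS mulrCA ler_piMl //; last exact: ltW.
    by apply: mulr_ge0; [exact: mulr_ge0|exact: exprn_ge0].
  have h6 : r * rnorm ((w - g n) x) <= rnorm ((w - g n) x).
    by rewrite ler_piMl ?rnorm_ge0 // ltW.
  lra.
have Bbw := Bmul Bb Bw; have Bzw := Bscale z Bw; have Bs := Badd Bbw Bzw.
have /eqP := congr1 (ev tau) wE.
rewrite (evD tau Be (Bscale l^-1 Bs)) (evZ tau _ Bs) (evD tau Bbw Bzw).
rewrite (evM tau Bb Bw) (evZ tau _ Bw).
rewrite -mulrDl mulKf // -subr_eq0 opprD addrA addrAC subrr add0r oppr_eq0.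
by rewrite (negbTE he).
Qed.

Lemma ev_bound0 tau b M : B b -> 0 <= M -> opbound b M -> rnorm (ev tau b) <= M.
Proof.
move=> Bb M0 hM; have := @ev_bound tau b 0 M Bb M0.
by rewrite scale0r !addr0; apply.
Qed.

(** |ev tau b + i t|^2 <= M^2 + t^2 for all real t, which is only possible when
    the coefficient of t on the left vanishes. *)
Lemma ev_real tau b : B b -> sym b -> complex.Im (ev tau b) = 0.
Proof.
move=> Bb sb; have [M M0 hM] := bddP (Bbdd Bb).
have lb := cstar_lin Bb.
have key (t : R) : rnorm (ev tau b + 'i%C * t%:C) ^+ 2 <= M ^+ 2 + t ^+ 2.
  have h0 : 0 <= M ^+ 2 + t ^+ 2 by rewrite addr_ge0 // sqr_ge0.
  rewrite -[leRHS]sqr_sqrtr // ler_pXn2r // ?nnegrE ?rnorm_ge0 ?sqrtr_ge0 //.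
  apply: ev_bound => //.
  move=> x; rewrite -rdot_le_norms ?sqrtr_ge0 // sqr_sqrtr // !opE mulrC -scalerA.
  have h1 : rdot (b x) (b x) <= M ^+ 2 * rdot x x.
    by rewrite rdot_le_norms; [exact: hM|exact: ltW].
  have h2 : rdot ('i%C *: x) ('i%C *: x) = rdot x x.
    by rewrite rdot_i scalerA (_ : 'i%C * 'i%C = -1) ?scaleN1r ?rdotNr ?opprK // -expr2 sqr_i.
  have h3 : rdot (b x) ('i%C *: x) = 0.
    have : rdot (b x) ('i%C *: x) = - rdot ('i%C *: x) (b x).
      by rewrite sb linZ // rdot_i opprK.
    by rewrite (rdotC ('i%C *: x)); lra.
  rewrite !rdotw (rdotC ('i%C *: x) (b x)) h2 h3; have := rdot_ge0 x; lra.
move: key; case: (ev tau b) => u v key /=; apply/eqP; apply: contraT => v0.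
set t := (M ^+ 2 + 1) / (2 * v).
have : u ^+ 2 + (v + t) ^+ 2 <= M ^+ 2 + t ^+ 2.
  by have := key t; rewrite rnorm_sqr /= !(mul0r, mulr0, mul1r, subr0, add0r, addr0).
have : v * t = (M ^+ 2 + 1) / 2 by rewrite /t; field.
have := sqr_ge0 u; have := sqr_ge0 v; nra.
Qed.

Definition evr tau b : R := complex.Re (ev tau b).

Lemma ev_evr tau b : B b -> sym b -> ev tau b = (evr tau b)%:C.
Proof. by move=> Bb sb; rewrite /evr [LHS]complexE ev_real // mulr0 addr0. Qed.

Lemma evrD tau b c : B b -> B c -> evr tau (b + c) = evr tau b + evr tau c.
Proof. by move=> Bb Bc; rewrite /evr evD // raddfD. Qed.

Lemma evrB tau b c : B b -> B c -> evr tau (b - c) = evr tau b - evr tau c.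
Proof. by move=> Bb Bc; rewrite /evr evB // raddfB. Qed.

Lemma evrZ tau (r : R) b : B b -> evr tau (r%:C *: b) = r * evr tau b.
Proof.
by move=> Bb; rewrite /evr evZ //; case: (ev tau b) => u v /=; rewrite mul0r subr0.
Qed.

Lemma evrM tau b c : B b -> B c -> sym b -> sym c ->
  evr tau (b \o c) = evr tau b * evr tau c.
Proof. by move=> Bb Bc sb sc; rewrite {1}/evr evM // (ev_evr _ Bb) // (ev_evr _ Bc) // -rmorphM. Qed.

Lemma evr_ge0 tau b : B b -> sym b -> psd b -> 0 <= evr tau b.
Proof.
move=> Bb sb pb; have [s [Bs ss _ <-]] := cstar_sqrt Bb sb pb.
by rewrite evrM // -expr2 sqr_ge0.
Qed.

Lemma adjointC b c : is_adjoint b c -> forall x y, rdot (c x) y = rdot x (b y).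
Proof. by move=> h x y; rewrite (rdotC (c x)) -(adjoint_rdot h) rdotC. Qed.

Lemma cstar_reim b : B b -> exists b1 b2,
  [/\ B b1, B b2, sym b1, sym b2 & b = b1 + 'i%C *: b2].
Proof.
move=> Bb; have [c Bc bc] := cstar_adjoint cB Bb.
have h1 := adjoint_rdot bc; have h2 := adjointC bc.
exists ((2^-1 : R)%:C *: (b + c)), ((- 2^-1 : R)%:C *: ('i%C *: (b - c))); split.
- exact/Bscale/Badd.
- exact/Bscale/Bscale/cstar_sub.
- by apply: sym_scale => x y; rewrite !opE !rdotw h1 h2 addrC.
- apply: sym_scale => x y; rewrite !opE rdot_i rdotDl rdotNl h1 h2.
  rewrite (linZ _ _ (cstar_lin Bb)) (linZ _ _ (cstar_lin Bc)).
  by rewrite scalerBr rdotDr rdotNr; ring.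
- apply/funext => x; rewrite !opE; apply: rdotP => z.
  have -> : 'i%C *: ((- 2^-1)%:C *: ('i%C *: (b x - c x))) = (2^-1 : R)%:C *: (b x - c x).
    by rewrite !scalerA; congr (_ *: _); apply/eqP; rewrite eq_complex /=; apply/andP; split; apply/eqP; field.
  by rewrite !rdotw; field.
Qed.

Lemma ev_adjoint tau b c : B b -> B c -> is_adjoint b c -> ev tau c = (ev tau b)^*%C.
Proof.
move=> Bb Bc bc; have [b1 [b2 [B1 B2 s1 s2 be]]] := cstar_reim Bb.
have ce : c = b1 - 'i%C *: b2.
  apply/funext => x; apply: rdotP => y; rewrite (adjointC bc) be !opE !rdotw.
  by rewrite s1 rdot_i opprK s2 (linZ _ _ (cstar_lin B2)).
rewrite ce be evB ?evD ?evZ //; try exact: Bscale.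
by rewrite (ev_evr _ B1) // (ev_evr _ B2) //; apply/eqP; rewrite eq_complex /=; apply/andP; split; apply/eqP; ring.
Qed.

Lemma ev_abs2 tau b c : B b -> B c -> is_adjoint b c ->
  evr tau (c \o b) = rnorm (ev tau b) ^+ 2.
Proof.
move=> Bb Bc bc; rewrite /evr evM // (ev_adjoint _ Bb) // rnorm_sqr.
by case: (ev tau b) => u v /=; ring.
Qed.

Lemma sym_adjmul b c : is_adjoint b c -> sym (c \o b).
Proof. by move=> bc x y; rewrite /= (adjointC bc) (adjoint_rdot bc). Qed.

Lemma adjmul_dot b c x : is_adjoint b c -> rdot ((c \o b) x) x = rdot (b x) (b x).
Proof. by move=> bc; rewrite /= (adjointC bc). Qed.

End Characters.

(** * The topology of the spectrum *)

Section Topology.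

Lemma spectrum_cvg (F : set_system (spectrum B)) tau : Filter F ->
  (forall b, B b -> forall e : R, 0 < e -> \forall s \near F, rnorm (ev s b - ev tau b) <= e) ->
  F --> tau.
Proof.
move=> FF h.
have h1 : {ptws, (fun s : spectrum B => (val s : {ptws B -> R[i]^o})) @ F --> (val tau : {ptws B -> R[i]^o})}.
  apply/cvg_sup => b; apply/cvg_image.
    by rewrite eqEsubset; split => // v _; exists (cst v).
  move=> W /= hW.
  exists ((@^~ b) @^-1` W); last first.
    by rewrite eqEsubset; split => [j [? + <-//]|j Wj]; exists (fun _ => j).
  have /nbhs_ballP[e e0 he] := hW.
  have e0' : 0 < complex.Re e by move: e0; rewrite /= ltcE /= => /andP[].
  have eE : e = (complex.Re e)%:C by rewrite RRe_real // gtr0_real.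
  apply: filterS (h (val b) (set_valP b) _ (divr_gt0 e0' (ltr0n _ 2))) => s hs /=.
  apply: he; rewrite -ball_normE /ball_ /= normE eE ltcR rdistC.
  rewrite !evE in hs; apply: le_lt_trans hs _; lra.
move=> A; rewrite /nbhs /= => -[_ [[V Vop <-] Vtau sVA]].
have : nbhs (val tau : {ptws B -> R[i]^o}) V by exact: open_nbhs_nbhs.
by move=> /h1 hV; exact: (@filterS _ F _ _ _ sVA hV).
Qed.

Lemma gelfand_continuous (b : B) : continuous (gelfand b : spectrum B -> R[i]^o).
Proof.
have c1 : continuous (fun s : spectrum B => (val s : {ptws B -> R[i]^o})).
  exact: initial_continuous.
have c2 : continuous (fun f : {ptws B -> R[i]^o} => f b).
  by move=> f; apply: (@proj_continuous _ _ b).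
by move=> s; exact: (continuous_comp (c1 s) (c2 _)).
Qed.

Lemma ev_continuous tau b (e : R) : B b -> 0 < e ->
  \forall s \near tau, rnorm (ev s b - ev tau b) <= e.
Proof.
move=> Bb e0; have /cvgrPdist_le/(_ e%:C) := @gelfand_continuous (inB Bb) tau.
rewrite ltcR => /(_ e0); apply: filterS => s.
by rewrite normE lecR -!evE rdistC.
Qed.

Lemma spectrum_hausdorff : hausdorff_space (spectrum B).
Proof.
move=> s t cl; apply: val_inj; apply/funext => b.
apply/eqP; rewrite -subr_eq0; apply/eqP/rnorm_eq0/eqP.
rewrite eq_le rnorm_ge0 andbT; apply: (@le0_eps _ _ 2) => e e0.
have Bb := set_valP b.
have [r [h1 h2]] := cl _ _ (ev_continuous s Bb e0) (ev_continuous t Bb e0).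
have := rnorm_dist (ev r (val b)) (ev s (val b)) (ev t (val b)).
rewrite (rdistC (ev s (val b)) (ev r (val b))) => h3.
suff : rnorm (ev s (val b) - ev t (val b)) <= 2 * e by rewrite !evE /gelfand.
lra.
Qed.

(** The identities defining characters pass to limits, and bounded scalars
    converge along an ultrafilter.  With evaluations at the points of the
    spectrum as phi this gives compactness, with vector states at approximate
    eigenvectors it gives existence of characters.  The last hypothesis keeps
    the limit from being zero. *)
Lemma ultra_character (X : Type) (U : set_system X) (phi : (H -> H) -> X -> R[i]) :
  UltraFilter U ->
  (forall b, B b -> exists M : R, \forall x \near U, rnorm (phi b x) <= M) ->
  (forall (u : R[i]) b c, B b -> B c -> forall e : R, 0 < e ->
     \forall x \near U, rnorm (phi (u *: b + c) x - (u * phi b x + phi c x)) <= e) ->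
  (forall b c, B b -> B c -> forall e : R, 0 < e ->
     \forall x \near U, rnorm (phi (b \o c) x - phi b x * phi c x) <= e) ->
  (exists2 b, B b & exists2 d : R, 0 < d & \forall x \near U, d <= rnorm (phi b x)) ->
  exists tau : spectrum B, forall b, B b -> forall e : R, 0 < e ->
    \forall x \near U, rnorm (phi b x - ev tau b) <= e.
Proof.
move=> UU hbd hlin hmul [b0 Bb0 [d d0 hd]].
have PU : ProperFilter U by exact: ultra_proper.
have ex b : exists l, B b -> forall e : R, 0 < e -> \forall x \near U, rnorm (phi b x - l) <= e.
  have [Bb|nB] := pselect (B b); last by exists 0.
  by have [M hM] := hbd b Bb; have [l hl] := ultra_lim UU hM; exists l.
pose L b := projT1 (cid (ex b)).
have LP b : B b -> forall e : R, 0 < e -> \forall x \near U, rnorm (phi b x - L b) <= e.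
  exact: (projT2 (cid (ex b))).
have [tau ht] : exists tau : spectrum B, forall b, B b -> ev tau b = L b.
  apply: spectrum_mk.
  - exists b0 => //; apply/eqP => L0.
    have /filter_ex[x [h1 h2]] : \forall x \near U,
        d <= rnorm (phi b0 x) /\ rnorm (phi b0 x - L b0) <= d / 2.
      by near=> x; split; near: x => //; apply: LP => //; rewrite divr_gt0.
    by move: h2; rewrite L0 subr0; lra.
  - move=> u b c Bb Bc; have Bs : B (u *: b + c) by apply: Badd => //; exact: Bscale.
    apply/eqP; rewrite -subr_eq0; apply/eqP/rnorm_eq0/eqP.
    rewrite eq_le rnorm_ge0 andbT; apply: (@le0_eps _ _ (3 + rnorm u)) => e e0.
    have /filter_ex[x [h1 h2 h3 h4]] : \forall x \near U,
        [/\ rnorm (phi (u *: b + c) x - L (u *: b + c)) <= e,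
            rnorm (phi b x - L b) <= e, rnorm (phi c x - L c) <= e &
            rnorm (phi (u *: b + c) x - (u * phi b x + phi c x)) <= e].
      by near=> x; split; near: x; [exact: LP|exact: LP|exact: LP|exact: hlin].
    have -> : L (u *: b + c) - (u * L b + L c) =
       (phi (u *: b + c) x - (u * phi b x + phi c x)) -
       (phi (u *: b + c) x - L (u *: b + c)) +
       (u * (phi b x - L b) + (phi c x - L c)) by ring.
    apply: le_trans (rnormD _ _) _.
    have := rnormB (phi (u *: b + c) x - (u * phi b x + phi c x))
      (phi (u *: b + c) x - L (u *: b + c)).
    have := rnormD (u * (phi b x - L b)) (phi c x - L c).
    rewrite rnormM; have := ler_wpM2l (rnorm_ge0 u) h2; lra.
  - move=> b c Bb Bc; have Bs : B (b \o c) by exact: Bmul.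
    apply/eqP; rewrite -subr_eq0; apply/eqP/rnorm_eq0/eqP.
    rewrite eq_le rnorm_ge0 andbT.
    have [M hM] := hbd b Bb.
    apply: (@le0_eps _ _ (2 + `|M| + rnorm (L c))) => e e0.
    have /filter_ex[x [h1 h2 h3 [h4 h5]]] : \forall x \near U,
        [/\ rnorm (phi (b \o c) x - L (b \o c)) <= e,
            rnorm (phi b x - L b) <= e, rnorm (phi c x - L c) <= e &
            rnorm (phi (b \o c) x - phi b x * phi c x) <= e /\ rnorm (phi b x) <= M].
      near=> x; split; [| | |split]; near: x;
        [exact: LP|exact: LP|exact: LP|exact: hmul|exact: hM].
    have -> : L (b \o c) - L b * L c =
       (phi (b \o c) x - phi b x * phi c x) - (phi (b \o c) x - L (b \o c)) +
       (phi b x * (phi c x - L c) + (phi b x - L b) * L c) by ring.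
    apply: le_trans (rnormD _ _) _.
    have := rnormB (phi (b \o c) x - phi b x * phi c x) (phi (b \o c) x - L (b \o c)).
    have := rnormD (phi b x * (phi c x - L c)) ((phi b x - L b) * L c).
    rewrite !rnormM.
    have k1 : rnorm (phi b x) * rnorm (phi c x - L c) <= `|M| * e.
      by apply: ler_pM; rewrite ?rnorm_ge0 //; apply: le_trans h5 (ler_norm _).
    have := ler_wpM2r (rnorm_ge0 (L c)) h2; lra.
by exists tau => b Bb e e0; rewrite ht //; exact: LP.
Unshelve. all: by end_near. Qed.

(** Gelfand transforms vanish at infinity: a limit of characters in this set is
    a non-zero multiplicative functional, since its value at b stays away
    from 0. *)
Lemma compact_ev_ge b (d : R) : B b -> 0 < d ->
  compact [set tau : spectrum B | d <= rnorm (ev tau b)].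
Proof.
move=> Bb d0; rewrite compact_ultra => U UU hU.
have PU : ProperFilter U by exact: ultra_proper.
have [||||tau ht] := @ultra_character _ U (fun b tau => ev tau b) UU.
- move=> c Bc; have [M M0 hM] := bddP (Bbdd Bc); exists M.
  by near=> s; apply: ev_bound0 => //; exact: ltW.
- by move=> u c c' Bc Bc' e e0; near=> s; rewrite ev_lin // subrr rnorm0 ltW.
- by move=> c c' Bc Bc' e e0; near=> s; rewrite evM // subrr rnorm0 ltW.
- by exists b => //; exists d.
exists tau; split; last by apply: spectrum_cvg => // c Bc e e0; exact: ht.
rewrite /=; apply: le_eps => e e0.
have /filter_ex[s [h1 h2]] : \forall s \near U,
    d <= rnorm (ev s b) /\ rnorm (ev s b - ev tau b) <= e.
  by near=> s; split; near: s => //; exact: ht.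
have := rnormD (ev s b - ev tau b) (ev tau b); rewrite subrK; lra.
Unshelve. all: by end_near. Qed.

Lemma open_ev_gt b (z : R[i]) (d : R) : B b ->
  open [set tau : spectrum B | d < rnorm (ev tau b - z)].
Proof.
move=> Bb; rewrite openE => tau /= h; rewrite /interior.
have e0 : 0 < (rnorm (ev tau b - z) - d) / 2 by rewrite divr_gt0 // subr_gt0.
apply: filterS (ev_continuous tau Bb e0) => s hs /=.
have := rnormD (ev tau b - ev s b) (ev s b - z); rewrite subrKA (rdistC (ev tau b) (ev s b)); lra.
Qed.

Lemma spectrum_locally_compact : locally_compact [set: spectrum B].
Proof.
move=> tau _; have [e Be he] := ev_neq0 tau.
have d0 : 0 < rnorm (ev tau e) / 2.
  by rewrite divr_gt0 // rnorm_gt0.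
pose K := [set s : spectrum B | rnorm (ev tau e) / 2 <= rnorm (ev s e)].
exists K; last first.
  split; first exact: compact_ev_ge.
  apply: compact_closed; [exact: spectrum_hausdorff|exact: compact_ev_ge].
apply: filterS (ev_continuous tau Be d0) => s hs _ /=; rewrite /K /=.
have := rnormD (ev tau e - ev s e) (ev s e); rewrite subrK (rdistC (ev tau e) (ev s e)); lra.
Qed.

End Topology.

(** * Existence of characters *)

Section Existence.

Lemma sym_sq0 p : sym p -> (forall x, p (p x) = 0) -> p = 0.
Proof.
by move=> sp h; apply/funext => x; apply: rdot_eq0; rewrite sp h rdot0r.
Qed.

(** A substitute for the spectral projections of b inside the range of c.  As
    b - t need not be in B, p is the positive part of c (b - t) c, and the
    alternative is whether p vanishes. *)
Lemma spectral_cut b c (t : R) : B b -> sym b -> B c -> sym c ->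
  (exists p, [/\ B p, sym p, c \o p != 0 & forall y,
     t * rdot (c (p y)) (c (p y)) <= rdot (b (c (p y))) (c (p y))]) \/
  (forall y, rdot (b (c y)) (c y) <= t * rdot (c y) (c y)).
Proof.
move=> Bb sb Bc sc.
have Bcb := Bmul Bc Bb; have Bcc := Bmul Bc Bc; have Bccb := Bmul Bc Bcb.
pose q : H -> H := (c \o (c \o b)) - t%:C *: (c \o c).
have Bq : B q by apply: cstar_sub => //; exact: Bscale.
have sq : sym q.
  by apply: sym_sub; [apply: Bsym => //; exact: Bsym|apply: sym_scale; exact: Bsym].
have qE y : rdot (q y) y = rdot (b (c y)) (c y) - t * rdot (c y) (c y).
  rewrite /q !opE /= !rdotw !(sc _ y); congr (_ - _).
  by rewrite (cstar_commx _ Bc Bb).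
have [p [m [[Bp Bm sp sm] qpm pm0 ppm]]] := cstar_posneg Bq sq.
have mp0 y : m (p y) = 0.
  by rewrite (cstar_commx _ Bm Bp) -[p (m y)]/((p \o m) y) pm0.
have qp y : q (p y) = p (p y) by rewrite qpm !opE mp0 subr0.
have [p0|pN0] := eqVneq p 0; [right|left].
  move=> y; rewrite -subr_le0 -qE qpm p0 sub0r !opE rdotNl oppr_le0.
  by have := ppm y; rewrite p0 add0r.
exists p; split => //.
- apply: contra_neq pN0 => cp0; apply: (sym_sq0 sp) => x; rewrite -qp /q !opE /=.
  have cp y : c (p y) = 0 by rewrite -[LHS]/((c \o p) y) cp0.
  rewrite cp (lin0 (cstar_lin Bc)) scaler0 subr0.
  rewrite -[c (b (p x))](cstar_commx _ Bb Bc) cp.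
  by rewrite (lin0 (cstar_lin Bb)) (lin0 (cstar_lin Bc)).
- move=> y; rewrite -subr_ge0 -qE qp.
  by have := ppm (p y); rewrite !opE mp0 addr0.
Qed.

(** Let beta be the supremum of the form of b on unit vectors in the range of c,
    and cut at beta - e.  On the range of c p the form of beta - b lies between
    0 and e, so that form_sandwich applies. *)
Lemma approx_eigen_sym b c (e : R) : B b -> sym b -> B c -> sym c -> c != 0 -> 0 < e ->
  exists p, [/\ B p, sym p, c \o p != 0 & exists t : R, forall y,
    rnorm (b (c (p y)) - t%:C *: c (p y)) <= e * rnorm (c (p y))].
Proof.
move=> Bb sb Bc sc cN0 e0; have [M M0 hM] := bddP (Bbdd Bb).
have lb := cstar_lin Bb; have lc := cstar_lin Bc.
have [x0 hx0] := op_neq0 cN0.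
pose A := [set r | exists2 y, c y != 0 & r = rdot (b (c y)) (c y) / rdot (c y) (c y)].
have pos y : c y != 0 -> 0 < rdot (c y) (c y).
  move=> cy; rewrite lt_neqAle rdot_ge0 andbT eq_sym.
  by apply: contra_neq cy => /rdot_eq0.
have supA : has_sup A.
  split; first by exists (rdot (b (c x0)) (c x0) / rdot (c x0) (c x0)), x0.
  exists M => _ [y cy ->]; rewrite ler_pdivrMr ?pos //.
  by apply: le_trans (ler_norm _) _; apply: opbound_form => //; exact: ltW.
pose beta := sup A.
have up y : rdot (b (c y)) (c y) <= beta * rdot (c y) (c y).
  have [cy0|cy] := eqVneq (c y) 0; first by rewrite cy0 (lin0 lb) !rdot0l mulr0.
  rewrite -ler_pdivrMr ?pos //; apply: ub_le_sup; first by case: supA.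
  by exists y.
have [[p [Bp sp cp lo]]|hi] := spectral_cut (beta - e) Bb sb Bc sc; last first.
  have : beta <= beta - e.
    apply: ge_sup; first by case: supA.
    by move=> _ [y cy ->]; rewrite ler_pdivrMr ?pos.
  lra.
have lp := cstar_lin Bp.
exists p; split => //; exists beta => y.
pose a : H -> H := beta%:C *: id - b.
have la : linear a by apply: lin_sub => //; exact: lin_scale.
have sa : sym a by apply: sym_sub => //; exact: sym_scale.
have aE x : rdot (a x) x = beta * rdot x x - rdot (b x) x by rewrite /a !opE !rdotw.
have ac x : a (c (p x)) = c (p (a x)).
  rewrite /a !opE (linB _ _ lp) (linB _ _ lc) (linZ _ _ lp) (linZ _ _ lc).
  by rewrite (cstar_commx _ Bb Bc) (cstar_commx _ Bb Bp).
set z := c (p y).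
have h1 : 0 <= rdot (a (z - e^-1%:C *: a z)) (z - e^-1%:C *: a z).
  have -> : z - e^-1%:C *: a z = c (p (y - e^-1%:C *: a y)).
    by rewrite (linB _ _ lp) (linB _ _ lc) (linZ _ _ lp) (linZ _ _ lc) -ac.
  by rewrite aE subr_ge0.
have h2 : rdot (a (a z)) (a z) <= e * rdot (a z) (a z).
  by rewrite {1 2}/z ac; rewrite aE; have := lo (a y); rewrite -!ac -/z; lra.
have h3 := form_sandwich la sa e0 h1 h2.
rewrite -[_ - _]opprB rnormN -(rdot_le_norms _ _ (ltW e0)).
have -> : beta%:C *: z - b z = a z by [].
apply: le_trans h3 _; rewrite expr2 -mulrA ler_wpM2l //; first exact: ltW.
rewrite aE.
by have := lo y; rewrite -/z; lra.
Qed.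

Lemma approx_eigen b c (e : R) : B b -> B c -> sym c -> c != 0 -> 0 < e ->
  exists p, [/\ B p, sym p, c \o p != 0 & exists t : R[i], forall y,
    rnorm (b (c (p y)) - t *: c (p y)) <= e * rnorm (c (p y))].
Proof.
move=> Bb Bc sc cN0 e0; have e2 : 0 < e / 2 by rewrite divr_gt0.
have [b1 [b2 [B1 B2 s1 s2 be]]] := cstar_reim Bb.
have [p1 [Bp1 sp1 cp1 [t1 h1]]] := approx_eigen_sym B1 s1 Bc sc cN0 e2.
have [p2 [Bp2 sp2 cp2 [t2 h2]]] :=
  approx_eigen_sym B2 s2 (Bmul Bc Bp1) (Bsym Bc Bp1 sc sp1) cp1 e2.
exists (p1 \o p2); split => //; [exact: Bmul|exact: Bsym|].
exists (t1%:C + 'i%C * t2%:C) => y /=; set z := c (p1 (p2 y)).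
have -> : b z - (t1%:C + 'i%C * t2%:C) *: z =
   (b1 z - t1%:C *: z) + 'i%C *: (b2 z - t2%:C *: z).
  by rewrite be !opE scalerDl -scalerA scalerBr opprD addrACA.
apply: le_trans (rnormD _ _) _; rewrite rnormZ.
rewrite rnorm_i.
by have := h1 (p2 y); have := h2 y; rewrite /= -/z; lra.
Qed.

Lemma joint_approx_eigen (F : seq (H -> H)) c (e : R) :
  (forall b, b \in F -> B b) -> B c -> sym c -> c != 0 -> 0 < e ->
  exists p, [/\ B p, sym p, c \o p != 0 & forall b, b \in F -> exists t : R[i], forall y,
    rnorm (b (c (p y)) - t *: c (p y)) <= e * rnorm (c (p y))].
Proof.
move=> + + + + e0; elim: F c => [|b F IH] c FB Bc sc cN0.
  have [p [Bp sp cp _]] := approx_eigen Bc Bc sc cN0 e0.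
  by exists p; split.
have [p1 [Bp1 sp1 cp1 [t1 h1]]] := approx_eigen (FB b (mem_head _ _)) Bc sc cN0 e0.
have [|p2 [Bp2 sp2 cp2 h2]] := IH (c \o p1) _ (Bmul Bc Bp1) (Bsym Bc Bp1 sc sp1) cp1.
  by move=> b' b'F; apply: FB; rewrite inE b'F orbT.
exists (p1 \o p2); split => //; [exact: Bmul|exact: Bsym|].
move=> b'; rewrite inE => /orP[/eqP ->|/h2//].
by exists t1 => y; exact: h1.
Qed.

Lemma rnorm_inner x y : rnorm (inner x y) <= 2 * (rnorm x * rnorm y).
Proof.
rewrite inner_rdot; apply: le_trans (rnorm_ReIm _) _; rewrite /= normrN.
have := rdot_CS x y; have := rdot_CS ('i%C *: x) y; rewrite rnormZ rnorm_i; lra.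
Qed.

(** Finite sets of elements of B have joint approximate eigenvectors of norm 1
    with arbitrary precision.  On such vectors the vector states are almost
    multiplicative, and along an ultrafilter they converge to a character.
    Choosing the vectors in a range on which p^2 is bounded below makes its
    value at p^2 non-zero. *)
Lemma ev_separates p : B p -> sym p -> p != 0 -> exists tau : spectrum B, ev tau p != 0.
Proof.
move=> Bp sp pN0; have lp := cstar_lin Bp.
have Bpp := Bmul Bp Bp; have spp := Bsym Bp Bp sp sp.
(* if no cut of p^2 at d > 0 were possible in the range of p, then p^4 <= d p^2
   for all d > 0, and p = 0 *)
have [d d0 [p1 [Bp1 sp1 cp1 hp1]]] : exists2 d : R, 0 < d &
    exists p1, [/\ B p1, sym p1, p \o p1 != 0 & forall y,
     d * rdot (p (p1 y)) (p (p1 y)) <= rdot ((p \o p) (p (p1 y))) (p (p1 y))].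
  apply: contrapT => hno; move/eqP: pN0; apply; apply: (sym_sq0 sp) => x.
  apply: rdot_eq0.
  apply/eqP; rewrite eq_le rdot_ge0 andbT.
  apply: (@le0_eps _ _ (rdot (p x) (p x))) => e e0.
  have [|h] := spectral_cut e Bpp spp Bp sp; first by move=> ?; case: hno; exists e.
  by have := h x; rewrite /= (sp (p (p x))) mulrC.
pose c := p \o p1.
have Bc : B c by exact: Bmul.
have sc : sym c by exact: Bsym.
pose D := [set Fe : seq (H -> H) * R | (forall b, b \in Fe.1 -> B b) /\ 0 < Fe.2].
pose X (Fe : seq (H -> H) * R) := [set z | [/\ rnorm z = 1, exists y, z = c y &
   forall b, b \in Fe.1 -> exists t : R[i], rnorm (b z - t *: z) <= Fe.2]].
have PF : ProperFilter (filter_from D X).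
  apply: filter_from_proper; last first.
    move=> [F e] [/= FB e0].
    have [q [Bq sq cq hq]] := joint_approx_eigen FB Bc sc cp1 e0.
    have [y /= hy] := op_neq0 cq; rewrite -/(c (q y)) in hy.
    have n0 := rnorm_gt0 hy.
    exists ((rnorm (c (q y)))^-1%:C *: c (q y)); split.
    - by rewrite rnormZ rnorm_real ger0_norm ?mulVf ?gt_eqF // invr_ge0 ltW.
    - exists ((rnorm (c (q y)))^-1%:C *: q y); rewrite linZ //; exact: cstar_lin.
    - move=> b bF; have [t ht] := hq b bF; exists t.
      rewrite (linZ _ _ (cstar_lin (FB b bF))) scalerA mulrC -scalerA -scalerBr.
      rewrite rnormZ rnorm_real ger0_norm; last by rewrite invr_ge0 ltW.
      rewrite ler_pdivrMl // mulrC.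
      exact: ht.
  apply: filter_from_filter; first by exists ([::], 1); split.
  move=> [F1 e1] [F2 e2] [/= h1 e10] [/= h2 e20].
  exists (F1 ++ F2, Num.min e1 e2).
    split=> /=; last by rewrite lt_min e10.
    by move=> b; rewrite mem_cat => /orP[/h1|/h2].
  move=> z [z1 zc hz]; split; split=> //= b bF.
    have [|t ht] := hz b; first by rewrite mem_cat bF.
    by exists t; apply: le_trans ht _; rewrite ge_min lexx.
  have [|t ht] := hz b; first by rewrite mem_cat bF orbT.
  by exists t; apply: le_trans ht _; rewrite ge_min lexx orbT.
have [U [UU FU]] := ultraFilterLemma PF.
have PU : ProperFilter U by exact: ultra_proper.
have UX F e : (forall b, b \in F -> B b) -> 0 < e -> U (X (F, e)).
  by move=> hF e0; apply: FU; exists (F, e).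
have [||||tau ht] := @ultra_character _ U (fun b z => inner (b z) z) UU.
- move=> b Bb; have [M M0 hM] := bddP (Bbdd Bb); exists (2 * M).
  apply: filterS (UX [::] 1 _ ltr01) => // z [z1 _ _].
  apply: le_trans (rnorm_inner _ _) _; have := hM z; rewrite z1 !mulr1.
  by rewrite ler_pM2l.
- move=> u b b' Bb Bb' e e0; near=> z.
  by rewrite !opE innerDl innerZl subrr rnorm0 ltW.
- move=> b b' Bb Bb' e e0; have [M M0 hM] := bddP (Bbdd Bb).
  have e1 : 0 < e / (6 * M) by rewrite divr_gt0 // mulr_gt0.
  apply: filterS (UX [:: b'] _ _ e1); last by move=> ?; rewrite inE => /eqP ->.
  move=> z [z1 _ /(_ b' (mem_head _ _))[t ht]]; rewrite /= in ht.
  pose r := b' z - t *: z.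
  have -> : inner (b (b' z)) z - inner (b z) z * inner (b' z) z =
     inner (b r) z - inner (b z) z * inner r z.
    have b'E : b' z = t *: z + r by rewrite /r addrC subrK.
    have izz : inner z z = 1.
      by rewrite inner_norm normE z1 expr1n.
    by rewrite b'E (cstar_lin Bb t) !innerDl !innerZl izz; ring.
  apply: le_trans (rnormB _ _) _; rewrite rnormM.
  have k1 := rnorm_inner (b r) z; have k2 := rnorm_inner (b z) z.
  have k3 := rnorm_inner r z; rewrite z1 !mulr1 in k1 k2 k3.
  have k4 := hM r; have k5 := hM z; rewrite z1 mulr1 in k5.
  have k6 : rnorm (inner (b z) z) * rnorm (inner r z) <= (2 * M) * (2 * rnorm r).
    by apply: ler_pM; rewrite ?rnorm_ge0 //; lra.
  have k7 : M * rnorm r <= e / 6.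
    rewrite -ler_pdivlMl //; apply: le_trans ht _.
    by rewrite le_eqVlt; apply/orP; left; apply/eqP; field; rewrite gt_eqF.
  lra.
- exists (p \o p) => //; exists d => //.
  apply: filterS (UX [::] 1 _ ltr01) => // z [z1 [y zy] _].
  apply: le_trans (rnorm_Re _); apply: le_trans (ler_norm _).
  have := hp1 y; rewrite -[p (p1 y)]/(c y) -zy rdotE z1 expr1n mulr1; exact.
exists tau; apply/eqP => tp0.
have := ht _ Bpp (d / 2) (divr_gt0 d0 (ltr0n _ 2)).
have : \forall z \near U, d <= complex.Re (inner ((p \o p) z) z).
  apply: filterS (UX [::] 1 _ ltr01) => // z [z1 [y zy] _].
  have := hp1 y; rewrite -[p (p1 y)]/(c y) -zy rdotE z1 expr1n mulr1; exact.
move=> /filterI h /h /filter_ex[z [k1]].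
rewrite evM // tp0 mulr0 subr0 => k2.
by have := le_trans (ler_norm _) (rnorm_Re (inner ((p \o p) z) z)); lra.
Unshelve. all: by end_near. Qed.

Lemma ev_eq0 b : B b -> sym b -> (forall tau : spectrum B, evr tau b = 0) -> b = 0.
Proof.
move=> Bb sb h; apply/eqP; apply: contraT => bN0.
have [tau] := ev_separates Bb sb bN0.
by rewrite ev_evr // h eqxx.
Qed.

(** Where b^ >= 0 the transform of the negative part m of b vanishes, as
    characters are multiplicative and m (b + m) = 0; by separation m = 0. *)
Lemma psd_ev b : B b -> sym b -> (forall tau : spectrum B, 0 <= evr tau b) -> psd b.
Proof.
move=> Bb sb h; have [p [m [[Bp Bm sp sm] bE pm0 ppm]]] := cstar_posneg Bb sb.
suff m0 : m = 0 by rewrite bE m0 subr0; rewrite m0 addr0 in ppm.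
apply: (ev_eq0 Bm sm) => tau.
have /eqP := congr1 (evr tau) pm0; rewrite evrM // {3}/evr ev0 mulf_eq0.
case/orP => /eqP // p0.
have := h tau; have := evr_ge0 tau (Badd Bp Bm) (sym_add sp sm) ppm.
by rewrite bE evrD // evrB // p0; lra.
Qed.

Lemma cstar_posneg_ev q : B q -> sym q -> exists p m,
  [/\ B p /\ B m, sym p /\ sym m, q = p - m /\ p \o m = 0, psd p /\ psd m &
      forall tau : spectrum B, evr tau p = Num.max (evr tau q) 0].
Proof.
move=> Bq sq; have [p [m [[Bp Bm sp sm] qE pm0 ppm]]] := cstar_posneg Bq sq.
have key (tau : spectrum B) :
    [/\ 0 <= evr tau p, 0 <= evr tau m & evr tau p = Num.max (evr tau q) 0].
  have /eqP := congr1 (evr tau) pm0; rewrite evrM // {3}/evr ev0 mulf_eq0.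
  have := evr_ge0 tau (Badd Bp Bm) (sym_add sp sm) ppm.
  rewrite qE evrD // evrB // => h /orP[] /eqP h0.
    rewrite h0 add0r in h; rewrite h0 sub0r; split=> //.
    by rewrite maxEle oppr_le0 h.
  rewrite h0 addr0 in h; rewrite h0 subr0; split=> //.
  by rewrite maxElt ltNge h.
exists p, m; split=> //; last by move=> tau; have [] := key tau.
by split; apply: psd_ev => // tau; have [] := key tau.
Qed.

(** u - u^2 has a nonnegative transform, hence u^2 <= u, and then
    (1 - u)^2 >= 0 gives u <= 1. *)
Lemma effect_ev u : B u -> sym u -> (forall tau : spectrum B, 0 <= evr tau u <= 1) ->
  effect u.
Proof.
move=> Bu su h; split=> //; first exact: cstar_lin.
  by apply: psd_ev => // tau; case/andP: (h tau).
have p1 : psd (u - (u \o u)).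
  apply: psd_ev; [by apply: cstar_sub => //; exact: Bmul|exact/sym_sub/Bsym|].
  move=> tau; have /andP[h1 h2] := h tau.
  by rewrite (evrB tau Bu (Bmul Bu Bu)) (evrM tau Bu Bu su su); nra.
move=> x; rewrite !opE !rdotw subr_ge0.
have h1 : rdot (u x) (u x) <= rdot (u x) x.
  by have := p1 x; rewrite !opE /= !rdotw su (su (u x)); rewrite (rdotC x); lra.
have h2 := rdot_ge0 (u x - x).
rewrite !rdotw (rdotC x (u x)) in h2; lra.
Qed.

(** Stand-ins for the continuous functions between 0 and the indicator of U. *)
Definition below (U : set (spectrum B)) u : Prop :=
  [/\ B u, sym u, forall tau, 0 <= evr tau u <= 1 & forall tau, ~ U tau -> evr tau u = 0].

Lemma below_effect U u : below U u -> effect u.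
Proof. by case=> ? ? h _; exact: effect_ev. Qed.

Lemma cstar_scale_effect u : B u -> sym u -> (forall tau : spectrum B, 0 <= evr tau u) ->
  exists2 k : R, 0 < k & forall tau : spectrum B, 0 <= evr tau (k%:C *: u) <= 1.
Proof.
move=> Bu su h; have [M M0 hM] := bddP (Bbdd Bu); exists M^-1; first by rewrite invr_gt0.
move=> tau; rewrite evrZ //; apply/andP; split.
  by rewrite mulr_ge0 // invr_ge0 ltW.
rewrite ler_pdivrMl // mulr1; apply: le_trans (ler_norm _) _.
apply: le_trans (rnorm_Re _) _; apply: ev_bound0 => //; exact: ltW.
Qed.

(** This replaces Urysohn's lemma.  The sets where some positive element of B is
    non-zero are stable under intersection (take products), and those containing
    tau generate its neighbourhoods because |b^ - b^(tau)| < e on the set where the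
    positive part of |e0|^2 (e^2 - |b - b^(tau)|^2) is non-zero, for any e0 in B
    with e0^(tau) != 0. *)
Lemma below_basis (U : set (spectrum B)) tau : open U -> U tau ->
  exists2 u, below U u & 0 < evr tau u.
Proof.
move=> oU Ut.
pose D := [set u | [/\ B u, sym u, forall s : spectrum B, 0 <= evr s u & 0 < evr tau u]].
pose F := filter_from D (fun u => [set s : spectrum B | 0 < evr s u]).
have [e0 Be0 he0] := ev_neq0 tau.
have [e1 Be1 ade] := cstar_adjoint cB Be0.
have Bee := Bmul Be1 Be0; have see := sym_adjmul ade.
have e0t := rnorm_gt0 he0.
have FF : Filter F.
  apply: filter_from_filter.
    exists (e1 \o e0); split=> // [s|]; rewrite (ev_abs2 _ Be0) ?sqr_ge0 //.
    by rewrite exprn_gt0.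
  move=> u v [Bu su pu tu] [Bv sv pv tv]; exists (u \o v).
    split; [exact: Bmul|exact: Bsym| |].
      by move=> s; rewrite evrM // mulr_ge0.
    by rewrite evrM // mulr_gt0.
  move=> s /=; rewrite evrM // => h; split; rewrite lt_neqAle ?pu ?pv andbT;
    by apply/eqP => h0; move: h; rewrite -h0 ?mul0r ?mulr0 ltxx.
have Ftau : F --> tau.
  apply: spectrum_cvg => b Bb e eps0.
  pose d := (e0 \o b) - ev tau b *: e0.
  have Bd : B d by apply: cstar_sub; [exact: Bmul|exact: Bscale].
  have evd s : ev s d = ev s e0 * (ev s b - ev tau b).
    rewrite /d (evB s (Bmul Be0 Bb) (Bscale _ Be0)) (evM s Be0 Bb) (evZ s _ Be0).
    ring.
  have [d1 Bd1 add] := cstar_adjoint cB Bd.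
  have Bdd := Bmul Bd1 Bd; have sdd := sym_adjmul add.
  pose g : H -> H := (e ^+ 2)%:C *: (e1 \o e0) - (d1 \o d).
  have Bg : B g by apply: cstar_sub => //; exact: Bscale.
  have sg : sym g by apply: sym_sub => //; exact: sym_scale.
  have evg s : evr s g = e ^+ 2 * rnorm (ev s e0) ^+ 2 -
      rnorm (ev s e0) ^+ 2 * rnorm (ev s b - ev tau b) ^+ 2.
    rewrite /g (evrB s (Bscale _ Bee) Bdd) (evrZ s _ Bee).
    by rewrite (ev_abs2 s Be0 Be1 ade) (ev_abs2 s Bd Bd1 add) evd rnormM exprMn.
  have [p [m [[Bp _] [sp _] _ _ hp]]] := cstar_posneg_ev Bg sg.
  exists p.
    split=> //; first by move=> s; rewrite hp le_max lexx orbT.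
    rewrite hp lt_max evg subrr rnorm0 expr0n mulr0 subr0 mulr_gt0 ?exprn_gt0 //.
  move=> s /=; rewrite hp lt_max ltxx orbF evg => h.
  rewrite -(ler_pXn2r (n := 2)) ?nnegrE ?rnorm_ge0 ?(ltW eps0) //.
  rewrite leNgt; apply/negP => h1.
  by have := sqr_ge0 (rnorm (ev s e0)); nra.
have [u [Bu su pu tu] uU] : F U by apply: Ftau; exact: open_nbhs_nbhs.
have [k k0 hk] := cstar_scale_effect Bu su pu.
exists (k%:C *: u); last by rewrite evrZ // mulr_gt0.
split=> //; [exact: Bscale|exact: sym_scale|].
move=> s Us; rewrite evrZ //; apply/eqP; rewrite mulf_eq0; apply/orP; right.
by rewrite eq_le pu andbT leNgt; apply/negP => /uU.
Qed.

End Existence.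

(** * The projections of open sets, and their outer extension *)

Section OpenProjections.

(** In terms of functions, u + v - u v dominates u and v, and 2 u - u^2 has
    values in [0, 1] again. *)
Lemma below_sup U : exists p, is_sup_of (below U) p.
Proof.
apply: sup_projection.
- exists 0; split; [exact: cstar_0 cB|exact: sym_zero| |].
    by move=> tau; rewrite /evr ev0 lexx ler01.
  by move=> tau _; rewrite /evr ev0.
- by move=> u; exact: below_effect.
- move=> u v [Bu su hu uU] [Bv sv hv vU]; have Buv := Bmul Bu Bv.
  have evE tau : evr tau (u + v - (u \o v)) = evr tau u + evr tau v - evr tau u * evr tau v.
    by rewrite (evrB tau (Badd Bu Bv) Buv) (evrD tau Bu Bv) (evrM tau Bu Bv su sv).
  have Br : B (u + v - (u \o v)) by apply: cstar_sub => //; exact: Badd.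
  have sr : sym (u + v - (u \o v)).
    by apply: sym_sub; [exact: sym_add|exact: Bsym].
  exists (u + v - (u \o v)); split.
  - split=> // tau; first by rewrite evE; have := hu tau; have := hv tau; nra.
    by move=> nU; rewrite evE uU // vU // mulr0 subr0 addr0.
  - apply: psd_ev; [exact: cstar_sub|exact: sym_sub|move=> tau].
    by rewrite (evrB tau Br Bu) evE; have := hu tau; have := hv tau; nra.
  - apply: psd_ev; [exact: cstar_sub|exact: sym_sub|move=> tau].
    by rewrite (evrB tau Br Bv) evE; have := hu tau; have := hv tau; nra.
- move=> u [Bu su hu uU]; have Buu := Bmul Bu Bu.
  exists ((2%:C : R[i]) *: u - (u \o u)); last first.
    by move=> x; rewrite !opE !rdotw -[(u \o u) x]/(u (u x)) (su (u x) x).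
  have evE tau : evr tau (2%:C *: u - (u \o u)) = 2 * evr tau u - evr tau u * evr tau u.
    by rewrite (evrB tau (Bscale _ Bu) Buu) (evrZ tau _ Bu) (evrM tau Bu Bu su su).
  split; [by apply: cstar_sub => //; exact: Bscale|by apply: sym_sub; [exact: sym_scale|exact: Bsym]| |].
    by move=> tau; rewrite evE; have := hu tau; nra.
  by move=> tau nU; rewrite evE uU // !mulr0 subr0.
Qed.

Definition openproj U : H -> H := projT1 (cid (below_sup U)).

Lemma openprojP U : is_sup_of (below U) (openproj U).
Proof. exact: (projT2 (cid (below_sup U))). Qed.

Lemma openproj_proj U : orthogonal_projection (openproj U).
Proof. exact: is_sup_proj (openprojP U). Qed.

Lemma B_commutant b : B b -> commutant B b.
Proof. by move=> Bb; split; [exact: Bbdd|move=> c Bc; exact: (cstar_comm cB)]. Qed.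

Lemma openproj_comm U a : commutant B a -> a \o openproj U = openproj U \o a.
Proof.
by move=> [ba ca]; apply: (is_sup_comm (openprojP U)) => // s [Bs _ _ _]; exact: ca.
Qed.

Lemma openproj_commutant U : commutant B (openproj U).
Proof.
split; first exact: proj_bdd (openproj_proj U).
by move=> b Bb; rewrite openproj_comm //; exact: B_commutant.
Qed.

Lemma openproj_mono U V : U `<=` V -> psd (openproj V - openproj U).
Proof.
move=> UV; apply: (is_sup_le (openprojP U)) => s [Bs ss hs sU].
by apply: (is_sup_ge (openprojP V)); split=> // tau nV; apply: sU => /UV.
Qed.

Lemma openproj_ker U y : openproj U y = 0 <-> forall u, below U u -> u y = 0.
Proof. by apply: (is_sup_kerE y (openprojP U)) => s; exact: below_effect. Qed.

(** A multiple of an element positive at a point exceeds 1 near that point;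
    finitely many of these cover K, and their sum exceeds 1 on K. *)
Lemma compact_cone (K : set (spectrum B)) (C : set (H -> H)) : compact K ->
  C 0 -> (forall u, C u -> [/\ B u, sym u & forall tau : spectrum B, 0 <= evr tau u]) ->
  (forall u v, C u -> C v -> C (u + v)) ->
  (forall (k : R) u, 0 < k -> C u -> C (k%:C *: u)) ->
  (forall tau, K tau -> exists2 u, C u & 0 < evr tau u) ->
  exists2 v, C v & forall tau, K tau -> 1 < evr tau v.
Proof.
move=> cK C0 CB CD CZ loc.
apply: (@compact_ideal _ K [set A | exists2 v, C v & forall tau, A tau -> 1 < evr tau v]) => //=.
- by exists 0.
- move=> A A' [v Cv hv] [v' Cv' hv']; exists (v + v'); first exact: CD.
  have [Bv sv pv] := CB v Cv; have [Bv' sv' pv'] := CB v' Cv'.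
  move=> tau; rewrite (evrD tau Bv Bv').
  by have := pv tau; have := pv' tau; move=> h1 h2 [/hv|/hv'] h3; lra.
- by move=> A A' AA' [v Cv hv]; exists v => // tau /AA'; exact: hv.
- move=> tau /loc[u Cu hu]; have [Bu su pu] := CB u Cu.
  pose v : H -> H := (2 / evr tau u)%:C *: u.
  have Cv : C v by apply: CZ => //; rewrite divr_gt0.
  have [Bv sv pv] := CB v Cv.
  have vtau : evr tau v = 2 by rewrite /v (evrZ tau _ Bu) divfK // gt_eqF.
  exists [set s | 1 < evr s v]; first by exists v.
  have := ev_continuous tau Bv (e := 1 / 2); rewrite divr_gt0 // => /(_ isT).
  apply: filterS => s hs /=.
  have := le_trans (rnorm_Re _) hs; rewrite raddfB /= -/(evr s v) -/(evr tau v) vtau.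
  by rewrite ler_norml => /andP[h1 h2]; lra.
Qed.

(** The positive part of u^2 - d u is at least u^2 - d u, so killing y for all
    d > 0 forces u^2 y = 0.  It vanishes where u <= d, that is, outside a compact
    set. *)
Lemma cut_ker u y : B u -> sym u -> (forall tau : spectrum B, 0 <= evr tau u) ->
  (forall (d : R) p, 0 < d -> B p -> sym p ->
     (forall tau : spectrum B, evr tau p = Num.max (evr tau u * evr tau u - d * evr tau u) 0) ->
     p y = 0) -> u y = 0.
Proof.
move=> Bu su pu h; apply: rdot_eq0; apply/eqP; rewrite eq_le rdot_ge0 andbT.
apply: (@le0_eps _ _ (rdot (u y) y)) => d d0.
have Buu := Bmul Bu Bu; have suu := Bsym Bu Bu su su.
pose q : H -> H := (u \o u) - d%:C *: u.
have Bq : B q by apply: cstar_sub => //; exact: Bscale.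
have sq : sym q by apply: sym_sub => //; exact: sym_scale.
have evq tau : evr tau q = evr tau u * evr tau u - d * evr tau u.
  by rewrite (evrB tau Buu (Bscale _ Bu)) (evrM tau Bu Bu su su) (evrZ tau _ Bu).
have [p [m [[Bp Bm] [sp sm] [qE pm0] [pp pm] evp]]] := cstar_posneg_ev Bq sq.
have py : p y = 0 by apply: (h d) => // tau; rewrite evp evq.
have := pm y; have := congr1 (fun f => rdot (f y) y) qE.
by rewrite /= /q !opE /= py !rdotw su; lra.
Qed.

(** Let w be below the union.  Up to a small error w is supported in the compact
    set where w >= d, and by compactness it is dominated there by an element v
    of B killing y, a positive combination of elements below the V i. *)
Lemma openproj_bigcup_ker (I : Type) (D : set I) (V : I -> set (spectrum B)) y :
  (forall i, D i -> open (V i)) -> (forall i, D i -> openproj (V i) y = 0) ->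
  openproj (\bigcup_(i in D) V i) y = 0.
Proof.
move=> oV h0; apply/openproj_ker => w [Bw sw hw wU].
have pw tau : 0 <= evr tau w by case/andP: (hw tau).
apply: cut_ker => // d p d0 Bp sp evp.
have pp : psd p by apply: psd_ev => // tau; rewrite evp le_max lexx orbT.
have cK := compact_ev_ge Bw d0.
pose C := [set u | [/\ B u, sym u, forall tau : spectrum B, 0 <= evr tau u & u y = 0]].
have [|||||v [Bv sv pv vy] hv] := @compact_cone _ C cK.
- split; [exact: cstar_0 cB|exact: sym_zero|by move=> tau; rewrite /evr ev0|by []].
- by move=> u [].
- move=> u v [Bu su pu uy] [Bv sv pv vy]; split; [exact: Badd|exact: sym_add| |].
    by move=> tau; rewrite (evrD tau Bu Bv) addr_ge0.
  by rewrite opE uy vy addr0.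
- move=> k u k0 [Bu su pu uy]; split; [exact: Bscale|exact: sym_scale| |].
    by move=> tau; rewrite (evrZ tau _ Bu) mulr_ge0 // ltW.
  by rewrite opE uy scaler0.
- move=> tau /= htau.
  have : (\bigcup_(i in D) V i) tau.
    apply: contrapT => /wU w0; move: htau.
    by rewrite ev_evr // w0 rnorm_real normr0; lra.
  move=> [i Di Vi]; have [u bu tu] := below_basis (oV i Di) Vi.
  exists u => //; have [Bu su hu _] := bu; split=> //.
    by move=> s; case/andP: (hu s).
  exact: (openproj_ker (V i) y).1 (h0 i Di) _ bu.
have pvp : psd (v - p).
  apply: psd_ev; [exact: cstar_sub|exact: sym_sub|move=> tau].
  rewrite (evrB tau Bv Bp) subr_ge0 evp ge_max pv andbT.
  have /andP[w0 w1] := hw tau.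
  have [hK|hK] := lerP d (rnorm (ev tau w)).
    by apply: le_trans (ltW (hv tau hK)); nra.
  move: hK; rewrite ev_evr // rnorm_real ger0_norm // => hK.
  by apply: le_trans (pv tau); nra.
apply: psd_form0 => //; first exact: Bbdd.
apply/eqP; rewrite eq_le pp andbT.
by have := pvp y; rewrite !opE vy !rdotw; lra.
Qed.

(** Some multiple of b^* b is below the whole spectrum, for every b in B. *)
Lemma openproj_setT : acts_nondegenerately B -> openproj setT = id.
Proof.
move=> nd; have pT := openproj_proj setT; apply: proj_eq_ker => //; first exact: proj_id.
move=> x; split=> [|->]; last exact: lin0 (proj_lin pT).
move=> /openproj_ker h; apply: nd => b Bb.
have [c Bc bc] := cstar_adjoint cB Bb.
have Bcb := Bmul Bc Bb; have scb := sym_adjmul bc.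
have ge0 (tau : spectrum B) : 0 <= evr tau (c \o b).
  by rewrite (ev_abs2 tau Bb Bc bc) sqr_ge0.
have [k k0 hk] := cstar_scale_effect Bcb scb ge0.
have : (k%:C *: (c \o b)) x = 0.
  by apply: h; split => //; [exact: Bscale|exact: sym_scale|by move=> tau []].
move=> /(congr1 (fun z => rdot z x)); rewrite /= opE rdotZl rdot0l (adjmul_dot _ bc).
by move=> /eqP; rewrite mulf_eq0 gt_eqF //= => /eqP /rdot_eq0.
Qed.

Lemma openproj_set0 : openproj set0 = 0.
Proof.
apply/funext => y; rewrite (_ : 0 y = 0) //; apply/openproj_ker => u [Bu su _ h].
by rewrite (ev_eq0 Bu su) // => tau; exact: h.
Qed.

(** The value at A is to be the infimum of the projections of the open sets
    containing A.  Monotone limits having been set up for increasing families,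
    complements are taken. *)
Definition outer_family A : set (H -> H) :=
  [set id - openproj V | V in [set V | open V /\ A `<=` V]].

Lemma outer_sup A : exists p, is_sup_of (outer_family A) p.
Proof.
have pV V : orthogonal_projection (id - openproj V).
  exact: proj_compl (openproj_proj V).
apply: sup_projection.
- by exists (id - openproj setT), setT => //; split=> //; exact: openT.
- by move=> _ [V _ <-]; exact: proj_effect.
- move=> _ _ [V [oV AV] <-] [W [oW AW] <-].
  exists (id - openproj (V `&` W)); split.
  + exists (V `&` W) => //; split; first exact: openI.
    by move=> t At; split; [exact: AV|exact: AW].
  + move=> x; have := @openproj_mono (V `&` W) V (@subIsetl _ _ _) x.
    by rewrite !opE !rdotw; lra.
  + move=> x; have := @openproj_mono (V `&` W) W (@subIsetr _ _ _) x.
    by rewrite !opE !rdotw; lra.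
- move=> _ [V hV <-]; exists (id - openproj V); first by exists V.
  by move=> x; rewrite (proj_dot _ (pV V)); lra.
Qed.

Definition outer A : H -> H := id - projT1 (cid (outer_sup A)).

Lemma outerP A : is_sup_of (outer_family A) (id - outer A).
Proof.
rewrite /outer (_ : id - _ = projT1 (cid (outer_sup A))); first exact: projT2.
by apply/funext => x; rewrite !opE opprB addrCA subrr addr0.
Qed.

Lemma outer_proj A : orthogonal_projection (outer A).
Proof. exact: proj_compl (is_sup_proj (projT2 (cid (outer_sup A)))). Qed.

Lemma outer_comm A a : commutant B a -> a \o outer A = outer A \o a.
Proof.
move=> ca; have [ba _] := ca; have la := bdd_lin ba.
have : a \o (id - outer A) = (id - outer A) \o a.
  apply: (is_sup_comm (outerP A)) => // _ [V _ <-].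
  apply/funext => x /=; rewrite !opE linB //; congr (_ - _).
  by rewrite -[LHS]/((a \o openproj V) x) openproj_comm.
move=> h; apply/funext => x; have := congr1 (@^~ x) h; rewrite /= !opE linB //.
by move=> /addrI/oppr_inj.
Qed.

Lemma outer_commutant A : commutant B (outer A).
Proof.
split; first exact: proj_bdd (outer_proj A).
by move=> b Bb; rewrite outer_comm //; exact: B_commutant.
Qed.

Lemma outer_commx A A' x : outer A (outer A' x) = outer A' (outer A x).
Proof.
by rewrite -[LHS]/((outer A \o outer A') x) outer_comm //; exact: outer_commutant.
Qed.

Lemma outer_B A b x : B b -> b (outer A x) = outer A (b x).
Proof. by move=> Bb; rewrite -[LHS]/((b \o outer A) x) outer_comm //; exact: B_commutant. Qed.

Lemma outer_le_open A V : open V -> A `<=` V -> psd (openproj V - outer A).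
Proof.
move=> oV AV x; have : psd ((id - outer A) - (id - openproj V)).
  by apply: (is_sup_ge (outerP A)); exists V.
by move=> /(_ x); rewrite !opE !rdotw; lra.
Qed.

Lemma outer_approx A x (e : R) : 0 < e ->
  exists V, [/\ open V, A `<=` V & rnorm (openproj V x - outer A x) <= e].
Proof.
move=> e0; have [_ [V [oV AV] <-] h] := is_sup_approx x (outerP A) e0.
exists V; split=> //; rewrite (_ : _ - _ = - ((id - openproj V) x - (id - outer A) x)).
  by rewrite rnormN.
by rewrite !opE; apply: rdotP => z; rewrite !rdotw; ring.
Qed.

Lemma outer_mono A A' : A `<=` A' -> psd (outer A' - outer A).
Proof.
move=> AA'; have : psd ((id - outer A) - (id - outer A')).
  apply: (is_sup_le (outerP A')) => _ [V [oV AV] <-]; apply: (is_sup_ge (outerP A)).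
  by exists V => //; split=> //; exact: subset_trans AV.
by move=> h x; have := h x; rewrite !opE !rdotw; lra.
Qed.

Lemma outer_open U : open U -> outer U = openproj U.
Proof.
move=> oU; apply: proj_le_antisym; [exact: outer_proj|exact: openproj_proj| |].
  exact: outer_le_open.
have : psd ((id - openproj U) - (id - outer U)).
  apply: (is_sup_le (outerP U)) => _ [V [oV UV] <-] x.
  by have := openproj_mono UV x; rewrite !opE !rdotw; lra.
by move=> h x; have := h x; rewrite !opE !rdotw; lra.
Qed.

(** After removing the part of x in the range of P(V), and then that in the range
    of P(W), nothing is left in the range of P(V `|` W). *)
Lemma openprojU_le V W x :
  open V -> open W -> rnorm (openproj (V `|` W) x) <= rnorm (openproj V x) + rnorm (openproj W x).
Proof.
move=> oV oW.
have [pV pW pU] := And3 (openproj_proj V) (openproj_proj W) (openproj_proj (V `|` W)).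
have VW y : openproj V (openproj W y) = openproj W (openproj V y).
  by rewrite -[LHS]/((openproj V \o openproj W) y) openproj_comm //; exact: openproj_commutant.
set y := x - openproj V x; set z := y - openproj W y.
have z0 : openproj (V `|` W) z = 0.
  rewrite -bigcup2E; apply: openproj_bigcup_ker => [i _|i _].
    by rewrite /bigcup2; case: i => [//|[//|i]]; exact: open0.
  rewrite /bigcup2; case: i => [|[|i]].
  - rewrite /z (linB _ _ (proj_lin pV)) VW /y (linB _ _ (proj_lin pV)) proj_idem //.
    by rewrite subrr (lin0 (proj_lin pW)) subr0.
  - by rewrite /z (linB _ _ (proj_lin pW)) proj_idem // subrr.
  - by rewrite openproj_set0.
have xE : x = openproj V x + (openproj W y + z).
  rewrite /z; move: (openproj W y) => w; rewrite /y.
  by apply: rdotP => t; rewrite !rdotw; ring.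
have -> : openproj (V `|` W) x = openproj (V `|` W) (openproj V x + openproj W y).
  by rewrite [LHS](congr1 _ xE) addrA (linD (_ + _) z (proj_lin pU)) z0 addr0.
apply: le_trans (proj_le _ pU) _; apply: le_trans (rnormD _ _) _.
rewrite lerD2l /y (linB _ _ (proj_lin pW)) -VW.
have -> : openproj W x - openproj V (openproj W x) = (id - openproj V) (openproj W x) by [].
exact: proj_le (proj_compl pV).
Qed.

(** Countable subadditivity, in the form it takes for projections.  Approximate
    A n from outside by an open V n with ||P(V n) y|| <= e / 2^(n+1): the norms of
    P y on finite unions of the V n stay below e, and those unions increase to
    an open set containing all A n. *)
Lemma outer_bigcup_ker (A : nat -> set (spectrum B)) y :
  (forall n, outer (A n) y = 0) -> outer (\bigcup_n A n) y = 0.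
Proof.
move=> A0; apply: (@eq_eps _ _ _ _ 2) => e e0; rewrite subr0.
have /choice[V hV] n : exists V, [/\ open V, A n `<=` V & rnorm (openproj V y) <= e / 2 ^+ n.+1].
  have [|V [oV AV h]] := @outer_approx (A n) y (e / 2 ^+ n.+1).
    by rewrite divr_gt0 // exprn_gt0.
  by exists V; split=> //; rewrite A0 subr0 in h.
pose W n : set (spectrum B) := \bigcup_(i in `I_n) V i.
have oW n : open (W n) by apply: bigcup_open => i _; have [] := hV i.
have W_S n : W n.+1 = W n `|` V n.
  by rewrite /W IIS bigcup_setU bigcup_set1.
have Wb n : rnorm (openproj (W n) y) <= e * (1 - 2 ^- n).
  elim: n => [|n IH]; first by rewrite /W II0 bigcup_set0 openproj_set0 rnorm0 expr0 invr1 subrr mulr0.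
  rewrite W_S; have [oV _ hn] := hV n.
  apply: le_trans (openprojU_le _ (oW n) oV) _.
  have -> : e * (1 - 2 ^- n.+1) = e * (1 - 2 ^- n) + e / 2 ^+ n.+1; last exact: lerD.
  by rewrite exprS; field; rewrite expf_neq0.
have Wm m n : (m <= n)%N -> psd (openproj (W n) - openproj (W m)).
  move=> mn; apply: openproj_mono => t [i /= im Vi]; exists i => //=.
  exact: leq_trans im mn.
have [Q hQ] := sup_increasing (fun n => openproj_proj (W n)) Wm.
pose VV := \bigcup_n V n.
have oVV : open VV by apply: bigcup_open => i _; have [] := hV i.
have QE : Q = openproj VV.
  apply: proj_eq_ker; [exact: is_sup_proj hQ|exact: openproj_proj|].
  move=> x; split=> [Qx|Vx].
    have -> : VV = \bigcup_n W n.
      rewrite eqEsubset; split=> t [n _].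
        by move=> Vt; exists n.+1 => //; exists n => /=.
      by move=> [i _ Vt]; exists i.
    apply: openproj_bigcup_ker => // n _.
    apply: proj_le_ker Qx; first exact: openproj_proj.
    by apply: (is_sup_ge hQ); exists n.
  apply: (is_sup_ker hQ) => _ [n _ <-]; apply: proj_le_ker Vx; first exact: openproj_proj.
  by apply: openproj_mono => t [i _ Vt]; exists i.
have [_ [n _ <-] hn] := is_sup_approx y hQ e0.
have h1 : rnorm (outer (\bigcup_n A n) y) <= rnorm (openproj VV y).
  apply: proj_le_rnorm; [exact: outer_proj|exact: openproj_proj|].
  by apply: outer_le_open => // t [i _ At]; exists i => //; have [_ + _] := hV i; apply.
rewrite QE rdistC in hn.
have h2 := rnormD (openproj VV y - openproj (W n) y) (openproj (W n) y).
rewrite subrK in h2; have h3 := Wb n.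
have h4 : e * (1 - 2 ^- n) <= e.
  by rewrite ler_piMr ?ltW // gerBl invr_ge0 exprn_ge0.
lra.
Qed.

Lemma outer_set0 : outer set0 = 0.
Proof. by rewrite outer_open ?openproj_set0 //; exact: open0. Qed.

End OpenProjections.

(** * The resolution of identity *)

Section Resolution.
Hypothesis nd : acts_nondegenerately B.

Local Notation P := outer.

Lemma outer_setT x : P setT x = x.
Proof. by rewrite outer_open ?openproj_setT //; exact: openT. Qed.

(** Let u be below U and p the cut of u at d: p vanishes on the open set V where
    u < d, which contains the complement of U.  So p P(V) = 0, while P(V) fixes
    the range of P(~` U). *)
Lemma outer_open_compl U x : open U -> P U (P (~` U) x) = 0.
Proof.
move=> oU; rewrite outer_open //; apply/openproj_ker => u [Bu su hu uU].
set y := P (~` U) x.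
have pu tau : 0 <= evr tau u by case/andP: (hu tau).
apply: cut_ker => // d p d0 Bp sp evp.
pose V := [set tau : spectrum B | rnorm (ev tau u) < d].
have oV : open V.
  rewrite openE => tau /= ht; rewrite /interior.
  have e0 : 0 < (d - rnorm (ev tau u)) / 2 by rewrite divr_gt0 // subr_gt0.
  apply: filterS (ev_continuous tau Bu e0) => s hs /=; rewrite /V /=.
  have := rnormD (ev s u - ev tau u) (ev tau u); rewrite subrK.
  by rewrite /V /= in ht; lra.
have UV : ~` U `<=` V.
  by move=> tau nU; rewrite /V /= ev_evr // uU // rnorm_real normr0.
have yV : openproj V y = y.
  by have [_ ->] := proj_le_fix x (outer_proj _) (openproj_proj V) (outer_le_open oV UV).
rewrite -yV -[p _]/((p \o openproj V) y) openproj_comm; last exact: B_commutant.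
apply/openproj_ker => v [Bv sv hv vV].
rewrite -[v (p y)]/((v \o p) y) (_ : v \o p = 0) //.
apply: ev_eq0; [exact: Bmul|exact: Bsym|move=> tau].
rewrite (evrM tau Bv Bp sv sp) evp.
have [ht|/vV ->] := pselect (V tau); last by rewrite mul0r.
rewrite (_ : Num.max _ _ = 0) ?mulr0 //; apply/max_idPr.
move: ht; rewrite /V /= ev_evr // rnorm_real ger0_norm // => ht.
by have := pu tau; nra.
Qed.

(** For a projection-valued outer measure this is Caratheodory's criterion:
    subadditivity gives P(A) \/ P(~` A) = 1, and additivity means
    orthogonality. *)
Definition splits A : Prop := forall x, P A (P (~` A) x) = 0.

Lemma splits_sigma : sigma_algebra [set: spectrum B] splits.
Proof.
split.
- by move=> x; rewrite outer_set0.
- by move=> A hA x; rewrite setTD setCK outer_commx; exact: hA.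
- move=> A hA x; apply: outer_bigcup_ker => n.
  have sub : ~` (\bigcup_n A n) `<=` ~` A n by move=> t nt At; apply: nt; exists n.
  have [_ <-] := proj_le_fix x (outer_proj _) (outer_proj _) (outer_mono sub).
  exact: hA.
Qed.

Lemma borel_splits A : borel A -> splits A.
Proof.
apply: smallest_sub; first exact: splits_sigma.
by move=> U oU x; exact: outer_open_compl.
Qed.

Lemma outer_disj A A' x : splits A -> A `&` A' = set0 -> P A (P A' x) = 0.
Proof.
move=> sA dA; have sub : A' `<=` ~` A by apply/disjoints_subset; rewrite setIC.
have [_ <-] := proj_le_fix x (outer_proj _) (outer_proj _) (outer_mono sub).
exact: sA.
Qed.

Lemma outer_add A A' x : splits A -> A `&` A' = set0 ->
  P (A `|` A') x = P A x + P A' x.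
Proof.
move=> sA dA; have [pA pA'] := (outer_proj A, outer_proj A').
have pU := outer_proj (A `|` A').
have fixA y : P (A `|` A') (P A y) = P A y.
  by have [] := proj_le_fix y pA pU (outer_mono (@subsetUl _ A A')).
have fixA' y : P (A `|` A') (P A' y) = P A' y.
  by have [] := proj_le_fix y pA' pU (outer_mono (@subsetUr _ A A')).
have : P (A `|` A') (x - (P A x + P A' x)) = 0.
  rewrite -bigcup2E; apply: outer_bigcup_ker => -[|[|n]] /=.
  - rewrite (linB _ _ (proj_lin pA)) (linD _ _ (proj_lin pA)) (proj_idem _ pA).
    by rewrite outer_disj // addr0 subrr.
  - rewrite (linB _ _ (proj_lin pA')) (linD _ _ (proj_lin pA')) (proj_idem _ pA').
    by rewrite outer_commx -/P outer_disj // add0r subrr.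
  - by rewrite outer_set0.
rewrite (linB _ _ (proj_lin pU)) (linD _ _ (proj_lin pU)) fixA fixA' => /eqP.
by rewrite subr_eq0 => /eqP.
Qed.

Lemma borel_open U : open U -> borel U.
Proof. by move=> oU; exact: sub_sigma_algebra. Qed.

(** Both P of the union and the strong limit of the P(S n) are projections with
    the same kernel, by countable subadditivity. *)
Lemma outer_countable_additive (F : nat -> set (spectrum B)) x :
  (forall n, borel (F n)) -> trivIset [set: nat] F ->
  series (diag_measure P x \o F) @ \oo --> diag_measure P x (\bigcup_n F n).
Proof.
move=> bF tF.
pose S n : set (spectrum B) := \bigcup_(i in `I_n) F i.
have SS n : S n.+1 = S n `|` F n by rewrite /S IIS bigcup_setU bigcup_set1.
have bS n : borel (S n).
  have sb := smallest_sigma_algebra [set: spectrum B] open.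
  elim: n => [|n IH]; first by rewrite /S II0 bigcup_set0; case: sb.
  rewrite SS -bigcup2E; case: sb => s0 _ sU; apply: sU => -[|[|m]] //=; exact: bF.
have dS n : S n `&` F n = set0.
  rewrite -subset0 => t [[i /= im Fi] Fn].
  have := trivIsetP.1 tF i n I I; rewrite neq_ltn im => /(_ isT) h.
  have : (F i `&` F n) t by split.
  by rewrite h.
have serE n : series (diag_measure P x \o F) n = rdot (P (S n) x) x.
  elim: n => [|n IH].
    by rewrite /series /= big_nil /S II0 bigcup_set0 outer_set0 rdot0l.
  rewrite seriesSr IH /= diag_rdot.
  by rewrite SS outer_add ?rdotDl //; exact: borel_splits.
have mS m n : (m <= n)%N -> psd (P (S n) - P (S m)).
  move=> mn; apply: outer_mono => t [i /= im Fi]; exists i => //=.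
  exact: leq_trans im mn.
have [Q hQ] := sup_increasing (fun n => outer_proj (S n)) mS.
have QE : Q = P (\bigcup_n F n).
  apply: proj_eq_ker; [exact: is_sup_proj hQ|exact: outer_proj|].
  move=> y; split=> [Qy|Fy].
    apply: outer_bigcup_ker => n; apply: proj_le_ker (_ : P (S n.+1) y = 0).
    - exact: outer_proj.
    - by apply: outer_mono => t Ft; exists n => /=.
    - apply: proj_le_ker Qy; first exact: outer_proj.
      by apply: (is_sup_ge hQ); exists n.+1.
  apply: (is_sup_ker hQ) => _ [n _ <-]; apply: proj_le_ker Fy; first exact: outer_proj.
  by apply: outer_mono => t [i _ Ft]; exists i.
apply/cvgrPdist_le => e e0.
have e1 : 0 < e / (rnorm x + 1) by rewrite divr_gt0 // ltr_wpDl // rnorm_ge0.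
have [_ [N _ <-] hN] := is_sup_near hQ x e1.
exists N => // n /= Nn; rewrite serE /diag_measure -/(rdot _ x) -QE -rdotNl -rdotDl.
apply: le_trans (rdot_CS _ _) _; rewrite rdistC.
have := hN (P (S n)) (ex_intro2 _ _ n I erefl) (mS _ _ Nn) => h.
apply: le_trans (ler_wpM2r (rnorm_ge0 x) h) _.
rewrite mulrAC ler_pdivrMr; last by rewrite ltr_wpDl // rnorm_ge0.
by rewrite ler_wpM2l ?lerDl // ltW.
Qed.

Hypothesis H_neq0 : exists x : H, x != 0.

Lemma spectrum_nonempty : [set: spectrum B] !=set0.
Proof.
have [x x0] := H_neq0.
have [b [Bb bx]] : exists b, B b /\ b x != 0.
  apply: contrapT => h; move/eqP: x0; apply; apply: nd => b Bb.
  by apply/eqP/negP => hx; apply: h; exists b; split => //; apply/negP.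
have [c Bc bc] := cstar_adjoint cB Bb.
have [|tau _] := @ev_separates (c \o b) (Bmul Bc Bb) (sym_adjmul bc); last by exists tau.
apply: contra_neq bx => cb0; apply: rdot_eq0.
by rewrite -(adjmul_dot x bc) cb0 rdot0l.
Qed.

Lemma outer_spectral : spectral_measure (@borel (spectrum B)) P.
Proof.
split.
- exact: smallest_sigma_algebra.
- exact: spectrum_nonempty.
- by move=> w _; exact: outer_proj.
- by apply/funext => x; exact: outer_setT.
- move=> x; split.
  + by rewrite /diag_measure outer_set0 -/(rdot _ x) rdot0l.
  + by move=> w _; rewrite /diag_measure -/(rdot _ x); exact: proj_psd (outer_proj w) x.
  + by move=> F bF tF; exact: outer_countable_additive.
Qed.

(** Let U be the open set where |b^ - z| > r; P(U) kills the range of P(A).  For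
    e below the whole spectrum, the positive part of (|b - z|^2 - r^2) e^2 lies
    in B and is, up to a factor, below U, so it kills this range too, and there
    |(b - z) e y| <= r |e y|.  Finally e tends strongly to 1. *)
Lemma outer_local A b (z : R[i]) (r : R) x : B b -> 0 <= r ->
  (forall tau, A tau -> rnorm (ev tau b - z) <= r) ->
  rnorm (b (P A x) - z *: P A x) <= r * rnorm (P A x).
Proof.
move=> Bb r0 hA; set y := P A x.
pose U := [set tau : spectrum B | r < rnorm (ev tau b - z)].
have oU : open U := open_ev_gt z r Bb.
have yU : openproj U y = 0.
  rewrite -(outer_open oU); have AU : A `<=` ~` U.
    by move=> tau /hA h; rewrite /U /=; apply/negP; rewrite -leNgt.
  rewrite /y; have [_ <-] := proj_le_fix x (outer_proj _) (outer_proj _) (outer_mono AU).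
  exact: outer_open_compl.
pose t : H -> H := b - z *: id.
have bt : bounded_operator t by apply: bdd_sub; [exact: Bbdd|exact/bdd_scale/bdd_id].
have key e : below [set: spectrum B] e -> rnorm (t (e y)) <= r * rnorm (e y).
  move=> [Be se he _].
  pose a : H -> H := (b \o e) - z *: e.
  have Ba : B a by apply: cstar_sub; [exact: Bmul|exact: Bscale].
  have eva tau : ev tau a = (ev tau b - z) * ev tau e.
    by rewrite /a (evB tau (Bmul Bb Be) (Bscale _ Be)) (evM tau Bb Be)
       (evZ tau _ Be) mulrBl.
  have [a' Ba' aa'] := cstar_adjoint cB Ba.
  have Baa := Bmul Ba' Ba; have saa := sym_adjmul aa'.
  have Bee := Bmul Be Be; have see := Bsym Be Be se se.
  pose q : H -> H := (a' \o a) - (r ^+ 2)%:C *: (e \o e).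
  have Bq : B q by apply: cstar_sub => //; exact: Bscale.
  have sq : sym q by apply: sym_sub => //; exact: sym_scale.
  have evq tau : evr tau q = (rnorm (ev tau b - z) ^+ 2 - r ^+ 2) * evr tau e ^+ 2.
    rewrite /q (evrB tau Baa (Bscale _ Bee)) (evrZ tau _ Bee).
    rewrite (ev_abs2 tau Ba Ba' aa') (evrM tau Be Be se se) eva rnormM.
    rewrite (ev_evr tau Be se) rnorm_real exprMn real_normK ?num_real //.
    by rewrite mulrBl expr2.
  have [p [m [[Bp Bm] [sp sm] [qE pm0] [pp pm] evp]]] := cstar_posneg_ev Bq sq.
  have evp0 tau : 0 <= evr tau p by rewrite evp le_max lexx orbT.
  have [k k0 hk] := cstar_scale_effect Bp sp evp0.
  have bk : below U (k%:C *: p).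
    split=> //; [exact: Bscale|exact: sym_scale|move=> tau nU].
    rewrite (evrZ tau _ Bp) evp (_ : Num.max _ _ = 0) ?mulr0 //.
    apply/max_idPr; rewrite evq; apply: mulr_le0_ge0; last exact: sqr_ge0.
    rewrite subr_le0 ler_pXn2r // ?nnegrE ?rnorm_ge0 //.
    by rewrite leNgt; apply/negP.
  have py : p y = 0.
    have /eqP := (openproj_ker U y).1 yU _ bk; rewrite opE scaler_eq0.
    by rewrite realC_eq0 gt_eqF //= => /eqP.
  rewrite -(rdot_le_norms _ _ r0).
  have qa : rdot (q y) y = rdot (a y) (a y) - r ^+ 2 * rdot (e y) (e y).
    rewrite /q !opE rdotDl rdotNl rdotZl (adjmul_dot y aa').
    by rewrite -[(e \o e) y]/(e (e y)) (se (e y)).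
  have qm : rdot (q y) y = - rdot (m y) y by rewrite qE !opE py sub0r rdotNl.
  by rewrite -[t (e y)]/(a y); have := pm y; lra.
have [M M0 hM] := bddP bt.
rewrite -[_ - _]/(t y).
apply: (@le_eps _ _ _) => d d0.
have d1 : 0 < d / M by rewrite divr_gt0.
have [e be he] := is_sup_approx y (openprojP setT) d1.
rewrite openproj_setT // in he.
have h1 := key e be; have h2 := effect_bdd (below_effect be).
have h3 : rnorm (e y) <= rnorm y.
  have [le_ se pe qe] := below_effect be.
  by have := effect_bound le_ se pe qe y; rewrite mul1r.
have h4 := hM (y - e y); rewrite (linB _ _ (bdd_lin bt)) in h4.
rewrite rdistC in he.
have h5 : M * rnorm (y - e y) <= d by rewrite -ler_pdivlMl // mulrC.
have h6 := rnormD (t y - t (e y)) (t (e y)); rewrite subrK in h6.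
have h7 := ler_wpM2l r0 h3.
lra.
Qed.

Lemma borel_gelfand (b : B) (U : set R[i]^o) : open U -> borel (gelfand b @^-1` U).
Proof.
by move=> oU; apply: borel_open; apply: open_comp => // t _; exact: gelfand_continuous.
Qed.

Lemma gelfand_bounded (b : B) : exists2 M : R, 0 < M & forall tau, rnorm (gelfand b tau) <= M.
Proof.
have Bb := set_valP b; have [M M0 hM] := bddP (Bbdd Bb); exists M => // tau.
by rewrite -evE; apply: ev_bound0 => //; exact: ltW.
Qed.

Lemma outer_integral (b : B) : is_norm_integral (@borel (spectrum B)) P (gelfand b) (val b).
Proof.
have Bb := set_valP b; have sP := outer_spectral.
have [M M0 hM] := gelfand_bounded b.
split; [by exists M|exact: borel_gelfand|].
move=> h c [n [z [w [Ew hE cE]]]].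
have [N hN] := step_bounded z w.
have hfin t : rnorm (gelfand b t - h t) <= M + N.
  by apply: le_trans (rnormB _ _) _; apply: lerD; [exact: hM|rewrite hE; exact: hN].
set r := supnorm _.
have hr t : rnorm (gelfand b t - h t) <= r by exact: (supnorm_ub t hfin).
have r0 : 0 <= r.
  by have [t _] := spectrum_nonempty; apply: le_trans (hr t); exact: rnorm_ge0.
apply: opnorm_le => // x.
have := @step_estimate _ _ _ _ _ sP (val b) (gelfand b) r (cstar_lin Bb) r0 _ _ n z w 0 setT Ew (sm_setT sP).
rewrite (spectral_setT sP) => est.
suff : rnorm (val b x - (0 *: x + (\sum_(i < n) z i *: P (w i)) x)) <= r * rnorm x.
  by rewrite scale0r add0r -cE.
apply: est.
- by move=> w' y _; exact: outer_B.
- move=> A u EA hA y; apply: outer_local => // tau At; rewrite evE; exact: hA.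
- move=> t _; have := hr t; rewrite hE sum_funE add0r; exact.
Qed.

Lemma outer_diag_mono A A' x : A `<=` A' -> diag_measure P x A <= diag_measure P x A'.
Proof.
by move=> AA'; have := outer_mono AA' x; rewrite !diag_rdot !opE !rdotw; lra.
Qed.

(** Approximating the complement of w from outside gives a closed C inside w.
    Cutting C down to the compact set K1 where u >= d, for some u below the whole
    spectrum with u x near x, loses little, as u is small off K1. *)
Lemma outer_regular x : inner_regular (diag_measure P x).
Proof.
move=> w bw; have sP := outer_spectral; have hs := spectrum_hausdorff.
have bK (K : set (spectrum B)) : compact K -> borel K.
  by move=> /(compact_closed hs) cK; rewrite -[K]setCK; apply: (sm_compl sP);
     apply: borel_open; exact: closed_openC.
apply/eqP; rewrite eq_le; apply/andP; split; last first.
  apply: ge_sup.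
    by exists (diag_measure P x set0), set0 => //; split; [exact: compact0|].
  by move=> _ [K [cK Kw] <-]; exact: outer_diag_mono.
have ubw : has_ubound [set diag_measure P x K | K in [set K | compact K /\ K `<=` w]].
  by exists (diag_measure P x w) => _ [K [cK Kw] <-]; exact: outer_diag_mono.
apply: (@le_eps _ _ _) => e e0.
pose k := rnorm x ^+ 2 + rnorm x + 1.
have k0 : 0 < k by rewrite ltr_wpDl // addr_ge0 ?sqr_ge0 // rnorm_ge0.
have xle : rnorm x <= k by rewrite /k; have := sqr_ge0 (rnorm x); lra.
have xxle : rnorm x * rnorm x <= k by rewrite /k; have := rnorm_ge0 x; nra.
have e1 : 0 < e / (3 * k) by rewrite divr_gt0 // mulr_gt0.
have [V [oV wV hV]] := outer_approx (~` w) x e1.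
pose C := ~` V.
have bC : borel C by apply: (sm_compl sP); exact: borel_open.
have Cw : C `<=` w by move=> t nV; apply: contrapT => /wV.
pose y := P C x.
have [u bu hu] := is_sup_approx y (openprojP setT) e1.
rewrite openproj_setT // rdistC in hu.
have [Bu su u01 _] := bu.
pose K1 := [set tau : spectrum B | e / (3 * k) <= rnorm (ev tau u)].
have cK1 : compact K1 := compact_ev_ge Bu e1.
have clC : closed C by exact: open_closedC.
have cK : compact (C `&` K1).
  apply: (subclosed_compact _ cK1); last exact: subIsetr.
  by apply: closedI => //; exact: compact_closed.
have : diag_measure P x (C `&` K1) <= sup [set diag_measure P x K | K in [set K | compact K /\ K `<=` w]].
  apply: ub_le_sup => //; exists (C `&` K1) => //; split=> //.
  by move=> t [Ct _]; exact: Cw.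
suff : diag_measure P x w <= diag_measure P x (C `&` K1) + e by lra.
rewrite !diag_rdot.
have small z : rnorm z <= e / (3 * k) -> `|rdot z x| <= e / 3.
  move=> hz; apply: le_trans (rdot_CS _ _) _.
  apply: (@le_trans _ _ (e / (3 * k) * k)).
    by apply: ler_pM => //; exact: rnorm_ge0.
  by rewrite le_eqVlt; apply/orP; left; apply/eqP; field; rewrite gt_eqF.
have d1 : `|rdot (P V x - P (~` w) x) x| <= e / 3.
  by apply: small; rewrite (outer_open oV).
have PV : P C x = x - P V x by rewrite -(sm_C sP x (borel_open oV)).
have Pw : P (~` w) x = x - P w x by rewrite (sm_C sP x bw).
have yE : y = P (C `&` K1) x + P (C `\` K1) x := sm_split sP x bC (bK _ cK1).
have fixz : P (~` K1) (P (C `\` K1) x) = P (C `\` K1) x.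
  apply: (sm_sub sP); [exact: (sm_setD sP) bC (bK _ cK1)|exact: (sm_compl sP) (bK _ cK1)|].
  by move=> t [].
have d2 : `|rdot (P (C `\` K1) y - u (P (C `\` K1) y)) x| <= e / 3.
  apply: small; rewrite [u (P _ y)]outer_B // -(linB _ _ (proj_lin (outer_proj _))).
  by apply: le_trans hu; exact: proj_le (outer_proj _).
have Py : P (C `\` K1) y = P (C `\` K1) x.
  have [] := proj_le_fix x (outer_proj (C `\` K1)) (outer_proj C) (outer_mono (@subDsetl _ C K1)).
  by [].
rewrite Py in d2.
have d3 : `|rdot (u (P (C `\` K1) x)) x| <= e / 3.
  rewrite -fixz; apply: le_trans (rdot_CS _ _) _.
  have := @outer_local (~` K1) u 0 (e / (3 * k)) (P (C `\` K1) x) Bu (ltW e1).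
  rewrite scale0r subr0 fixz => h.
  have : rnorm (u (P (C `\` K1) x)) <= e / (3 * k) * rnorm (P (C `\` K1) x).
    apply: h => tau; rewrite /K1 /= subr0 => /negP; rewrite -ltNge; exact: ltW.
  move=> h2.
  have h3 : rnorm (P (C `\` K1) x) <= rnorm x by exact: proj_le (outer_proj _).
  apply: (@le_trans _ _ (e / (3 * k) * (rnorm x * rnorm x))).
    rewrite mulrA ler_wpM2r ?rnorm_ge0 //; apply: le_trans h2 _.
    by rewrite ler_wpM2l // ltW.
  apply: (@le_trans _ _ (e / (3 * k) * k)); first by rewrite ler_wpM2l // ltW.
  by rewrite le_eqVlt; apply/orP; left; apply/eqP; field; rewrite gt_eqF.
have h : rdot (x - P V x) x = rdot (P (C `&` K1) x) x + rdot (P (C `\` K1) x) x.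
  by rewrite -PV -/y {1}yE rdotDl.
rewrite Pw in d1; rewrite !rdotw in h.
move: d1 d2 d3; rewrite !ler_norml !rdotw => /andP[k1 k2] /andP[k3 k4] /andP[k5 k6].
lra.
Qed.

End Resolution.

(** * Uniqueness *)

Section Uniqueness.

Variable Q : set (spectrum B) -> H -> H.
Hypothesis sQ : spectral_measure (@borel (spectrum B)) Q.
Hypothesis iQ : forall b : B, is_norm_integral (@borel (spectrum B)) Q (gelfand b) (val b).

(** The integral formula for the step function with values j / (n + 1) on the
    level sets of u^.  All level sets lie in U, so the operator c kills the range
    of Q(~` U). *)
Lemma step_approx U u (e : R) : open U -> below U u -> 0 < e ->
  exists c, [/\ bounded_operator c, opbound (u - c) e,
    forall a, bounded_operator a -> (forall w, borel w -> a \o Q w = Q w \o a) ->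
      a \o c = c \o a & forall x, c (Q (~` U) x) = 0].
Proof.
move=> oU [Bu su u01 uU] e0.
have [n hn] : exists n, n.+1%:R^-1 <= e.
  have := archi_boundP (x := e^-1); rewrite invr_ge0 ltW // => /(_ isT) h.
  exists (Num.bound e^-1); rewrite -[leRHS]invrK lef_pV2 ?posrE ?invr_gt0 //.
  by apply: ltW; apply: lt_trans h _; rewrite ltr_nat.
have N0 : 0 < n.+1%:R :> R by rewrite ltr0n.
pose w (j : 'I_n.+1) := [set tau : spectrum B | j%:R / n.+1%:R < evr tau u].
have wU j : w j `<=` U.
  move=> tau; apply: contraPP => /uU; rewrite /w /= => ->.
  by apply/negP; rewrite -leNgt divr_ge0.
have bw j : borel (w j).
  apply: borel_open; have -> : w j = [set tau | j%:R / n.+1%:R < rnorm (ev tau u - 0)].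
    apply/seteqP; split => tau; rewrite /w /= subr0 ev_evr // rnorm_real ger0_norm //;
      by case/andP: (u01 tau).
  exact: open_ev_gt.
pose k : R := n.+1%:R^-1.
pose c : H -> H := \sum_(j < n.+1) k%:C *: Q (w j).
have bc : bounded_operator c by exact: (step_bdd sQ (fun=> k%:C) bw).
exists c; split => //.
- have [_ _ /(_ (\sum_(j < n.+1) k%:C *: (\1_(w j) : spectrum B -> R[i]^o)) c)] := iQ (inB Bu).
  move=> h x; have {}h : opnorm (u - c) <= supnorm (gelfand (inB Bu) -
      \sum_(j < n.+1) k%:C *: (\1_(w j) : spectrum B -> R[i]^o)).
    by apply: h; exists n.+1, (fun=> k%:C), w; split.
  apply: le_trans (opbound_opnorm _ x) _; first by apply: bdd_sub => //; exact: Bbdd.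
  rewrite ler_wpM2r ?rnorm_ge0 //; apply: le_trans h _; apply: le_trans hn.
  apply: supnorm_le; first exact: spectral_nonempty sQ.
  move=> tau; have /andP[t0 t1] := u01 tau.
  rewrite -[(_ - _) tau]/(gelfand (inB Bu) tau - (\sum_(j < n.+1) _) tau) sum_funE -evE /=.
  have -> : \sum_(j < n.+1) ((k%:C *: (\1_(w j) : spectrum B -> R[i]^o)) tau : R[i]) =
      (k * \sum_(j < n.+1) ((j%:R < n.+1%:R * evr tau u)%R)%:R)%:C.
    rewrite rmorphM rmorph_sum /= mulr_sumr; apply: eq_bigr => j _.
    rewrite -[LHS]/(k%:C * _) indicE rmorph_nat; congr (_ * _%:R).
    congr nat_of_bool; rewrite -ltr_pdivrMl // mulrC.
    by apply/idP/idP => [/set_mem|/mem_set].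
  rewrite (ev_evr tau Bu su) -rmorphB rnorm_real.
  have /count_below/andP[] : 0 <= n.+1%:R * evr tau u <= n.+1%:R.
    by rewrite mulr_ge0 ?ler0n //= ler_piMr.
  set S := \sum_(j < n.+1) _ => h1 h2.
  have kN : k * n.+1%:R = 1 by rewrite /k mulVf // gt_eqF.
  have k0 : 0 <= k by rewrite /k invr_ge0 ltW.
  have h3 := ler_wpM2l k0 h1; have h4 := ler_wpM2l k0 h2.
  rewrite mulrDr mulrA kN mul1r mulr1 in h4; rewrite mulrA kN mul1r in h3.
  by rewrite ler_norml -/k; apply/andP; split; lra.
- move=> a ba ha; rewrite /c; apply: (@big_ind _ (fun c : H -> H => a \o c = c \o a)).
  + by apply/funext => x; rewrite /= !opE (lin0 (bdd_lin ba)).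
  + move=> f g hf hg; apply/funext => x; rewrite /= !opE (linD _ _ (bdd_lin ba)).
    by rewrite -[a (f x)]/((a \o f) x) hf -[a (g x)]/((a \o g) x) hg.
  + move=> j _; apply/funext => x; rewrite /= !opE (linZ _ _ (bdd_lin ba)).
    by rewrite -[a (Q _ x)]/((a \o Q (w j)) x) ha.
- move=> x; rewrite /c; apply: (@big_ind _ (fun c : H -> H => c (Q (~` U) x) = 0)) => //.
  + by move=> f g hf hg; rewrite opE hf hg addr0.
  + move=> j _; rewrite opE (sm_orth sQ) ?scaler0 //.
      exact: (sm_compl sQ) (borel_open oU).
    by apply/disjoints_subset; rewrite setCK; exact: wU.
Qed.

Lemma integral_comm U u a : open U -> below U u -> bounded_operator a ->
  (forall w, borel w -> a \o Q w = Q w \o a) -> a \o u = u \o a.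
Proof.
move=> oU bu ba ha; apply/funext => x /=; have [M M0 hM] := bddP ba.
have la := bdd_lin ba; have [Bu _ _ _] := bu.
apply: (@eq_eps _ _ _ _ (M * rnorm x + rnorm (a x))) => e e0.
have [c [bc hc ca _]] := step_approx oU bu e0.
have -> : a (u x) - u (a x) = a ((u - c) x) - (u - c) (a x).
  rewrite !opE (linB _ _ la) -[a (c x)]/((a \o c) x) ca //=.
  by rewrite opprB addrA subrK.
apply: le_trans (rnormB _ _) _.
have := hM ((u - c) x); have := hc x; have := hc (a x); move=> h1 h2 h3.
have := ler_wpM2l (ltW M0) h2; lra.
Qed.

Lemma integral_vanish U u x : open U -> below U u -> u (Q (~` U) x) = 0.
Proof.
move=> oU bu; apply: (@eq_eps _ _ _ _ (rnorm (Q (~` U) x))) => e e0.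
have [c [_ hc _ cU]] := step_approx oU bu e0; have := hc (Q (~` U) x).
by rewrite !opE cU; lra.
Qed.

(** By Cartesian decomposition and positive parts, B is spanned by its elements
    with values in [0, 1]. *)
Lemma comm_span a : bounded_operator a -> (forall u, below [set: spectrum B] u -> a \o u = u \o a) ->
  forall b, B b -> a \o b = b \o a.
Proof.
move=> ba ha b Bb; have la := bdd_lin ba.
have hp p : B p -> sym p -> psd p -> forall x, a (p x) = p (a x).
  move=> Bp sp pp x; have [k k0 hk] := cstar_scale_effect Bp sp (fun tau => evr_ge0 tau Bp sp pp).
  have : below [set: spectrum B] (k%:C *: p).
    by split=> //; [exact: Bscale|exact: sym_scale|move=> tau []].
  move=> /ha/(congr1 (@^~ x)); rewrite /= !opE linZ //; apply: scalerI.
  by rewrite realC_eq0 gt_eqF.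
have hs q : B q -> sym q -> forall x, a (q x) = q (a x).
  move=> Bq sq x; have [p [m [[Bp Bm] [sp sm] [-> _] [pp pm] _]]] := cstar_posneg_ev Bq sq.
  by rewrite !opE (linB _ _ la) (hp p Bp sp pp) (hp m Bm sm pm).
have [b1 [b2 [B1 B2 s1 s2 ->]]] := cstar_reim Bb.
apply/funext => x; rewrite /= !opE (linD _ _ la) (linZ _ _ la).
by rewrite (hs b1 B1 s1) (hs b2 B2 s2).
Qed.

Lemma integral_commB a : bounded_operator a ->
  (forall w, borel w -> a \o Q w = Q w \o a) -> forall b, B b -> a \o b = b \o a.
Proof.
move=> ba ha; apply: comm_span => // u bu; apply: (integral_comm openT bu ba ha).
Qed.

(** Equality of kernels.  One inclusion is integral_vanish.  For the other, let
    P(U) y = 0 and K compact in U: some positive v in B vanishing outside U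
    exceeds 1 on K.  Then v y = 0, and v commutes with Q K, so v kills Q K y;
    but v is bounded below on the range of Q K.  Inner regularity passes from
    the K to U. *)
Lemma integral_open (nd : acts_nondegenerately B)
    (rQ : forall x, inner_regular (diag_measure Q x)) U : open U -> Q U = openproj U.
Proof.
move=> oU; have bU := borel_open oU; have pU := spectral_projection sQ bU.
apply: proj_eq_ker => //; first exact: openproj_proj.
move=> y; split=> [Uy|Uy].
  apply/openproj_ker => u bu.
  have -> : y = Q (~` U) y by rewrite (sm_C sQ y bU) Uy subr0.
  exact: integral_vanish.
suff QK (K : set (spectrum B)) : compact K -> K `<=` U -> Q K y = 0.
  apply: proj_form0 => //; rewrite -diag_rdot (rQ y U bU).
  apply: ge_sup; first by exists (diag_measure Q y set0), set0 => //; split; [exact: compact0|].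
  by move=> _ [K [cK KU] <-]; rewrite diag_rdot QK // rdot0l.
move=> cK KU.
have bK : borel K.
  have := compact_closed (spectrum_hausdorff) cK.
  by move=> clK; rewrite -[K]setCK; apply: (sm_compl sQ); apply: borel_open; exact: closed_openC.
pose C := [set u | [/\ B u, sym u, forall tau : spectrum B, 0 <= evr tau u &
                       forall tau, ~ U tau -> evr tau u = 0]].
have [||||| v [Bv sv pv vU] hv] := @compact_cone K C cK.
- by split; [exact: cstar_0 cB|exact: sym_zero|move=> tau; rewrite /evr ev0|
     move=> tau _; rewrite /evr ev0].
- by move=> u [].
- move=> u v [Bu su pu uU] [Bv sv pv vU]; split; [exact: Badd|exact: sym_add| |].
    by move=> tau; rewrite (evrD tau Bu Bv) addr_ge0.
  by move=> tau nU; rewrite (evrD tau Bu Bv) uU // vU // addr0.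
- move=> k u k0 [Bu su pu uU]; split; [exact: Bscale|exact: sym_scale| |].
    by move=> tau; rewrite (evrZ tau _ Bu) mulr_ge0 // ltW.
  by move=> tau nU; rewrite (evrZ tau _ Bu) uU // mulr0.
- move=> tau Kt; have [u [Bu su u01 uU] ut] := below_basis oU (KU _ Kt).
  by exists u => //; split => // s; case/andP: (u01 s).
have vy : v y = 0.
  have [k k0 hk] := cstar_scale_effect Bv sv pv.
  have : below U (k%:C *: v).
    split => //; [exact: Bscale|exact: sym_scale|].
    by move=> tau nU; rewrite (evrZ tau _ Bv) vU // mulr0.
  move=> /((openproj_ker U y).1 Uy) /eqP; rewrite opE scaler_eq0.
  by rewrite realC_eq0 gt_eqF //= => /eqP.
have vQ : v (Q K y) = 0.
  have := @integral_commB (Q K) (proj_bdd (spectral_projection sQ bK)) _ v Bv.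
  move=> /(_ _)/(congr1 (@^~ y)) /= <-.
    by rewrite vy (lin0 (proj_lin (spectral_projection sQ bK))).
  by move=> w bw; apply/funext => x /=; rewrite (sm_comm sQ).
(* where v^ > 1 it is within (M - 1) / 2 of (M + 1) / 2, elsewhere within 1 / 2 of
   1 / 2, and 1 / 2 <= (M - 1) / 2; but v kills Q K y, on which the step operator
   acts as the scalar (M + 1) / 2 > (M - 1) / 2 *)
have [M0 M00 hM0] := gelfand_bounded (inB Bv).
pose M := Num.max M0 2.
have M2 : 2 <= M by rewrite le_max lexx orbT.
have vM tau : evr tau v <= M.
  rewrite le_max; apply/orP; left; apply: le_trans (ler_norm _) _.
  by apply: le_trans (rnorm_Re _) _; have := hM0 tau; rewrite -evE.
pose W := [set tau : spectrum B | 1 < evr tau v].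
have bW : borel W.
  apply: borel_open; have -> : W = [set tau | 1 < rnorm (ev tau v - 0)].
    by apply/seteqP; split => tau; rewrite /W /= subr0 ev_evr // rnorm_real ger0_norm.
  exact: open_ev_gt.
pose z (i : 'I_2) : R[i] := if i == ord0 then (M / 2)%:C else (1 / 2)%:C.
pose w (i : 'I_2) : set (spectrum B) := if i == ord0 then W else setT.
have bw i : borel (w i) by rewrite /w; case: ifP => _ //; exact: sm_setT sQ.
have [_ _ /(_ (\sum_(i < 2) z i *: (\1_(w i) : spectrum B -> R[i]^o))
   (\sum_(i < 2) z i *: Q (w i)))] := iQ (inB Bv).
move=> h; have {}h := h (ex_intro _ 2%N (ex_intro _ z (ex_intro _ w (And3 bw erefl erefl)))).
have bs := step_bdd sQ z bw.
have est : opnorm (v - \sum_(i < 2) z i *: Q (w i)) <= (M - 1) / 2.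
  apply: le_trans h _; apply: supnorm_le; first exact: spectral_nonempty sQ.
  move=> tau; rewrite -[(_ - _) tau]/(gelfand (inB Bv) tau - (\sum_(j < 2) _) tau) sum_funE -evE /=.
  rewrite big_ord_recl big_ord1 -[(z ord0 *: _) tau]/(_ * _) -[(z _ *: _) tau]/(_ * _).
  rewrite /z /w /= !indicE in_setT mulr1 ev_evr //.
  have [tW|tW] := boolP (tau \in W).
    rewrite mulr1 -rmorphD -rmorphB rnorm_real ler_norml; move/set_mem: tW; rewrite /W /= => tW.
    by have vt := vM tau; apply/andP; split; lra.
  rewrite mulr0 add0r -rmorphB rnorm_real ler_norml; move/negP: tW => tW.
  have : evr tau v <= 1 by rewrite leNgt; apply/negP => h1; apply: tW; exact: mem_set.
  by have pt := pv tau => vt; apply/andP; split; lra.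
have := le_trans (opbound_opnorm (bdd_sub (Bbdd Bv) bs) (Q K y))
  (ler_wpM2r (rnorm_ge0 (Q K y)) est).
rewrite big_ord_recl big_ord1 !opE vQ /z /w /= (sm_sub sQ _ bK bW); last first.
  by move=> tau Kt; apply: hv.
rewrite (spectral_setT sQ) /= -scalerDl -rmorphD sub0r rnormN rnormZ rnorm_real.
rewrite ger0_norm; last by lra.
move=> h1; apply: rnorm_eq0; apply/eqP; rewrite eq_le rnorm_ge0 andbT; lra.
Qed.

End Uniqueness.

End SpectralTheorem.

(** * The spectral theorem *)

Theorem theorem35p3 (R : realType) (H : hilbertType R) (B : set (H -> H))
    (H_neq0 : exists x : H, x != 0)
    (B_cstar : commutative_cstar_algebra B) (B_nondeg : acts_nondegenerately B) :
  exists P : set (spectrum B) -> H -> H,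
    [/\ resolution_of_identity P
          /\ (forall b : B, is_norm_integral (@borel (spectrum B)) P (gelfand b) (val b)),
        forall Q : set (spectrum B) -> H -> H,
          resolution_of_identity Q ->
          (forall b : B, is_norm_integral (@borel (spectrum B)) Q (gelfand b) (val b)) ->
          forall w, borel w -> Q w = P w,
        commutant B = commutant (P @` @borel (spectrum B)) &
        is_support P [set: spectrum B]].
Proof.
have sP := outer_spectral B_cstar B_nondeg H_neq0.
have iP := outer_integral B_cstar B_nondeg H_neq0.
have rP := outer_regular B_cstar B_nondeg H_neq0.
have hs := spectrum_hausdorff (B := B).
exists (outer B_cstar); split.
- split=> //; split=> //; exact: spectrum_locally_compact.
- move=> Q [_ _ sQ rQ] iQ w bw.
  have Qo U : open U -> Q U = outer B_cstar U.
    by move=> oU; rewrite (integral_open B_cstar sQ iQ) // outer_open.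
  have pw := spectral_projection sQ bw; have pw' := outer_proj B_cstar w.
  have QK x (K : set (spectrum B)) : compact K -> diag_measure Q x K = diag_measure (outer B_cstar) x K.
    move=> /(compact_closed hs) clK; rewrite !diag_rdot -[K]setCK.
    have oK := closed_openC clK; have bK := borel_open oK.
    by rewrite (sm_C sQ x bK) (sm_C sP x bK) Qo.
  apply: sym_eq; [exact: proj_lin|exact: proj_lin|exact: proj_sym|exact: proj_sym|].
  move=> x; rewrite -!diag_rdot (rQ x w bw) (rP x w bw); congr sup.
  by apply/seteqP; split=> _ [K [cK Kw] <-]; exists K => //; rewrite QK.
- apply/seteqP; split=> a [ba ca].
    by split=> // _ [w _ <-]; apply: outer_comm.
  split=> // b Bb; apply: (integral_commB B_cstar sP iP ba _ Bb) => w bw.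
  by apply: ca; exists w.
- exists set0; split; [exact: open0|exact: outer_set0| |by rewrite setC0].
  move=> v ov Pv0 tau vt; have [u bu ut] := below_basis B_cstar ov vt.
  have u0 : u = 0.
    apply/funext => x; apply: ((openproj_ker B_cstar v x).1 _ _ bu).
    by rewrite -outer_open // Pv0.
  by move: ut; rewrite u0 /evr (ev0 B_cstar) ltxx.
Qed.
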